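(* Let $\pi$ be a smooth irreducible representation of $G=\mathrm{GL}_2(F)$ over $\overline{\mathbb F}_p$ with central character. For every smooth irreducible representation $\pi'$ of $G$ with central character, one has $\pi\cong\pi'$ (as $G$-representations) if and only if $D(\pi)\cong D(\pi')$ as diagrams.
   Context: Let $p$ be a prime, $F$ a field complete for a discrete valuation with finite residue field of characteristic $p$, $\mathcal O$ its ring of integers, $\varpi$ a fixed uniformizer. $\overline{\mathbb F}_p$ is a fixed algebraically closed field of characteristic $p$; all representations are on $\overline{\mathbb F}_p$-vector spaces; smooth means that every vector is fixed by an open subgroup. Representations of $G$ are assumed to admit a central character. $G=\mathrm{GL}_2(F)$, $K=\mathrm{GL}_2(\mathcal O)$, $Z$ is the centre of $G$, $I\subset K$ is the subgroup of matrices upper triangular modulo $\varpi$, $\Pi=\begin{pmatrix}0&1\\ \varpi&0\end{pmatrix}$, $N$ is the normalizer of $I$ in $G$ (generated by $I$ and $\Pi$), and $P^+=\begin{pmatrix}\mathcal O-\{0\}&\mathcal O\\0&1\end{pmatrix}$ (a submonoid of $G$). A diagram is a triple $(D_0,D_1,r)$ with $D_0$ a smooth representation of $KZ$, $D_1$ a smooth representation of $N$, and $r:D_1\to D_0$ an $IZ$-equivariant map. A morphism $(D_0,D_1,r)\to(D_0',D_1',r')$ is a pair $(\varphi_0,\varphi_1)$ with $\varphi_0:D_0\to D_0'$ $KZ$-equivariant, $\varphi_1:D_1\to D_1'$ $N$-equivariant and $\varphi_0\circ r=r'\circ\varphi_1$. Canonical diagram: for $\pi$ smooth irreducible with central character,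 choose any irreducible $KZ$-subrepresentation $\sigma\subset\pi$; put $I^+(\pi)=\langle P^+\cdot\sigma\rangle$ (linear span of all $gx$, $g\in P^+,x\in\sigma$), $I^-(\pi)=\Pi\cdot I^+(\pi)$ (these do not depend on $\sigma$), $D_1(\pi)=I^+(\pi)\cap I^-(\pi)$ (stable by $N$), $D_0(\pi)=\langle K\cdot D_1(\pi)\rangle$, and $D(\pi)=(D_0(\pi),D_1(\pi),\mathrm{can})$ with $\mathrm{can}$ the inclusion $D_1(\pi)\hookrightarrow D_0(\pi)$. *)

(* Defs.v *)
From HB Require Import structures.
From mathcomp Require Import all_boot all_order all_algebra.
From mathcomp Require Import boolp classical_sets.
From mathcomp Require Import ring lra zify.

Set Implicit Arguments.
Unset Strict Implicit.
Unset Printing Implicit Defensive.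

Import Order.TTheory GRing.Theory Num.Theory.
Local Open Scope classical_set_scope.
Local Open Scope ring_scope.

(** The value of [lf_val] at [0] is unconstrained: "v x >= n" is always stated
    through [val_ge], which treats [0] as having infinite valuation.
    [lf_finite_residue] says that finitely many cosets of the maximal ideal
    cover the ring of integers, and [lf_residue_char] that [p] vanishes in the
    residue field; [F] itself may have characteristic [0] or [p]. *)
Definition val_ge (F : fieldType) (v : F -> int) (n : int) (x : F) : bool :=
  (x == 0) || (n <= v x).

Record local_field (p : nat) := LocalField {
  lf_field :> fieldType;
  lf_val : lf_field -> int;
  lf_valM : forall x y, x != 0 -> y != 0 ->
    lf_val (x * y) = lf_val x + lf_val y;
  lf_valD : forall x y, x != 0 -> y != 0 -> x + y != 0 ->
    Num.min (lf_val x) (lf_val y) <= lf_val (x + y);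
  lf_val_onto : exists x, x != 0 /\ lf_val x = 1;
  lf_complete : forall u : nat -> lf_field,
    (forall n : int, exists N, forall i j, (N <= i)%N -> (N <= j)%N ->
       val_ge lf_val n (u i - u j)) ->
    exists l, forall n : int, exists N, forall i, (N <= i)%N ->
       val_ge lf_val n (u i - l);
  lf_finite_residue : exists s : seq lf_field, forall x, val_ge lf_val 0 x ->
    exists2 y, y \in s & val_ge lf_val 1 (x - y);
  lf_residue_char : val_ge lf_val 1 p%:R
}.

Notation vge x n := (val_ge (@lf_val _ _) n x).

Record uniformizer (p : nat) (F : local_field p) := Uniformizer {
  unif_elt :> F;
  unif_neq0 : unif_elt != 0;
  unif_val : lf_val unif_elt = 1
}.

Section Valuation.
Context {p : nat} (F : local_field p).
Local Notation v := (@lf_val p F).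
Implicit Types x y : F.

Lemma vge0 n : val_ge v n 0. Proof. by rewrite /val_ge eqxx. Qed.

Lemma val1 : v 1 = 0.
Proof.
have := lf_valM (oner_neq0 F) (oner_neq0 F); rewrite mulr1 => h.
by apply: (addrI (v 1)); rewrite addr0 -h.
Qed.

Lemma vgeM n m x y : val_ge v n x -> val_ge v m y -> val_ge v (n + m) (x * y).
Proof.
rewrite /val_ge mulf_eq0; case: (eqVneq x 0) => //= x0.
by case: (eqVneq y 0) => //= y0; rewrite lf_valM //; lia.
Qed.

Lemma vgeD n x y : val_ge v n x -> val_ge v n y -> val_ge v n (x + y).
Proof.
rewrite /val_ge; case: (eqVneq x 0) => [->|x0] /=; first by rewrite add0r.
case: (eqVneq y 0) => [->|y0] /=; first by rewrite addr0 (negPf x0).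
case: (eqVneq (x + y) 0) => //= xy0 hx hy.
by apply: le_trans (lf_valD x0 y0 xy0); rewrite le_min hx hy.
Qed.

Lemma valN1 : v (-1) = 0.
Proof.
have n0 : (-1 : F) != 0 by rewrite oppr_eq0 oner_neq0.
have := lf_valM n0 n0; rewrite mulrNN mulr1 val1 => h.
by lia.
Qed.

Lemma vgeN n x : val_ge v n x -> val_ge v n (- x).
Proof.
move=> hx; have := @vgeM 0 n (-1) x; rewrite add0r mulN1r; apply => //.
by rewrite /val_ge valN1 lexx orbT.
Qed.

Lemma vgeB n x y : val_ge v n x -> val_ge v n y -> val_ge v n (x - y).
Proof. by move=> hx /vgeN; apply: vgeD. Qed.

Lemma vge_trans n m x : (m <= n)%R -> val_ge v n x -> val_ge v m x.
Proof. by rewrite /val_ge => h /orP[->//|h2]; rewrite (le_trans h h2) orbT. Qed.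

Lemma valV x : x != 0 -> v x^-1 = - v x.
Proof.
move=> x0; have := lf_valM x0 (invr_neq0 x0); rewrite divff // val1 => h.
by apply/eqP; rewrite -addr_eq0 addrC -h.
Qed.

End Valuation.

Section Groups.
Context {p : nat} (F : local_field p).
Local Notation v := (@lf_val p F).
Local Notation M2 := 'M[F]_2.

Definition mat2 (a b c d : F) : M2 :=
  \matrix_(i < 2, j < 2) (if i == 0 then if j == 0 then a else b
                          else if j == 0 then c else d).

Definition int_unit (x : F) : bool := (x != 0) && (v x == 0).

Definition GL2 : set M2 := [set g : M2 | g \in unitmx].
Definition centre : set M2 := [set g : M2 | exists2 a : F, a != 0 & g = a%:M].
Definition maxK : set M2 :=
  [set g : M2 | (forall i j, vge (g i j) 0) /\ int_unit (\det g)].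
Definition iwahori : set M2 := [set g : M2 | maxK g /\ vge (g 1 0) 1].
Definition setmul (A B : set M2) : set M2 :=
  [set g : M2 | exists x y, [/\ A x, B y & g = x *m y]].
Definition KZ : set M2 := setmul maxK centre.
Definition IZ : set M2 := setmul iwahori centre.
Definition normI : set M2 :=
  [set g : M2 | GL2 g /\ forall h, iwahori (g *m h *m invmx g) <-> iwahori h].
Definition Ppos : set M2 :=
  [set g : M2 | exists a b, [/\ a != 0, vge a 0, vge b 0 & g = mat2 a b 0 1]].
Definition Pi (w : uniformizer F) : M2 := mat2 0 1 w 0.

Definition is_subgroup (U : set M2) :=
  [/\ U `<=` GL2, U 1%:M, (forall g h, U g -> U h -> U (g *m h))
    & forall g, U g -> U (invmx g)].

(** Openness for the topology that [H] inherits from [M_2(F)]; on [GL2] this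
    is the usual topology, since inversion is continuous there. *)
Definition open_subgroup (H U : set M2) :=
  [/\ U `<=` H, is_subgroup U
    & forall g, U g -> exists n : int, forall h, H h ->
        (forall i j, vge (h i j - g i j) n) -> U h].

End Groups.

Arguments GL2 {p} F _.
Arguments centre {p} F _.
Arguments maxK {p} F _.
Arguments iwahori {p} F _.
Arguments KZ {p} F _.
Arguments IZ {p} F _.
Arguments normI {p} F _.
Arguments Ppos {p} F _.

Section GroupLemmas.
Context {p : nat} (F : local_field p).
Local Notation v := (@lf_val p F).
Local Notation M2 := 'M[F]_2.
Implicit Types (g h : M2) (a b c d : F).

Lemma ord2P (P : 'I_2 -> Prop) : P 0 -> P 1 -> forall i, P i.
Proof.
by move=> P0 P1 [[|[|//]] hi]; [move: P0|move: P1]; congr P; apply: val_inj.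
Qed.

Lemma mat2E g : g = mat2 (g 0 0) (g 0 1) (g 1 0) (g 1 1).
Proof. by apply/matrixP; do 2 apply: ord2P; rewrite !mxE. Qed.

Lemma mat200 a b c d : mat2 a b c d 0 0 = a. Proof. by rewrite mxE. Qed.
Lemma mat201 a b c d : mat2 a b c d 0 1 = b. Proof. by rewrite mxE. Qed.
Lemma mat210 a b c d : mat2 a b c d 1 0 = c. Proof. by rewrite mxE. Qed.
Lemma mat211 a b c d : mat2 a b c d 1 1 = d. Proof. by rewrite mxE. Qed.
Definition mat2s := (mat200, mat201, mat210, mat211).

Lemma mat2M a b c d a' b' c' d' : mat2 a b c d *m mat2 a' b' c' d' =
  mat2 (a * a' + b * c') (a * b' + b * d') (c * a' + d * c') (c * b' + d * d').
Proof.
apply/matrixP => i j; rewrite mxE big_ord_recl big_ord1 /=.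
have -> : lift ord0 ord0 = 1 :> 'I_2 by apply: val_inj.
by move: i j; do 2 apply: ord2P; rewrite !mxE.
Qed.

Lemma mat2_scalar a : a%:M = mat2 a 0 0 a.
Proof. by apply/matrixP; do 2 apply: ord2P; rewrite !mxE. Qed.

Lemma det_mat2 a b c d : \det (mat2 a b c d) = a * d - b * c.
Proof.
rewrite (expand_det_row _ 0) big_ord_recl big_ord1 /= /cofactor !det_mx11 !mxE.
by rewrite /=; ring.
Qed.

Lemma det2E g : \det g = g 0 0 * g 1 1 - g 0 1 * g 1 0.
Proof. by rewrite {1}[g]mat2E det_mat2. Qed.

Lemma GL2E g : GL2 F g <-> \det g != 0.
Proof. by rewrite /GL2 /= unitmxE unitfE. Qed.

Lemma mat2V a b c d : a * d - b * c != 0 ->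
  let D := a * d - b * c in
  invmx (mat2 a b c d) = mat2 (d / D) (- b / D) (- c / D) (a / D).
Proof.
move=> D0 D; have gU : mat2 a b c d \in unitmx.
  by apply/GL2E; rewrite det_mat2.
apply: (can_inj (mulKmx gU)); rewrite mulmxV // mat2M mat2_scalar.
by congr mat2; rewrite /D; field.
Qed.

Lemma maxK_mat2 a b c d : maxK F (mat2 a b c d) <->
  [/\ vge a 0, vge b 0, vge c 0 & vge d 0] /\ int_unit (a * d - b * c).
Proof.
rewrite /maxK /= det_mat2; split=> -[h ?]; split=> //.
  by split; [have := h 0 0|have := h 0 1|have := h 1 0|have := h 1 1];
    rewrite mat2s.
by case: h => ????; do 2 apply: ord2P; rewrite mat2s.
Qed.

Lemma iwahori_mat2 a b c d : iwahori F (mat2 a b c d) <->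
  [/\ vge a 0, vge b 0, vge c 1 & vge d 0] /\ int_unit (a * d - b * c).
Proof.
rewrite /iwahori /= maxK_mat2 mat2s; split.
  by move=> [[[]]].
by move=> [[????]?]; do 3 split=> //; apply: vge_trans (_ : val_ge v 1 c).
Qed.

Lemma int_unitM a b : int_unit a -> int_unit b -> int_unit (a * b).
Proof.
rewrite /int_unit => /andP[a0 /eqP va] /andP[b0 /eqP vb].
by rewrite mulf_neq0 // lf_valM // va vb.
Qed.

Lemma int_unitV a : int_unit a -> int_unit a^-1.
Proof.
by rewrite /int_unit => /andP[a0 /eqP va]; rewrite invr_neq0 // valV // va.
Qed.

Lemma int_unit_ge a : int_unit a -> vge a 0.
Proof. by rewrite /val_ge => /andP[_ /eqP->]; rewrite lexx orbT. Qed.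

Lemma int_unit1 : int_unit (1 : F).
Proof. by rewrite /int_unit oner_neq0 val1. Qed.

(* a unit plus an element of the maximal ideal is a unit *)
Lemma int_unitD a b : int_unit a -> vge b 1 -> int_unit (a + b).
Proof.
move=> /andP[a0 /eqP va]; rewrite /val_ge; case: (eqVneq b 0) => [->|b0] /=.
  by rewrite addr0 /int_unit a0 va.
move=> vb; have ab0 : a + b != 0.
  apply: contraTneq vb => /eqP; rewrite addr_eq0 => /eqP e.
  have : v a = v b.
    rewrite e -mulN1r lf_valM ?valN1 ?add0r// oppr_eq0; exact: oner_neq0.
  by rewrite va => <-.
rewrite /int_unit ab0 /=.
have h1 := lf_valD a0 b0 ab0; rewrite va in h1.
have nb0 : - b != 0 by rewrite oppr_eq0.
have vnb : v (- b) = v b.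
  by rewrite -mulN1r lf_valM ?valN1 ?add0r// oppr_eq0; exact: oner_neq0.
have := lf_valD ab0 nb0; rewrite addrK => /(_ a0); rewrite va vnb.
move: h1 vb; move: (v b) (v (a + b)) => x y.
by case: leP; case: leP; lia.
Qed.

Lemma maxKM g h : maxK F g -> maxK F h -> maxK F (g *m h).
Proof.
move=> [g0 gd] [h0 hd]; split; last by rewrite det_mulmx int_unitM.
move=> i j; rewrite mxE big_ord_recl big_ord1.
by apply: vgeD; rewrite -(addr0 0); apply: vgeM.
Qed.

Lemma maxKV g : maxK F g -> maxK F (invmx g).
Proof.
rewrite [g]mat2E; set a := g 0 0; set b := g 0 1; set c := g 1 0.
set d := g 1 1 => /maxK_mat2[[ha hb hc hd] hD].
have D0 : a * d - b * c != 0 by case/andP: hD.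
rewrite mat2V //; apply/maxK_mat2; have /int_unit_ge hDV := int_unitV hD.
have M0 x : vge x 0 -> vge (x / (a * d - b * c)) 0.
  by move=> hx; rewrite -(addr0 0); apply: vgeM.
split; first by split; apply: M0 => //; apply: vgeN.
have -> : d / (a * d - b * c) * (a / (a * d - b * c)) -
  - b / (a * d - b * c) * (- c / (a * d - b * c)) = (a * d - b * c)^-1.
  by field.
exact: int_unitV.
Qed.

Lemma maxK1 : maxK F 1%:M.
Proof.
rewrite mat2_scalar; apply/maxK_mat2; have h := int_unit_ge int_unit1.
by split; rewrite ?mulr0 ?subr0 ?mulr1 ?int_unit1 //; split; rewrite ?vge0.
Qed.

Lemma maxK_GL2 g : maxK F g -> GL2 F g.
Proof. by move=> [_ /andP[h _]]; apply/GL2E. Qed.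

Lemma iwahori_maxK g : iwahori F g -> maxK F g. Proof. by case. Qed.

Lemma iwahori1 : iwahori F 1%:M.
Proof. by split; [exact: maxK1|rewrite mat2_scalar mat2s vge0]. Qed.

Lemma iwahoriM g h : iwahori F g -> iwahori F h -> iwahori F (g *m h).
Proof.
move=> [gK g1] [hK h1]; split; first exact: maxKM.
rewrite mxE big_ord_recl big_ord1 /=.
have -> : lift ord0 ord0 = 1 :> 'I_2 by apply: val_inj.
apply: vgeD; first by rewrite -(addr0 1); apply: vgeM => //; apply: hK.1.
by rewrite -(add0r 1); apply: vgeM => //; apply: gK.1.
Qed.

Lemma iwahoriV g : iwahori F g -> iwahori F (invmx g).
Proof.
move=> [gK g1]; split; first exact: maxKV.
have gd := gK.2; have g0 : \det g != 0 by case/andP: gd.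
move: g1 gd g0; rewrite [in invmx g](mat2E g) det2E => g1 gd g0.
rewrite mat2V // mat2s -(addr0 1); apply: vgeM; first exact: vgeN.
by apply: int_unit_ge; apply: int_unitV.
Qed.

Lemma centre_GL2 g : centre F g -> GL2 F g.
Proof. by move=> [a a0 ->]; apply/GL2E; rewrite det_scalar expf_neq0. Qed.

Lemma centreC g h : centre F g -> g *m h = h *m g.
Proof. by move=> [a _ ->]; rewrite mul_scalar_mx mul_mx_scalar. Qed.

Lemma centre1 : centre F 1%:M. Proof. by exists 1; rewrite ?oner_neq0. Qed.

Lemma centreM g h : centre F g -> centre F h -> centre F (g *m h).
Proof.
move=> [a a0 ->] [b b0 ->]; exists (a * b); first exact: mulf_neq0.
by rewrite scalar_mxM.
Qed.

Lemma centreV g : centre F g -> centre F (invmx g).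
Proof.
move=> [a a0 ->]; exists a^-1; first by rewrite invr_neq0.
by rewrite invmx_scalar.
Qed.

Lemma GL2M g h : GL2 F g -> GL2 F h -> GL2 F (g *m h).
Proof. by rewrite /GL2 /= unitmx_mul => -> ->. Qed.

Lemma GL2V g : GL2 F g -> GL2 F (invmx g).
Proof. by rewrite /GL2 /= unitmx_inv. Qed.

Lemma invmxM g h : GL2 F g -> GL2 F h -> invmx (g *m h) = invmx h *m invmx g.
Proof.
move=> gU hU; have ghU := GL2M gU hU.
apply: (can_inj (mulKmx ghU)); rewrite mulmxV // !mulmxA -(mulmxA g).
by rewrite mulmxV // mulmx1 mulmxV.
Qed.

Lemma KZ_subgroup : is_subgroup (KZ F).
Proof.
split.
- by move=> _ [k [z [/maxK_GL2 kK /centre_GL2 zZ ->]]]; apply: GL2M.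
- by exists 1%:M, 1%:M; split; [exact: maxK1|exact: centre1|rewrite mulmx1].
- move=> _ _ [k [z [kK zZ ->]]] [k' [z' [kK' zZ' ->]]].
  exists (k *m k'), (z *m z'); split; [exact: maxKM|exact: centreM|].
  by rewrite -!mulmxA (mulmxA z) (centreC k') // !mulmxA.
- move=> _ [k [z [kK zZ ->]]]; exists (invmx k), (invmx z).
  split; [exact: maxKV|exact: centreV|].
  rewrite invmxM; first exact/centreC/centreV.
    exact: maxK_GL2.
  exact: centre_GL2.
Qed.

Lemma normI_subgroup : is_subgroup (normI F).
Proof.
split.
- by move=> g [].
- by split=> [|h]; [exact: unitmx1|rewrite invmx1 mul1mx mulmx1].
- move=> g h [gU hg] [hU hh]; split=> [|k]; first exact: GL2M.
  rewrite invmxM //.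
  have -> : g *m h *m k *m (invmx h *m invmx g)
            = g *m (h *m k *m invmx h) *m invmx g by rewrite !mulmxA.
  exact: iff_trans (hg _) (hh _).
- move=> g [gU hg]; split=> [|k]; first exact: GL2V.
  have := hg (invmx g *m k *m g); rewrite invmxK.
  rewrite !mulmxA mulmxV // mul1mx -mulmxA mulmxV // mulmx1.
  exact: iff_sym.
Qed.

Lemma IZ_KZ g : IZ F g -> KZ F g.
Proof. by move=> [i [z [[iK _] zZ ->]]]; exists i, z. Qed.

Lemma IZ_normI g : IZ F g -> normI F g.
Proof.
move=> [i [z [iI zZ ->]]]; have iG := maxK_GL2 (iwahori_maxK iI).
have zG := centre_GL2 zZ; split=> [|h]; first exact: GL2M.
have -> : i *m z *m h *m invmx (i *m z) = i *m h *m invmx i.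
  rewrite invmxM // -(mulmxA i) (centreC h zZ) !mulmxA.
  by rewrite -(mulmxA _ z) mulmxV // mulmx1.
split=> [hI|hI]; last by apply: iwahoriM (iwahoriV iI); apply: iwahoriM.
have := iwahoriM (iwahoriM (iwahoriV iI) hI) iI.
by rewrite !mulmxA mulVmx // mul1mx -mulmxA mulVmx // mulmx1.
Qed.

Lemma Pi_GL2 (w : uniformizer F) : GL2 F (Pi w).
Proof.
by apply/GL2E; rewrite det_mat2 mul0r sub0r mul1r oppr_eq0 unif_neq0.
Qed.

Lemma PiV (w : uniformizer F) : invmx (Pi w) = mat2 0 (w : F)^-1 1 0.
Proof.
have w0 := unif_neq0 w.
rewrite mat2V ?mul0r ?sub0r ?mul1r ?oppr_eq0 //.
by rewrite invrN !mulrNN mul1r divff.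
Qed.

Lemma Pi_sqr (w : uniformizer F) : Pi w *m Pi w = (w : F)%:M.
Proof. rewrite mat2M mat2_scalar.
by rewrite !mul0r !mulr0 !mul1r !mulr1 !addr0 !add0r. Qed.

Lemma Pi_conj (w : uniformizer F) g :
  iwahori F g -> iwahori F (invmx (Pi w) *m g *m Pi w).
Proof.
have w0 := unif_neq0 w; have vw := unif_val w.
rewrite [g]mat2E PiV; set a := g 0 0; set b := g 0 1; set c := g 1 0.
set d := g 1 1 => /iwahori_mat2[[ha hb hc hd] hD].
rewrite !mat2M; apply/iwahori_mat2; split; last first.
  by move: hD; congr int_unit; field.
split.
- by move: hd; congr val_ge; field.
- have -> : (0 * a + (w : F)^-1 * c) * 1 + (0 * b + (w : F)^-1 * d) * 0
      = c * (w : F)^-1 by ring.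
  rewrite (_ : 0 = 1 + (- 1))//; apply: vgeM => //.
  by rewrite /val_ge valV // vw lexx orbT.
- have -> : (1 * a + 0 * c) * 0 + (1 * b + 0 * d) * (w : F) = (w : F) * b.
    by ring.
  rewrite -(addr0 1); apply: vgeM => //.
  by rewrite /val_ge vw lexx orbT.
- by move: ha; congr val_ge; ring.
Qed.

Lemma val_onto (n : int) : exists2 x : F, x != 0 & v x = n.
Proof.
have [x [x0 vx]] := lf_val_onto F.
elim: n => [|n [y y0 vy]|n [y y0 vy]]; first by exists 1; rewrite ?oner_neq0 ?val1.
- exists (x * y); first exact: mulf_neq0.
  by rewrite lf_valM // vx vy; lia.
- exists (x^-1 * y); first by rewrite mulf_neq0 ?invr_neq0.
  by rewrite lf_valM ?invr_neq0 // valV // vx vy; lia.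
Qed.

Lemma vge_sqr a c (k l : int) : c != 0 ->
  vge (a * a / c) k -> l + l <= v c + k + 1 -> vge a l.
Proof.
move=> c0; rewrite /val_ge !mulf_eq0 invr_eq0 (negPf c0) orbF orbb.
case: (eqVneq a 0) => //= a0; rewrite !lf_valM ?mulf_neq0 ?invr_neq0 // valV //.
by move: (v a) (v c) => x y; lia.
Qed.

Lemma int_halve (n : int) : exists m, n = m + m \/ n = m + m + 1.
Proof.
exists (n %/ 2)%Z; have := divz_eq n 2; have := @modz_ge0 n 2 isT.
have := @ltz_pmod n 2 isT; move: (_ %% _)%Z (_ %/ _)%Z => r m; lia.
Qed.

Lemma normI_dec (w : uniformizer F) g : normI F g ->
  exists i z, [/\ iwahori F i, centre F z & g = i *m z \/ g = Pi w *m i *m z].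
Proof.
have w0 := unif_neq0 w; have vw := unif_val w.
rewrite [g]mat2E; move: (g 0 0) (g 0 1) (g 1 0) (g 1 1) => a b c d.
move=> [/GL2E]; rewrite det_mat2; set D := a * d - b * c => D0 gI.
have u1 : int_unit (1 : F) := int_unit1.
have o1 : vge (1 : F) 0 := int_unit_ge u1.
have e12 : iwahori F (mat2 1 1 0 1).
  apply/iwahori_mat2; split; first by split; rewrite ?vge0.
  by rewrite mulr0 subr0 mulr1.
have e21 : iwahori F (mat2 1 0 w 1).
  apply/iwahori_mat2; split; last by rewrite mul0r subr0 mulr1.
  by split; rewrite ?vge0 // /val_ge vw lexx orbT.
move/gI: e12; move/gI: e21.
rewrite mat2V // !mat2M -/D.
move=> /iwahori_mat2[[_ h2 h3 _] _] /iwahori_mat2[[_ h5 h6 _] _].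
have {h5} ha : vge (a * a / D) 0 by move: h5; congr val_ge; field.
have {h6} hc : vge (c * c / D) 1.
  by move/vgeN: h6; congr val_ge; field.
have wN1 : vge (w : F)^-1 (-1) by rewrite /val_ge valV // vw lexx orbT.
have {h2} hb : vge (b * b / D) (- 1).
  rewrite -(addr0 (- 1)); have := vgeM wN1 (vgeN h2).
  by congr val_ge; field; rewrite w0 D0.
have {h3} hd : vge (d * d / D) 0.
  rewrite -(addNr 1); have := vgeM wN1 h3.
  by congr val_ge; field; rewrite w0 D0.
have [m eDm] := int_halve (v D).
have [z z0 vz] := val_onto m.
have zV0 : z^-1 != 0 by rewrite invr_neq0.
have vzV : v z^-1 = - m by rewrite valV // vz.
have zz : vge z^-1 (- m) by rewrite /val_ge vzV lexx orbT.
have vDz : v (D / z / z) = v D - m - m.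
  by rewrite !lf_valM ?mulf_neq0 // vzV.
case: eDm => eD.
- exists (mat2 (a / z) (b / z) (c / z) (d / z)), z%:M; split.
  + apply/iwahori_mat2; split.
      split; [have h := vge_sqr D0 ha|have h := vge_sqr D0 hb
             |have h := vge_sqr D0 hc|have h := vge_sqr D0 hd].
      * by rewrite -(subrr m); apply: vgeM zz; apply: h; rewrite eD; clear; lia.
      * by rewrite -(subrr m); apply: vgeM zz; apply: h; rewrite eD; clear; lia.
      * rewrite (_ : 1 = (m + 1) - m); last by clear; lia.
        by apply: vgeM zz; apply: h; rewrite eD; clear; lia.
      * by rewrite -(subrr m); apply: vgeM zz; apply: h; rewrite eD; clear; lia.
    have -> : a / z * (d / z) - b / z * (c / z) = D / z / z.
      by rewrite /D; field.
    by rewrite /int_unit !mulf_neq0 // vDz eD; clear; lia.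
  + by exists z.
  + left; rewrite mat2_scalar mat2M; congr mat2; field; exact: z0.
- exists (mat2 (c / (w : F) / z) (d / (w : F) / z) (a / z) (b / z)), z%:M; split.
  + apply/iwahori_mat2; split.
      split; [have h := vge_sqr D0 hc|have h := vge_sqr D0 hd
             |have h := vge_sqr D0 ha|have h := vge_sqr D0 hb].
      * rewrite (_ : 0 = (m + 1) + (- 1) - m); last by clear; lia.
        by apply: vgeM zz; apply: vgeM wN1; apply: h; rewrite eD; clear; lia.
      * rewrite (_ : 0 = (m + 1) + (- 1) - m); last by clear; lia.
        by apply: vgeM zz; apply: vgeM wN1; apply: h; rewrite eD; clear; lia.
      * rewrite (_ : 1 = (m + 1) - m); last by clear; lia.
        by apply: vgeM zz; apply: h; rewrite eD; clear; lia.
      * by rewrite -(subrr m); apply: vgeM zz; apply: h; rewrite eD; clear; lia.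
    have -> : c / (w : F) / z * (b / z) - d / (w : F) / z * (a / z) =
              -1 * (w : F)^-1 * (D / z / z).
      by rewrite /D; field; rewrite w0 z0.
    have n1 : (-1 : F) != 0 by rewrite oppr_eq0 oner_neq0.
    rewrite /int_unit !mulf_neq0 ?invr_neq0 //= !lf_valM ?mulf_neq0 ?invr_neq0 //.
    by rewrite valN1 !valV // vw vz eD; clear; lia.
  + by exists z.
  + right; rewrite mat2_scalar !mat2M.
    by congr mat2; field; rewrite ?w0 z0.
Qed.

(* [I P^+] is contained in [P^+ K Z] *)
Lemma iwahori_Ppos g h : iwahori F g -> Ppos F h ->
  exists h' k, [/\ Ppos F h', KZ F k & g *m h = h' *m k].
Proof.
rewrite [g]mat2E; set a := g 0 0; set b := g 0 1; set c := g 1 0.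
set d := g 1 1 => /iwahori_mat2[[ha hb hc hd] hD] [t [u [t0 ht hu ->]]].
set D := a * d - b * c in hD; set e := c * u + d.
have hcu : vge (c * u) 1 by rewrite -(addr0 1); apply: vgeM.
have hc0 : vge c 0 by apply: vge_trans hc.
have /andP[] := hD; rewrite /D => D0 vD.
have vM x y : vge x 0 -> vge y 0 -> vge (x * y) 0.
  by move=> hx hy; rewrite -(addr0 0); apply: vgeM.
(* [a d] is a unit because [b c] lies in the maximal ideal *)
have had : int_unit (a * d).
  rewrite -(subrK (b * c) (a * d)); apply: int_unitD => //.
  by rewrite -(add0r 1); apply: vgeM.
have d_unit : int_unit d.
  move: had; rewrite /int_unit mulf_eq0 negb_or => /andP[/andP[a0 d0]].
  rewrite d0 lf_valM //; move: ha hd; rewrite /val_ge (negPf a0) (negPf d0) /=.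
  by move: (v a) (v d) => x y; lia.
have e_unit : int_unit e by rewrite /e addrC; apply: int_unitD.
have e0 : e != 0 by case/andP: e_unit.
have eV := int_unit_ge (int_unitV e_unit).
exists (mat2 t ((a * u + b) / e) 0 1).
exists (mat2 (D / e / e) 0 (c * t / e) 1 *m e%:M); split.
- exists t, ((a * u + b) / e); split=> //.
  by apply: (vM) => //; apply: vgeD => //; apply: (vM).
- exists (mat2 (D / e / e) 0 (c * t / e) 1), e%:M; split=> //; last by exists e.
  have De : int_unit (D / e / e) by do 2 ?apply: int_unitM; rewrite ?int_unitV.
  apply/maxK_mat2; split; last by rewrite mul0r subr0 mulr1.
  split; [exact: int_unit_ge|exact: vge0| |exact/int_unit_ge/int_unit1].
  by apply: (vM) => //; apply: (vM).
- rewrite mat2_scalar !mat2M; congr mat2; last first; last first.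
  all: rewrite /D /e in e0 *; field; exact: e0.
Qed.

End GroupLemmas.

Section Representations.
Context {p : nat} (F : local_field p) (C : closedFieldType).
Local Notation M2 := 'M[F]_2.

Record subspace (V : lmodType C) := Subspace {
  subspace_set :> V -> Prop;
  subspace0 : subspace_set 0;
  subspaceP : forall a x y,
    subspace_set x -> subspace_set y -> subspace_set (a *: x + y)
}.

Definition lin_span (V : lmodType C) (A : set V) : set V :=
  [set y | exists2 s : seq (C * V), forall u, u \in s -> A u.2
         & y = \sum_(u <- s) u.1 *: u.2].

Lemma span0 (V : lmodType C) (A : set V) : lin_span A 0.
Proof. by exists [::]; rewrite ?big_nil. Qed.

Lemma spanP (V : lmodType C) (A : set V) a x y :
  lin_span A x -> lin_span A y -> lin_span A (a *: x + y).
Proof.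
move=> [s sA ->] [t tA ->]; exists ([seq (a * u.1, u.2) | u <- s] ++ t).
  by move=> u; rewrite mem_cat => /orP[/mapP[u' /sA ? ->]|/tA].
rewrite big_cat big_map scaler_sumr; congr (_ + _).
by apply: eq_bigr => u _; rewrite scalerA.
Qed.

Definition span (V : lmodType C) (A : set V) : subspace V :=
  Subspace (span0 A) (@spanP V A).

Lemma mem_span (V : lmodType C) (A : set V) x : A x -> span A x.
Proof.
move=> Ax; exists [:: (1, x)]; first by move=> u; rewrite inE => /eqP->.
by rewrite big_seq1 scale1r.
Qed.

Lemma span_image (V W : lmodType C) (A : set V) (f : {linear V -> W})
  (B : subspace W) :
  (forall x, A x -> B (f x)) -> forall x, span A x -> B (f x).
Proof.
move=> AB _ [s sA ->]; elim: s sA => [|u s IH] sA.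
  by rewrite big_nil linear0; apply: subspace0.
rewrite big_cons linearP; apply: subspaceP.
  by apply/AB/sA; rewrite mem_head.
by apply: IH => t ts; apply: sA; rewrite inE ts orbT.
Qed.

Section SubspaceType.
Variables (V : lmodType C) (W : subspace V).

Definition subspace_pred : {pred V} := fun x => `[< subspace_set W x >].

Lemma subspace_submod : submod_closed subspace_pred.
Proof.
split; first exact/asboolP/subspace0.
by move=> a x y /asboolP hx /asboolP hy; apply/asboolP/subspaceP.
Qed.

HB.instance Definition _ :=
  GRing.isSubmodClosed.Build C V subspace_pred subspace_submod.

Definition subspace_type := {x : V | x \in subspace_pred}.
HB.instance Definition _ := SubChoice.on subspace_type.
HB.instance Definition _ := [SubChoice_isSubLmodule of subspace_type by <:].

Lemma subspace_typeP (x : subspace_type) : W (val x).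
Proof. by have := valP x; rewrite unfold_in => /asboolP. Qed.

Definition to_subspace (x : V) (Wx : W x) : subspace_type :=
  exist _ x (asboolT Wx).

End SubspaceType.

(** A representation of a subgroup [H] of [GL_2(F)]; only the operators
    attached to elements of [H] are meaningful. *)
Record rep (H : set M2) := Rep {
  rep_mod :> lmodType C;
  rep_act : M2 -> {linear rep_mod -> rep_mod};
  rep_act1 : forall x, rep_act 1%:M x = x;
  rep_actM : forall g h, H g -> H h ->
    forall x, rep_act (g *m h) x = rep_act g (rep_act h x)
}.

Definition smooth (H : set M2) (V : rep H) := forall x : V,
  exists2 U, open_subgroup H U & forall g, U g -> rep_act V g x = x.

Definition stable (H : set M2) (V : rep H) (H' : set M2) (W : subspace V) :=
  forall g, H' g -> forall x, W x -> W (rep_act V g x).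

Definition irreducible_in (H : set M2) (V : rep H) (H' : set M2)
    (S : subspace V) :=
  (exists2 x, S x & x != 0) /\
  forall W : subspace V, (forall x, W x -> S x) -> stable H' W ->
    (forall x, W x -> x = 0) \/ (forall x, S x -> W x).

Definition irreducible (H : set M2) (V : rep H) :=
  (exists x : V, x != 0) /\
  forall W : subspace V, stable H W ->
    (forall x, W x -> x = 0) \/ (forall x, W x).

Definition has_central_character (V : rep (GL2 F)) :=
  exists chi : F -> C,
    [/\ forall a, a != 0 -> chi a != 0,
        forall a b, a != 0 -> b != 0 -> chi (a * b) = chi a * chi b
      & forall a, a != 0 -> forall x : V, rep_act V a%:M x = chi a *: x].

Definition equivariant (H H1 H2 : set M2) (V1 : rep H1) (V2 : rep H2)
    (f : V1 -> V2) :=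
  forall g, H g -> forall x, f (rep_act V1 g x) = rep_act V2 g (f x).

Definition rep_iso (H : set M2) (V1 V2 : rep H) :=
  exists (f : {linear V1 -> V2}) (f' : {linear V2 -> V1}),
    [/\ equivariant H f, equivariant H f', cancel f f' & cancel f' f].

Record smooth_irrep := SmoothIrrep {
  si_rep :> rep (GL2 F);
  si_smooth : smooth si_rep;
  si_irreducible : irreducible si_rep;
  si_central : has_central_character si_rep
}.

Record diagram := Diagram {
  diag0 : rep (KZ F);
  diag1 : rep (normI F);
  diag0_smooth : smooth diag0;
  diag1_smooth : smooth diag1;
  diag_r : {linear diag1 -> diag0};
  diag_rP : equivariant (IZ F) diag_r
}.

Record diagram_mor (D D' : diagram) := DiagramMor {
  mor0 : {linear diag0 D -> diag0 D'};
  mor1 : {linear diag1 D -> diag1 D'};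
  mor0P : equivariant (KZ F) mor0;
  mor1P : equivariant (normI F) mor1;
  morP : forall x, mor0 (diag_r D x) = diag_r D' (mor1 x)
}.

Definition diagram_iso (D D' : diagram) :=
  exists (f : diagram_mor D D') (f' : diagram_mor D' D),
    [/\ cancel (mor0 f) (mor0 f'), cancel (mor0 f') (mor0 f),
        cancel (mor1 f) (mor1 f') & cancel (mor1 f') (mor1 f)].

Section Subrepresentation.
Variables (H H' : set M2) (V : rep H) (W : subspace V).
Hypotheses (sH : H' `<=` H) (gH' : is_subgroup H') (sW : stable H' W).

Definition subrep_fun (g : M2) (x : subspace_type W) : subspace_type W :=
  match pselect (H' g) with
  | left Hg => to_subspace (sW Hg (subspace_typeP x))
  | right _ => x
  end.

Lemma subrep_funE g x : H' g -> val (subrep_fun g x) = rep_act V g (val x).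
Proof. by rewrite /subrep_fun; case: pselect. Qed.

Lemma subrep_fun_linear g : linear (subrep_fun g).
Proof.
move=> a x y; case: (pselect (H' g)) => Hg; last first.
  by rewrite /subrep_fun; case: pselect.
by apply: val_inj; rewrite !linearP /= !subrep_funE // linearP.
Qed.

HB.instance Definition _ g :=
  GRing.isLinear.Build C (subspace_type W) (subspace_type W) _ (subrep_fun g)
    (subrep_fun_linear g).

Lemma subrep_fun1 x : subrep_fun 1%:M x = x.
Proof.
have [_ H1 _ _] := gH'.
by apply: val_inj; rewrite subrep_funE // rep_act1.
Qed.

Lemma subrep_funM g h : H' g -> H' h ->
  forall x, subrep_fun (g *m h) x = subrep_fun g (subrep_fun h x).
Proof.
move=> Hg Hh x; have [_ _ HM _] := gH'; apply: val_inj.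
by rewrite !subrep_funE ?rep_actM //; [exact: sH|exact: sH|exact: HM].
Qed.

Definition subrep : rep H' :=
  @Rep H' (subspace_type W) (fun g => subrep_fun g : {linear _ -> _})
    subrep_fun1 subrep_funM.

Lemma subrep_smooth : smooth V -> smooth subrep.
Proof.
move=> sV x; have [U [UH [UG U1 UM UV] Uo] Ux] := sV (val x).
have [HG H1 HM HV] := gH'.
exists (U `&` H') => [|g [Ug Hg]]; last by apply: val_inj; rewrite subrep_funE ?Ux.
split; first exact: subIsetr.
  split=> [g [/UG]//| // |g h [? ?] [? ?]|g [? ?]].
  - by split; [exact: UM|exact: HM].
  - by split; [exact: UV|exact: HV].
move=> g [/Uo[n Un] Hg]; exists n => h Hh gh; split=> //.
by apply: Un => //; exact: sH.
Qed.

End Subrepresentation.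

Section CanonicalDiagram.
Variables (w : uniformizer F) (pi : smooth_irrep).

Record KZ_irrep := KZIrrep {
  kz_space :> subspace pi;
  kz_stable : stable (KZ F) kz_space;
  kz_irreducible : irreducible_in (KZ F) kz_space
}.

Variable sigma : KZ_irrep.

Definition Iplus : subspace pi :=
  span [set y | exists g x, [/\ Ppos F g, sigma x & y = rep_act pi g x]].

Definition Iminus_set : set pi :=
  [set y | exists2 x, Iplus x & y = rep_act pi (Pi w) x].

Lemma Iminus0 : Iminus_set 0.
Proof. by exists 0; [exact: subspace0|rewrite linear0]. Qed.

Lemma IminusP a x y : Iminus_set x -> Iminus_set y -> Iminus_set (a *: x + y).
Proof.
move=> [x' Ix ->] [y' Iy ->]; exists (a *: x' + y'); first exact: subspaceP.
by rewrite linearP.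
Qed.

Definition Iminus : subspace pi := Subspace Iminus0 IminusP.

Lemma D1_0 : (Iplus `&` Iminus) 0.
Proof. by split; apply: subspace0. Qed.

Lemma D1_P a x y : (Iplus `&` Iminus) x -> (Iplus `&` Iminus) y ->
  (Iplus `&` Iminus) (a *: x + y).
Proof. by move=> [? ?] [? ?]; split; apply: subspaceP. Qed.

Definition D1_space : subspace pi := Subspace D1_0 D1_P.

Definition D0_space : subspace pi :=
  span [set y | exists g x, [/\ maxK F g, D1_space x & y = rep_act pi g x]].

Lemma Iplus_IZ i z x : iwahori F i -> centre F z -> Iplus x ->
  Iplus (rep_act pi (i *m z) x).
Proof.
move=> iI zZ; apply: span_image => _ [g [y [gP sy ->]]].
have [g' [k [gP' kKZ e]]] := iwahori_Ppos iI gP.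
have iG := maxK_GL2 (iwahori_maxK iI); have zG := centre_GL2 zZ.
have PG h : Ppos F h -> GL2 F h.
  move=> [a [b [a0 _ _ ->]]]; apply/GL2E.
  by rewrite det_mat2 mulr0 subr0 mulr1.
have [KZG _ KZM _] := KZ_subgroup F.
have zKZ : KZ F z by exists 1%:M, z; split; rewrite ?mul1mx //; exact: maxK1.
rewrite -rep_actM; [|exact: GL2M|exact: PG].
rewrite -mulmxA (centreC g) // mulmxA e -mulmxA.
rewrite rep_actM; [|exact: PG|exact/KZG/KZM].
apply: mem_span; exists g', (rep_act pi (k *m z) y); split=> //.
by apply: kz_stable => //; apply: KZM.
Qed.

Lemma Iminus_Pi x : Iplus x -> Iminus (rep_act pi (Pi w) x).
Proof. by exists x. Qed.

Lemma Iplus_Pi x : Iminus x -> Iplus (rep_act pi (Pi w) x).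
Proof.
move=> [y Iy ->]; have PG := Pi_GL2 w; rewrite -rep_actM // Pi_sqr.
rewrite -[_%:M]mul1mx; apply: Iplus_IZ => //; first exact: iwahori1.
by exists (w : F); rewrite ?unif_neq0.
Qed.

Lemma Iminus_IZ i z x : iwahori F i -> centre F z -> Iminus x ->
  Iminus (rep_act pi (i *m z) x).
Proof.
move=> iI zZ [y Iy ->]; have PG := Pi_GL2 w.
have iG := maxK_GL2 (iwahori_maxK iI); have zG := centre_GL2 zZ.
have jI := Pi_conj w iI.
exists (rep_act pi (invmx (Pi w) *m i *m Pi w *m z) y); first exact: Iplus_IZ.
rewrite -!rep_actM //; first 1 last.
- exact/GL2M/zG/maxK_GL2/iwahori_maxK.
- exact: GL2M.
by congr (rep_act _ _ _); rewrite !mulmxA mulmxV // mul1mx -!mulmxA (centreC _ zZ).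
Qed.

Lemma D1_stable : stable (normI F) D1_space.
Proof.
move=> g /(normI_dec w)[i [z [iI zZ [->|->]]]] x [xp xm].
  by split; [exact: Iplus_IZ|exact: Iminus_IZ].
rewrite -mulmxA rep_actM; first last.
- apply: GL2M (centre_GL2 zZ); exact/maxK_GL2/iwahori_maxK.
- exact: Pi_GL2.
by split; [exact/Iplus_Pi/Iminus_IZ|exact/Iminus_Pi/Iplus_IZ].
Qed.

Lemma D0_stable : stable (KZ F) D0_space.
Proof.
move=> _ [k [z [kK zZ ->]]]; apply: span_image => _ [h [x [hK [xp xm] ->]]].
have hG := maxK_GL2 hK; have kG := maxK_GL2 kK; have zG := centre_GL2 zZ.
rewrite -rep_actM //; last exact: GL2M.
rewrite -mulmxA (centreC h zZ) mulmxA rep_actM //; last exact: GL2M.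
apply: mem_span; exists (k *m h), (rep_act pi z x); split=> //.
  exact: maxKM.
rewrite -[z]mul1mx; split.
  by apply: Iplus_IZ => //; exact: iwahori1.
by apply: Iminus_IZ => //; exact: iwahori1.
Qed.

Lemma D1_sub_D0 x : D1_space x -> D0_space x.
Proof.
move=> Dx; apply: mem_span; exists 1%:M, x; split; rewrite ?rep_act1 //.
exact: maxK1.
Qed.

Definition can (x : subspace_type D1_space) : subspace_type D0_space :=
  to_subspace (D1_sub_D0 (subspace_typeP x)).

Lemma can_linear : linear can.
Proof. by move=> a x y; apply: val_inj. Qed.

HB.instance Definition _ :=
  GRing.isLinear.Build C (subspace_type D1_space) (subspace_type D0_space) _
    can can_linear.

Lemma KZ_GL2 : KZ F `<=` GL2 F. Proof. by have [] := KZ_subgroup F. Qed.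
Lemma normI_GL2 : normI F `<=` GL2 F. Proof. by have [] := normI_subgroup F. Qed.

Definition D0 : rep (KZ F) := subrep KZ_GL2 (KZ_subgroup F) D0_stable.
Definition D1 : rep (normI F) := subrep normI_GL2 (normI_subgroup F) D1_stable.

Lemma can_equivariant : @equivariant (IZ F) _ _ D1 D0 can.
Proof.
move=> g gIZ x; apply: val_inj.
rewrite [LHS](subrep_funE D1_stable) ?(subrep_funE D0_stable) //.
  exact: IZ_KZ.
exact: IZ_normI.
Qed.

(** The auxiliary [sigma] is kept as a parameter, so that statements about
    [D(pi)] quantify over every possible choice of it; [KZ_irrep_exists]
    below shows that one always exists. *)
Definition canonical_diagram : diagram :=
  @Diagram D0 D1
    (subrep_smooth (@si_smooth pi)) (subrep_smooth (@si_smooth pi))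
    (can : {linear _ -> _}) can_equivariant.

End CanonicalDiagram.

(** Every [pi] has an irreducible [KZ]-subrepresentation: the translates by
    [K] of a nonzero vector span a finite-dimensional space. *)
Section Existence.

Lemma residue_reps (N : nat) : exists s : seq F, forall x : F, vge x 0 ->
  exists2 y, y \in s & vge (x - y) (N%:Z).
Proof.
have [s0 s0P] := lf_finite_residue F.
elim: N => [|N [s sP]].
  by exists [:: 0] => x hx; exists 0; rewrite ?inE // subr0.
have [z z0 vz] := val_onto F N%:Z.
exists [seq y + z * r | y <- s, r <- s0] => x /sP[y ys xy].
have hq : vge ((x - y) / z) 0.
  rewrite -(subrr N%:Z); apply: vgeM xy _.
  by rewrite /val_ge valV // vz lexx orbT.
have [r rs qr] := s0P _ hq; exists (y + z * r).
  by apply/allpairsP; exists (y, r).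
have -> : x - (y + z * r) = z * ((x - y) / z - r) by field.
have -> : N.+1%:Z = N%:Z + 1 by lia.
by apply: vgeM qr; rewrite /val_ge vz lexx orbT.
Qed.

Lemma maxK_reps (N : nat) : exists L : seq M2, forall k, maxK F k ->
  exists2 l, l \in L & forall i j, vge (k i j - l i j) (N%:Z).
Proof.
have [s sP] := residue_reps N.
pose P := [seq (a, b) | a <- s, b <- s].
exists [seq mat2 u.1 u.2 t.1 t.2 | u <- P, t <- P] => k [k0 _].
have [a as_ ha] := sP _ (k0 0 0); have [b bs hb] := sP _ (k0 0 1).
have [c cs hc] := sP _ (k0 1 0); have [d ds hd] := sP _ (k0 1 1).
exists (mat2 a b c d); last by do 2 apply: ord2P; rewrite mat2s.
apply/allpairsP; exists ((a, b), (c, d)); split=> //.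
  by apply/allpairsP; exists (a, b).
by apply/allpairsP; exists (c, d).
Qed.

Definition gen (V : lmodType C) (xs : seq V) : subspace V :=
  span [set x | x \in xs].

Lemma gen_cons (V : lmodType C) (y : V) ys x :
  gen (y :: ys) x <-> exists b s, gen ys s /\ x = b *: y + s.
Proof.
split=> [[s sA ->]|[b [s [[t tA ->] ->]]]]; last first.
  exists ((b, y) :: t); last by rewrite big_cons.
  move=> u; rewrite inE => /orP[/eqP->|/tA /=]; first exact: mem_head.
  by rewrite inE => ->; rewrite orbT.
elim: s sA => [|u s IH] sA.
  by exists 0, 0; rewrite big_nil scale0r addr0; split=> //; exact: subspace0.
have [|b [t [tg e]]] := IH; first by move=> v vs; apply: sA; rewrite inE vs orbT.
rewrite big_cons e.
have := sA u (mem_head _ _); rewrite /= inE => /orP[/eqP->|uy].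
  by exists (u.1 + b), t; rewrite scalerDl addrA.
exists b, (u.1 *: u.2 + t); split; last by rewrite addrCA.
by apply: spanP => //; apply: mem_span.
Qed.

Lemma gen_nil (V : lmodType C) (x : V) : gen [::] x -> x = 0.
Proof. by move=> [[|u s] sA ->]; [rewrite big_nil|have := sA u (mem_head _ _)]. Qed.

Lemma subspaceB (V : lmodType C) (W : subspace V) a x y :
  W x -> W y -> W (x - a *: y).
Proof. by move=> Wx Wy; rewrite addrC -scaleNr; apply: subspaceP. Qed.

Lemma cap0 (V : lmodType C) (W T : subspace V) : (W `&` T) 0.
Proof. by split; apply: subspace0. Qed.

Lemma capP (V : lmodType C) (W T : subspace V) a x y :
  (W `&` T) x -> (W `&` T) y -> (W `&` T) (a *: x + y).
Proof. by move=> [? ?] [? ?]; split; apply: subspaceP. Qed.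

Lemma gen_sub (V : lmodType C) (xs : seq V) (W : subspace V) :
  (forall x, W x -> gen xs x) ->
  (forall x, gen xs x -> W x) \/
  exists2 ys, (size ys < size xs)%N & forall x, W x <-> gen ys x.
Proof.
elim: xs W => [|y ys IH] W sW.
  by left=> x /gen_nil->; apply: subspace0.
pose W' := Subspace (cap0 W (gen ys)) (@capP _ W (gen ys)).
have IHW := IH W' (fun x => @proj2 _ _).
have [WT|] := pselect (forall x, W x -> gen ys x).
  right; case: IHW => [TW|[zs lt_zs zsP]].
    by exists ys => // x; split=> [/WT|/TW[]].
  exists zs => [|x]; first exact: ltnW.
  by rewrite -zsP; split=> [Wx|[]//]; split=> //; apply: WT.
move=> /existsNP[x0 /not_implyP[Wx0 Tx0]].
have [a [t [Tt e0]]] := (gen_cons _ _ _).1 (sW _ Wx0).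
have a0 : a != 0.
  by apply: contra_notN Tx0 => /eqP a0; rewrite e0 a0 scale0r add0r.
have dec x : gen (y :: ys) x -> exists b s, gen ys s /\ x = b *: x0 + s.
  move=> /gen_cons[b [s [Ts ->]]]; exists (b / a), (s - (b / a) *: t).
  split; first exact: subspaceB.
  by rewrite e0 scalerDr scalerA divfK // -addrA [_ + (s - _)]addrC subrK.
case: IHW => [TW|[zs lt_zs zsP]]; [left|right].
  by move=> x /dec[b [s [/TW[Ws _] ->]]]; apply: subspaceP.
exists (x0 :: zs) => // x; split.
  move=> Wx; have [b [s [Ts e]]] := dec _ (sW _ Wx).
  apply/gen_cons; exists b, s; split=> //; apply/zsP; split=> //.
  have -> : s = x - b *: x0 by rewrite e addrAC subrr add0r.
  exact: subspaceB.
by move=> /gen_cons[b [s [/zsP[Ws _] ->]]]; apply: subspaceP.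
Qed.

Lemma KZ_irrep_in (pi : smooth_irrep) (n : nat) (S : subspace pi) (xs : seq pi) :
  (size xs <= n)%N -> (forall x, S x <-> gen xs x) -> stable (KZ F) S ->
  (exists2 x, S x & x != 0) -> inhabited (KZ_irrep pi).
Proof.
elim: n S xs => [|n IH] S xs.
  rewrite leqn0 => /nilP-> SP _ [x /SP/gen_nil->]; by rewrite eqxx.
move=> le_xs SP sS S0.
have [irr|] := pselect (irreducible_in (KZ F) S).
  by constructor; exact: KZIrrep sS irr.
move=> /not_andP[//|/existsNP[W /not_implyP[WS /not_implyP[sW]]]].
move=> /not_orP[/existsNP[x /not_implyP[Wx x0]] nSW].
have [|SW|[ys lt_ys ysP]] := @gen_sub _ xs W; first by move=> z /WS/SP.
  by case: nSW => z /SP/SW.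
apply: (IH W ys) => //; first by rewrite -ltnS (leq_trans lt_ys).
by exists x => //; apply/eqP.
Qed.

Lemma KZ_irrep_exists (pi : smooth_irrep) : inhabited (KZ_irrep pi).
Proof.
have [[x x0] _] := si_irreducible pi.
have [U [UG [_ U1 _ _] Uo] Ux] := @si_smooth pi x.
have [n Un] := Uo _ U1.
have [N nN] : exists N : nat, n <= N%:Z by exists `|n|%N; lia.
have cong k k' : maxK F k -> maxK F k' ->
    (forall i j, vge (k' i j - k i j) (N%:Z)) ->
    rep_act pi k x = rep_act pi k' x.
  move=> kK kK' kk'; have kG := maxK_GL2 kK; have kG' := maxK_GL2 kK'.
  have kV := maxKV kK; have kVG := maxK_GL2 kV.
  have e : k' = k *m (invmx k *m k') by rewrite mulmxA mulmxV // mul1mx.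
  rewrite [in RHS]e.
  rewrite rep_actM //; last exact: GL2M.
  rewrite (Ux (invmx k *m k')) //; apply: Un; first exact: GL2M.
  move=> i j; apply: (vge_trans nN).
  have -> : (invmx k *m k') i j - (1%:M : M2) i j = (invmx k *m (k' - k)) i j.
    by rewrite mulmxBr mulVmx // [RHS]mxE [X in _ = _ + X]mxE.
  rewrite mxE big_ord_recl big_ord1.
  by apply: vgeD; rewrite -(add0r N%:Z); apply: vgeM; rewrite ?kV.1 // !mxE.
have [L LP] := maxK_reps N.
pose near (l k : M2) := maxK F k /\ forall i j, vge (k i j - l i j) (N%:Z).
pose rho l := xget 1%:M (near l).
have rhoK l : maxK F (rho l).
  by rewrite /rho; case: xgetP => [k _ []|_] //; exact: maxK1.
pose ys := [seq rep_act pi (rho l) x | l <- L].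
have ysP k : maxK F k -> rep_act pi k x \in ys.
  move=> kK; have [l lL kl] := LP _ kK; apply/mapP; exists l => //.
  have [_ nl] : near l (rho l) by apply: (@xgetPex _ 1%:M (near l)); exists k.
  apply: cong => // i j.
  have -> : rho l i j - k i j = (rho l i j - l i j) - (k i j - l i j) by ring.
  exact: vgeB.
apply: (@KZ_irrep_in pi (size ys) (gen ys) ys) => //; last first.
  exists x => //; apply: mem_span; rewrite /= -[x in x \in _]rep_act1.
  by apply: ysP; exact: maxK1.
move=> _ [k [z [kK zZ ->]]].
have kG := maxK_GL2 kK; have zG := centre_GL2 zZ.
apply: span_image => _ /mapP[l lL ->].
have rG := maxK_GL2 (rhoK l).
have [chi [_ _ chiP]] := si_central pi.
rewrite rep_actM //; have [a a0 ->] := zZ; rewrite chiP // linearZ /=.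
rewrite -rep_actM // -[X in _ X]addr0; apply: spanP; last exact: span0.
by apply: mem_span; apply: ysP; exact: maxKM.
Qed.

End Existence.

End Representations.

(* Main.v *)
From HB Require Import structures.
From mathcomp Require Import all_boot all_order all_fingroup all_algebra all_solvable.
From mathcomp Require Import boolp classical_sets functions.
From mathcomp Require Import ring zify.
Require Import Defs.

(** Notation in these comments: [I] is the Iwahori group, [E a = step w a] is
    the matrix [(w, a; 0, 1)] for [a] in a system of representatives of the
    residue field, [S x] is the sum of the [E a <.> x], and [I+], [I-] are the
    two half-tree spaces attached to a weight [sigma], so that
    [D1 = I+ cap I-].

    From diagrams to representations. Let [f] be an isomorphism of diagrams.
    In [pi * pi'] take the subrepresentation [W] generated by the graph of
    [mor0 f]. It suffices that [W] is the graph of a nonzero map: it projects onto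
    [pi] by irreducibility, and Schur's lemma applies to the map. The half-tree space is filtered by balls, with
    [A_(n+1) = A_0 + sum_a E a A_n]. If an element of the half-tree space
    generated by the graph has its first component in [D1], then its components
    along the branches have theirs in [D1] too, because a relation between the
    branches at a vertex puts each of them in [I+ cap I-]. By induction such an
    element already lies in the graph of [mor1 f] ([half_ball_D1]), whence
    [graph_injective]. Finally, [D1 <> 0] makes the map nonzero.

    From representations to diagrams. The diagram is functorial in the pair
    [(pi, sigma)], so the point is that [I+] does not depend on [sigma].

    Both remaining facts follow from one statement ([D1_vector]): for weights
    [sigma] and [sigma'] of [pi], some nonzero [v] in [sigma'] lies in the
    space [D1] of [sigma]. Choose [v] to be an eigenvector of [I] and of
    [bruhat_sum] ([good_vector]). The proof has two steps.

    (1) [P(S) v = 0] for some nonzero polynomial [P] ([step_torsion]). Otherwise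
    the vectors [S^i v] and [Pi S^i v] are linearly independent, by the quadratic
    relation. Let [sigma1] be generated by [S v] under [K Z]. Its only vectors
    fixed by the upper unipotent matrices with integral entries are the multiples
    of [S v], and this propagates along the tree: those of its half-tree space
    are the [P(S) S v]. For this one needs that the sums defining the balls are
    direct, which follows from the existence of fixed vectors for [p]-groups
    acting on nonzero spaces of relations ([fixed_sum]). The two half-tree spaces
    of [sigma1] then meet in [0], and by irreducibility they span [pi]; thus [v]
    is of the form [P(S) S v + Pi Q(S) S v], which contradicts the independence.

    (2) If [P(S) v = 0] with [P] nonzero, then [v] and [Pi v] lie in [I+]
    ([torsion_in_both_halves]). Translation by a power [w ^+ N] brings all the
    [S^i v] and [Pi S^i v] into [I+], and the exponent can be lowered step by
    step: the quadratic relation for [Pi x] expresses it by [Pi S x] and by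
    translates of [x]. *)

Set Implicit Arguments.
Unset Strict Implicit.
Unset Printing Implicit Defensive.

Import Order.TTheory GRing.Theory Num.Theory.
Local Open Scope ring_scope.

(** * Eigenvectors and fixed vectors *)

Section Subspaces.
Context (C : closedFieldType) (U : lmodType C).
Implicit Types (W : subspace U) (x y : U).

Lemma span_subset (A : set U) W : (forall x, A x -> W x) -> forall x, span A x -> W x.
Proof. by move=> AW; apply: (@span_image _ _ _ _ idfun). Qed.

Lemma subspaceD W x y : W x -> W y -> W (x + y).
Proof. by move=> Wx Wy; rewrite -[x]scale1r; apply: subspaceP. Qed.

Lemma subspaceZ W (e : C) x : W x -> W (e *: x).
Proof.
by move=> Wx; rewrite -[_ *: _]addr0; apply: subspaceP => //; exact: subspace0.
Qed.

Lemma subspaceN W x : W x -> W (- x).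
Proof. by move=> /(subspaceZ (-1)); rewrite scaleN1r. Qed.

Lemma subspace_sub W x y : W x -> W y -> W (x - y).
Proof. by move=> Wx /subspaceN; apply: subspaceD. Qed.

Lemma subspace_sum W (I : eqType) (r : seq I) (f : I -> U) :
  (forall i, i \in r -> W (f i)) -> W (\sum_(i <- r) f i).
Proof.
move=> Wf; rewrite big_seq; elim/big_rec: _ => [|i x ir]; first exact: subspace0.
exact/subspaceD/Wf.
Qed.

End Subspaces.

Section PolynomialAction.
Context (C : closedFieldType) (V : lmodType C) (f : {linear V -> V}).
Implicit Types (P Q : {poly C}) (x y : V).

Definition poly_act x P : V := \sum_(i < size P) P`_i *: iter i f x.

Lemma poly_actE n P x : (size P <= n)%N ->
  poly_act x P = \sum_(i < n) P`_i *: iter i f x.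
Proof.
move=> le_n; rewrite /poly_act (big_ord_widen _ (fun i => P`_i *: iter i f x) le_n).
rewrite [RHS](bigID (fun i : 'I_n => (i < size P)%N)) /= [X in _ = _ + X]big1 ?addr0 // => i.
by rewrite -leqNgt => /(nth_default 0)->; rewrite scale0r.
Qed.

Lemma poly_act_is_linear x : linear (poly_act x).
Proof.
move=> a P Q; set n := maxn (size P) (size Q).
rewrite (@poly_actE n P) ?leq_maxl // (@poly_actE n Q) ?leq_maxr //.
rewrite (@poly_actE n); last first.
  by rewrite (leq_trans (size_polyD _ _)) // geq_max (leq_trans (size_scale_leq _ _)) ?leq_maxl ?leq_maxr.
rewrite scaler_sumr -big_split /=; apply: eq_bigr => i _.
by rewrite coefD coefZ scalerDl scalerA.
Qed.

HB.instance Definition _ x :=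
  GRing.isLinear.Build C {poly C} V _ (poly_act x) (poly_act_is_linear x).

Lemma poly_actC a x : poly_act x a%:P = a *: x.
Proof. by rewrite (@poly_actE 1) ?size_polyC_leq1 // big_ord1 coefC. Qed.

Lemma poly_actMX P x : poly_act x (P * 'X) = f (poly_act x P).
Proof.
rewrite (@poly_actE (size P).+1); last by rewrite (leq_trans (size_polyMleq _ _)) // size_polyX addn2.
rewrite big_ord_recl coefMX /= scale0r add0r linear_sum.
by apply: eq_bigr => i _; rewrite /bump /= add1n coefMX /= linearZ.
Qed.

Lemma poly_actM P Q x : poly_act x (P * Q) = poly_act (poly_act x Q) P.
Proof.
elim/poly_ind: P => [|P c IH].
  by rewrite mul0r !linear0.
rewrite mulrDl mulrAC !linearD /=.
by rewrite !poly_actMX IH mul_polyC linearZ /= poly_actC.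
Qed.

Lemma poly_actXn n x : poly_act x 'X^n = iter n f x.
Proof.
elim: n => [|n IH]; first by rewrite expr0 poly_actC scale1r.
by rewrite exprSr poly_actMX IH.
Qed.

Lemma poly_actX x : poly_act x 'X = f x.
Proof. by rewrite -[RHS]/(iter 1 f x) -poly_actXn expr1. Qed.

(** Over an algebraically closed field the annihilating polynomial can be
    stripped of its linear factors one at a time; the last nonzero vector met
    is an eigenvector. *)
Lemma poly_act_eigen (W : subspace V) P x : P != 0 -> W x -> x != 0 ->
  (forall y, W y -> W (f y)) -> poly_act x P = 0 ->
  exists y a, [/\ W y, y != 0, f y = a *: y & root P a].
Proof.
move=> P0 Wx x0 fW; have [n] := ubnP (size P).
elim: n P x P0 Wx x0 => // n IH P x P0 Wx x0 ltn Px.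
have [P1|sP] := eqVneq (size P) 1.
  move/eqP/size_poly1P: P1 Px => [c c0 ->]; rewrite poly_actC => /eqP.
  by rewrite scaler_eq0 (negPf c0) (negPf x0).
have [a ra] := closed_rootP _ sP.
have /factor_theorem[Q eP] := ra.
have Q0 : Q != 0 by apply: contraNneq P0 => Q0; rewrite eP Q0 mul0r.
have e z : poly_act z ('X - a%:P) = f z - a *: z.
  by rewrite linearB /= poly_actC poly_actX.
have [y0|y0] := eqVneq (poly_act x ('X - a%:P)) 0.
  by exists x, a; split=> //; apply/eqP; rewrite -subr_eq0 -e y0.
have [|||z [b [Wz z0 fz rb]]] := IH Q (poly_act x ('X - a%:P)) Q0 _ y0.
- by rewrite e; apply: subspaceB => //; apply: fW.
- by move: ltn; rewrite eP size_Mmonic ?monicXsubC // size_XsubC addn2 /= ltnS.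
- by rewrite -poly_actM -eP.
by exists z, b; split=> //; rewrite eP rootM rb.
Qed.

End PolynomialAction.

Section CommonEigenvectors.
Context (C : closedFieldType) (V : lmodType C).

(** The eigenspaces of one operator are stable under the operators commuting
    with it, so the operators can be treated one after the other. *)
Lemma common_eigenvector (I : eqType) (L : seq I) (f : I -> {linear V -> V})
    (P : I -> {poly C}) (W : subspace V) x :
  W x -> x != 0 -> (forall i, i \in L -> forall y, W y -> W (f i y)) ->
  (forall i j, i \in L -> j \in L -> forall y, W y -> f i (f j y) = f j (f i y)) ->
  (forall i, i \in L -> P i != 0) ->
  (forall i, i \in L -> forall y, W y -> poly_act (f i) y (P i) = 0) ->
  exists y, [/\ W y, y != 0 & forall i, i \in L ->
     exists2 a, root (P i) a & f i y = a *: y].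
Proof.
elim: L W x => [|i L IH] W x Wx x0 fW fC P0 PW; first by exists x.
have iL : i \in i :: L by rewrite mem_head.
have sL j : j \in L -> j \in i :: L by rewrite inE orbC => ->.
have [y [a [Wy y0 fy ra]]] := poly_act_eigen (P0 i iL) Wx x0 (fW i iL) (PW i iL x Wx).
have W'0 : W 0 /\ f i 0 = a *: 0 by split; [exact: subspace0|rewrite linear0 scaler0].
have W'P b u v : W u /\ f i u = a *: u -> W v /\ f i v = a *: v ->
    W (b *: u + v) /\ f i (b *: u + v) = a *: (b *: u + v).
  move=> [Wu fu] [Wv fv]; split; first exact: subspaceP.
  by rewrite linearP fu fv scalerDr !scalerA mulrC.
pose W' := Subspace W'0 W'P.
have [| | | | |z [[Wz fz] z0 zL]] := IH W' y _ y0.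
- by split.
- move=> j jL u [Wu fu]; split; first exact: fW (sL _ jL) _ Wu.
  by rewrite (fC i j iL (sL _ jL) u Wu) fu linearZ.
- by move=> j k jL kL u [Wu _]; apply: fC => //; apply: sL.
- by move=> j jL; apply/P0/sL.
- by move=> j jL u [Wu _]; apply: PW => //; apply: sL.
exists z; split=> // j; rewrite inE => /orP[/eqP->|/zL//]; by exists a.
Qed.

(** In characteristic [p] the only [p]-th root of unity is [1], so commuting
    operators of order [p] have a common fixed vector. *)
Lemma common_fixed_vector (p : nat) (I : eqType) (L : seq I)
    (f : I -> {linear V -> V}) (W : subspace V) x :
  prime p -> p \in GRing.pchar C ->
  W x -> x != 0 -> (forall i, i \in L -> forall y, W y -> W (f i y)) ->
  (forall i j, i \in L -> j \in L -> forall y, W y -> f i (f j y) = f j (f i y)) ->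
  (forall i, i \in L -> forall y, W y -> iter p (f i) y = y) ->
  exists y, [/\ W y, y != 0 & forall i, i \in L -> f i y = y].
Proof.
move=> pr_p charC Wx x0 fW fC fp.
have [| |y [Wy y0 yL]] := common_eigenvector (P := fun _ => 'X^p - 1) Wx x0 fW fC.
- by move=> i _; rewrite -size_poly_eq0 size_XnsubC ?prime_gt0.
- move=> i iL y Wy; rewrite linearB /=.
  by rewrite poly_actXn fp // poly_actC scale1r subrr.
exists y; split=> // i /yL[a]; rewrite rootE !hornerE => /eqP ap ->.
have : (a - 1) ^+ p = 0.
  by rewrite -(pFrobenius_autE charC) rmorphB rmorph1 /= pFrobenius_autE (eqP (_ : a ^+ p == 1)) ?subrr // -subr_eq0 ap.
by move/eqP; rewrite expf_eq0 subr_eq0 => /andP[_ /eqP->]; rewrite scale1r.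
Qed.

(** Multiplied by powers of [f], the relation [P(f) x = 0] expresses each later
    iterate by earlier ones. The map [g] lets the lemma be used on either side
    of an edge of the tree. *)
Lemma iter_in_subspace (f : {linear V -> V}) (P : {poly C}) (W : subspace V)
    (g : {linear V -> V}) x :
  P != 0 -> poly_act f x P = 0 ->
  (forall i, (i < size P)%N -> W (g (iter i f x))) ->
  forall i, W (g (iter i f x)).
Proof.
move=> P0 Px W0; elim/ltn_ind => i IH.
have [/W0//|le_i] := ltnP i (size P).
have sP : (0 < size P)%N by rewrite size_poly_gt0.
pose d := (size P).-1; have eP : size P = d.+1 by rewrite prednK.
have lc0 : P`_d != 0 by rewrite -lead_coefE lead_coef_eq0.
have : poly_act f x ('X^(i - d) * P) = 0 by rewrite poly_actM Px poly_actXn iter_fix ?linear0.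
rewrite mulrC poly_actM poly_actXn /poly_act eP big_ord_recr /= -iterD subnKC; last by lia.
move=> /eqP; rewrite addrC addr_eq0 => /eqP e.
have -> : iter i f x =
    - (P`_d)^-1 *: \sum_(j < d) P`_j *: iter j f (iter (i - d) f x).
  by rewrite -[LHS]scale1r -(mulVf lc0) -scalerA e scalerN scaleNr.
rewrite linearZ /= -[_ *: g _]addr0; apply: subspaceP; last exact: subspace0.
rewrite linear_sum; elim/big_rec: _ => [|j y _ Wy]; first exact: subspace0.
rewrite linearZ /=; apply: subspaceP => //; rewrite -iterD.
by apply: IH; have := ltn_ord j; lia.
Qed.

End CommonEigenvectors.

(** * The residue field *)

Section Residues.
Context {p : nat} (F : local_field p).
Local Notation v := (@lf_val p F).
Local Notation int x := (vge (x : F) 0).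
Implicit Types x y z : F.

Lemma vgeC n x y : vge (x - y) n -> vge (y - x) n.
Proof. by move/vgeN; rewrite opprB. Qed.

Lemma vge_diff n x y z : vge (x - y) n -> vge (y - z) n -> vge (x - z) n.
Proof. by move=> h k; have := vgeD h k; rewrite addrA subrK. Qed.

Lemma intM x y : int x -> int y -> int (x * y).
Proof. by move=> hx hy; rewrite -(addr0 0); apply: vgeM. Qed.

Lemma int1 : int 1. Proof. exact: int_unit_ge (int_unit1 F). Qed.

Lemma intW x : vge x 1 -> int x. Proof. exact: vge_trans. Qed.

Lemma vgeMl n x y : int x -> vge y n -> vge (x * y) n.
Proof. by move=> hx hy; rewrite -(add0r n); apply: vgeM. Qed.

Lemma vgeMr n x y : vge x n -> int y -> vge (x * y) n.
Proof. by move=> hx hy; rewrite -(addr0 n); apply: vgeM. Qed.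

Lemma int_congr x y : int x -> vge (x - y) 1 -> int y.
Proof. by move=> hx /intW h; have := vgeB hx h; rewrite subKr. Qed.

Lemma int_unitE x : int_unit x = int x && ~~ vge x 1.
Proof.
rewrite /int_unit /val_ge; case: (eqVneq x 0) => //= _.
by move: (v x) => n; lia.
Qed.

Lemma int_unitP x : int x -> int_unit x \/ vge x 1.
Proof. by rewrite int_unitE => ->; case: (vge x 1); [right|left]. Qed.

Lemma unit_neq0 x : int_unit x -> x != 0. Proof. by case/andP. Qed.

Lemma int_div x y : int x -> int_unit y -> int (x / y).
Proof. by move=> hx /int_unitV/int_unit_ge; apply: intM. Qed.

(** A finite list that covers the integers modulo [w] gives a normal form: the
    first of its elements in the residue class. *)
Lemma residue_system : exists s : seq F,
  [/\ uniq s, {in s, forall x, int x},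
      (forall x, int x -> exists2 y, y \in s & vge (x - y) 1)
    & {in s &, forall x y, vge (x - y) 1 -> x = y}].
Proof.
have [s0 s0P] := lf_finite_residue F.
pose nf x := head x [seq y <- s0 | vge (x - y) 1].
have nfP x : vge (x - nf x) 1.
  rewrite /nf; case E: [seq y <- s0 | _] => [|y l] /=; first by rewrite subrr vge0.
  by have := mem_head y l; rewrite -E mem_filter => /andP[].
have nf_eq x y : vge (x - y) 1 -> int y -> nf x = nf y.
  move=> xy hy; rewrite /nf.
  have -> : [seq z <- s0 | vge (x - z) 1] = [seq z <- s0 | vge (y - z) 1].
    apply: eq_filter => z; apply/idP/idP; apply: vge_diff => //.
    exact: vgeC.
  have [z zs yz] := s0P y hy.
  have : z \in [seq z <- s0 | vge (y - z) 1] by rewrite mem_filter yz.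
  by case: [seq z <- s0 | _].
exists (undup [seq nf y | y <- s0 & vge y 0]); split.
- exact: undup_uniq.
- move=> x; rewrite mem_undup => /mapP[y]; rewrite mem_filter => /andP[hy _] ->.
  exact: int_congr (nfP y).
- move=> x hx; have [y ys xy] := s0P x hx; exists (nf y).
    by rewrite mem_undup; apply: map_f; rewrite mem_filter ys (int_congr hx xy).
  exact: vge_diff xy (nfP y).
- move=> x y; rewrite !mem_undup => /mapP[x' + ->] /mapP[y' + ->].
  rewrite !mem_filter => /andP[hx _] /andP[hy _] h.
  apply: nf_eq hy; apply: vge_diff (nfP x') _; apply: vge_diff h _.
  exact/vgeC/nfP.
Qed.

Definition residues : seq F := projT1 (cid residue_system).

Lemma residues_uniq : uniq residues.
Proof. by have [] := projT2 (cid residue_system). Qed.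

Lemma residues_int x : x \in residues -> int x.
Proof. by have [_ h _ _] := projT2 (cid residue_system); apply: h. Qed.

Definition residue x : F := nth 0 residues (find (fun y => vge (x - y) 1) residues).

Lemma residueP x : int x -> residue x \in residues /\ vge (x - residue x) 1.
Proof.
move=> hx; have hs : has (fun y => vge (x - y) 1) residues.
  have [y ys xy] : exists2 y, y \in residues & vge (x - y) 1.
    by have [_ _ h _] := projT2 (cid residue_system); apply: h.
  by apply/hasP; exists y.
by split; [rewrite mem_nth // -has_find|exact: (nth_find 0 hs)].
Qed.

Lemma residue_eq x y : int x -> y \in residues -> vge (x - y) 1 -> residue x = y.
Proof.
move=> hx ys xy; have [rs xr] := residueP hx.
have h : {in residues &, forall x y, vge (x - y) 1 -> x = y}.
  by have [] := projT2 (cid residue_system).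
by apply: h => //; apply: vge_diff xy; apply: vgeC.
Qed.

Lemma residue_congr x y : int x -> vge (x - y) 1 -> residue x = residue y.
Proof.
move=> hx xy; have [ys yr] := residueP (int_congr hx xy).
by apply: residue_eq => //; apply: vge_diff xy yr.
Qed.

Lemma residue_int x : int x -> int (residue x).
Proof. by move=> /residueP[/residues_int]. Qed.

Lemma residue_id x : x \in residues -> residue x = x.
Proof. by move=> xs; apply: residue_eq; rewrite ?residues_int // subrr vge0. Qed.

(** A map of the finite residue field that is injective is a permutation. *)
Lemma perm_residues (phi : F -> F) :
  (forall x, int x -> int (phi x)) ->
  (forall x y, int x -> int y -> vge (phi x - phi y) 1 -> vge (x - y) 1) ->
  perm_eq [seq residue (phi x) | x <- residues] residues.
Proof.
move=> phiO phiI.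
have u : uniq [seq residue (phi x) | x <- residues].
  rewrite map_inj_in_uniq ?residues_uniq // => x y xs ys e.
  have [hx hy] := (residues_int xs, residues_int ys).
  have [[_ rx] [_ ry]] := (residueP (phiO _ hx), residueP (phiO _ hy)).
  rewrite -(residue_id xs); apply: residue_eq => //; apply: phiI => //.
  by apply: vge_diff rx _; rewrite e; apply: vgeC.
have sub : {subset [seq residue (phi x) | x <- residues] <= residues}.
  by move=> _ /mapP[x /residues_int hx ->]; apply: (residueP (phiO _ hx)).1.
apply: uniq_perm => //; first exact: residues_uniq.
by have [] := uniq_min_size u sub; rewrite ?size_map.
Qed.

Lemma sum_residues (V : zmodType) (f : F -> V) (phi : F -> F) :
  (forall x y, int x -> int y -> vge (x - y) 1 -> f x = f y) ->
  (forall x, int x -> int (phi x)) ->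
  (forall x y, int x -> int y -> vge (phi x - phi y) 1 -> vge (x - y) 1) ->
  \sum_(x <- residues) f (phi x) = \sum_(x <- residues) f x.
Proof.
move=> fP phiO phiI; rewrite -[RHS](perm_big _ (perm_residues phiO phiI)) big_map.
apply: eq_big_seq => x /residues_int hx.
have [rs rx] := residueP (phiO _ hx).
by apply: fP => //; [exact: phiO|exact: residues_int].
Qed.

(** Adding [1] permutes the residue field without fixed points and has
    order [p]. *)
Lemma dvdn_size_residues : prime p -> (p %| size residues)%N.
Proof.
move=> pr_p; set n := size residues.
have nthO (i : 'I_n) : int (residues`_i) by apply/residues_int/mem_nth.
have succO x : int x -> int (x + 1) by move=> hx; apply: vgeD hx int1.
have lt_i (i : 'I_n) : (index (residue (residues`_i + 1)) residues < n)%N.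
  by rewrite index_mem; apply: (residueP (succO _ (nthO i))).1.
pose f i := Ordinal (lt_i i).
have fE i : residues`_(f i) = residue (residues`_i + 1).
  by rewrite nth_index //; apply: (residueP (succO _ (nthO i))).1.
have f_iter k i : vge (residues`_(iter k f i) - (residues`_i + k%:R)) 1.
  elim: k => [|k IH]; first by rewrite addr0 subrr vge0.
  rewrite iterS fE; have [_ h] := residueP (succO _ (nthO (iter k f i))).
  apply: vge_diff (vgeC h) _; move: IH; congr val_ge; rewrite -addn1 natrD; ring.
have nth_congr (i j : 'I_n) : vge (residues`_i - residues`_j) 1 -> i = j.
  move=> h; have e : residues`_i = residues`_j.
    rewrite -[LHS]residue_id ?mem_nth //; apply: residue_eq => //.
    exact: mem_nth.
  apply/val_inj/eqP.
  by rewrite -(nth_uniq 0 (ltn_ord i) (ltn_ord j) residues_uniq) e eqxx.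
have fp i : iter p f i = i.
  apply: nth_congr; apply: vge_diff (f_iter p i) _.
  by rewrite addrC addKr; exact: lf_residue_char.
have f_inj : injective f.
  apply: (can_inj (g := iter p.-1 f)) => i.
  by rewrite -iterSr prednK ?prime_gt0.
pose t := perm f_inj.
have tE k i : (t ^+ k)%g i = iter k f i.
  by elim: k i => [|k IH] i; rewrite ?expg0 ?perm1 // expgSr permM IH permE.
have tp : (t ^+ p = 1)%g by apply/permP => i; rewrite tE perm1.
have pG : (p.-group <[t]>)%g.
  by rewrite /pgroup (pnat_dvd _ (pnat_id pr_p)) // order_dvdn tp.
have := @pgroup_fix_mod _ _ _ 'P%act p <[t]>%G [set: 'I_n]%SET pG.
have acts : [acts <[t]>, on [set: 'I_n] | 'P]%g by apply/actsP => a _ i; rewrite !inE.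
move=> /(_ acts); rewrite cardsT card_ord [X in _ = X %[mod p] -> _]eq_card0; last first.
  move=> i; apply/negP => /setIP[_ /afixP/(_ t (cycle_id t))].
  rewrite /= apermE permE => e; have := f_iter 1%N i; rewrite -[iter 1 f i]/(f i) e opprD addNKr.
  move=> /vgeN; rewrite opprK -[1%:R](addr0 1) => h.
  by have := int_unit1 F; rewrite int_unitE -{2}(addr0 (1 : F)) h andbF.
by rewrite mod0n => /eqP.
Qed.

Lemma size_residues0 (C : closedFieldType) :
  prime p -> p \in GRing.pchar C -> (size residues)%:R = 0 :> C.
Proof.
by move=> /dvdn_size_residues d pC; apply/eqP; rewrite -(dvdn_pcharf pC).
Qed.

End Residues.

Arguments residues {p} F.

(** * Matrices and decompositions of the group *)

Section Matrices.
Context {p : nat} (F : local_field p) (w : uniformizer F).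
Local Notation v := (@lf_val p F).
Local Notation int x := (vge (x : F) 0).
Local Notation M2 := 'M[F]_2.
Implicit Types x y z a b c d : F.

Definition upper b : M2 := mat2 1 b 0 1.
Definition lower c : M2 := mat2 1 0 c 1.
Definition dilate a : M2 := mat2 a 0 0 1.
Definition bruhat x : M2 := mat2 x 1 1 0.
Definition step x : M2 := mat2 (w : F) x 0 1.

Lemma GL2_upper b : GL2 F (upper b).
Proof. by apply/GL2E; rewrite det_mat2 mulr1 mulr0 subr0 oner_neq0. Qed.
Lemma GL2_lower c : GL2 F (lower c).
Proof. by apply/GL2E; rewrite det_mat2 mulr1 mul0r subr0 oner_neq0. Qed.
Lemma GL2_bruhat x : GL2 F (bruhat x).
Proof. by apply/GL2E; rewrite det_mat2 mulr1 mulr0 sub0r oppr_eq0 oner_neq0. Qed.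
Lemma GL2_affine a b : a != 0 -> GL2 F (mat2 a b 0 1).
Proof. by move=> a0; apply/GL2E; rewrite det_mat2 mulr1 mulr0 subr0. Qed.
Lemma GL2_step x : GL2 F (step x).
Proof. exact/GL2_affine/unif_neq0. Qed.
Lemma GL2_scalar a : a != 0 -> GL2 F a%:M.
Proof. by move=> a0; apply: centre_GL2; exists a. Qed.
Lemma GL2_KZ g : KZ F g -> GL2 F g.
Proof. by have [h _ _ _] := KZ_subgroup F; exact: h. Qed.
Lemma GL2_maxK g : maxK F g -> GL2 F g. Proof. exact: maxK_GL2. Qed.
Lemma GL2_iwahori g : iwahori F g -> GL2 F g.
Proof. by move/iwahori_maxK/GL2_maxK. Qed.
Lemma GL2_Ppos g : Ppos F g -> GL2 F g.
Proof. by move=> [a [b [a0 _ _ ->]]]; apply: GL2_affine. Qed.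

Lemma iwahori_upper b : int b -> iwahori F (upper b).
Proof.
move=> hb; apply/iwahori_mat2; rewrite mulr1 mulr0 subr0 int_unit1.
by split=> //; split; rewrite ?vge0 ?int1.
Qed.

Lemma iwahori_lower c : vge c 1 -> iwahori F (lower c).
Proof.
move=> hc; apply/iwahori_mat2; rewrite mulr1 mul0r subr0 int_unit1.
by split=> //; split; rewrite ?vge0 ?int1.
Qed.

Lemma maxK_lower c : int c -> maxK F (lower c).
Proof.
move=> hc; apply/maxK_mat2; rewrite mulr1 mul0r subr0 int_unit1.
by split=> //; split; rewrite ?vge0 ?int1.
Qed.

Lemma iwahori_dilate a : int_unit a -> iwahori F (dilate a).
Proof.
move=> ha; apply/iwahori_mat2; rewrite mulr1 mul0r subr0 ha.
by split=> //; split; rewrite ?vge0 ?int1 // int_unit_ge.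
Qed.

Lemma maxK_bruhat x : int x -> maxK F (bruhat x).
Proof.
move=> hx; apply/maxK_mat2; rewrite mulr1 mulr0 sub0r; split.
  by split; rewrite ?vge0 ?int1.
by rewrite /int_unit oppr_eq0 oner_neq0 valN1.
Qed.

Lemma maxK_KZ g : maxK F g -> KZ F g.
Proof. by move=> gK; exists g, 1%:M; rewrite mulmx1; split=> //; exact: centre1. Qed.

Lemma Ppos_affine a b : a != 0 -> int a -> int b -> Ppos F (mat2 a b 0 1).
Proof. by move=> a0 ha hb; exists a, b. Qed.

Lemma vw : v (w : F) = 1. Proof. exact: unif_val. Qed.
Lemma vge_w : vge (w : F) 1. Proof. by rewrite /val_ge vw lexx orbT. Qed.
Lemma int_w : int (w : F). Proof. exact: intW vge_w. Qed.

Lemma vge_wM c : int c -> vge ((w : F) * c) 1.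
Proof. by move=> hc; apply: vgeMr vge_w hc. Qed.

Lemma vge_wexp (n : nat) : vge ((w : F) ^+ n) n%:Z.
Proof.
elim: n => [|n IH]; first by rewrite expr0; exact: int1.
by rewrite exprS intS; apply: vgeM vge_w IH.
Qed.

Lemma int_wexp (n : nat) : int ((w : F) ^+ n).
Proof. exact: vge_trans (vge_wexp n). Qed.

Lemma wexp_neq0 (n : nat) : (w : F) ^+ n != 0.
Proof. by rewrite expf_neq0 ?unif_neq0. Qed.

Lemma val_wexp (n : nat) : v ((w : F) ^+ n) = n%:Z.
Proof.
elim: n => [|n IH]; first by rewrite expr0 val1.
by rewrite exprS lf_valM ?wexp_neq0 ?unif_neq0 // vw IH intS.
Qed.

Lemma vge_divw x (n : nat) : vge x n%:Z -> int (x / (w : F) ^+ n).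
Proof.
move=> hx; rewrite -(subrr n%:Z); apply: vgeM hx _.
by rewrite /val_ge valV ?wexp_neq0 // val_wexp lexx orbT.
Qed.

Lemma vge1_divw x : vge x 1 -> int (x / (w : F)).
Proof. by move/(@vge_divw x 1); rewrite expr1. Qed.

Lemma int_wexp_unit a : a != 0 -> int a ->
  exists n u, int_unit u /\ a = (w : F) ^+ n * u.
Proof.
move=> a0; rewrite /val_ge (negPf a0) /= => ha; exists `|v a|%N, (a / (w : F) ^+ `|v a|%N).
split; last by rewrite mulrC divfK ?wexp_neq0.
rewrite /int_unit mulf_neq0 ?invr_neq0 ?wexp_neq0 //=.
rewrite lf_valM ?invr_neq0 ?wexp_neq0 // valV ?wexp_neq0 // val_wexp; lia.
Qed.

Lemma vge_exists x : exists n : nat, int ((w : F) ^+ n * x).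
Proof.
exists `|v x|%N; rewrite /val_ge; case: (eqVneq x 0) => [->|x0]; first by rewrite mulr0 eqxx.
rewrite lf_valM ?wexp_neq0 // val_wexp; apply/orP; right; lia.
Qed.

Lemma bruhat_upper x y : upper y *m bruhat x = bruhat (x + y).
Proof. by rewrite mat2M; congr mat2; ring. Qed.

Lemma bruhat_Pi x : bruhat x *m Pi w = step x.
Proof. by rewrite mat2M; congr mat2; ring. Qed.

Lemma bruhat_lower x y : bruhat x *m lower y = bruhat (x + y).
Proof. by rewrite mat2M; congr mat2; ring. Qed.

Lemma step_upper x y : step x *m upper y = step (x + (w : F) * y).
Proof. by rewrite mat2M; congr mat2; ring. Qed.

Lemma upper_step x y : upper y *m step x = step (x + y).
Proof. by rewrite mat2M; congr mat2; ring. Qed.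

Lemma upperD x y : upper x *m upper y = upper (x + y).
Proof. by rewrite mat2M; congr mat2; ring. Qed.

Lemma upper0 : upper 0 = 1%:M. Proof. by rewrite mat2_scalar. Qed.
Lemma lower0 : lower 0 = 1%:M. Proof. by rewrite mat2_scalar. Qed.

Lemma bruhat_mul_unit x y : y != 0 ->
  bruhat x *m bruhat y = bruhat (x + y^-1) *m mat2 y 1 0 (- y^-1).
Proof. by move=> y0; rewrite !mat2M; congr mat2; field. Qed.

Lemma bruhat_mul x y : bruhat x *m bruhat y = upper x *m lower y.
Proof. by rewrite !mat2M; congr mat2; ring. Qed.

Lemma torus_unipotent y : y != 0 -> mat2 y 1 0 (- y^-1) =
  (- y^-1)%:M *m dilate (- y ^+ 2) *m upper (y^-1 : F).
Proof. by move=> y0; rewrite mat2_scalar !mat2M; congr mat2; field. Qed.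

Lemma affine_M a b c d :
  mat2 a b 0 1 *m mat2 c d 0 1 = mat2 (a * c) (a * d + b) 0 1.
Proof. by rewrite mat2M; congr mat2; ring. Qed.

(** The Bruhat decomposition of the group over the residue field: the lower left
    entry is either in the maximal ideal or a unit, and can serve as a pivot. *)
Lemma maxK_cases g : maxK F g -> iwahori F g \/
  exists x i, [/\ int x, iwahori F i & g = bruhat x *m i].
Proof.
rewrite [g]mat2E; move: (g 0 0) (g 0 1) (g 1 0) (g 1 1) => a b c d.
move=> /maxK_mat2[[ha hb hc hd] hD].
have [uc|c1] := int_unitP hc; last first.
  by left; apply/iwahori_mat2; split.
right; have c0 := unit_neq0 uc.
have hx : int (a / c) by apply: int_div.
exists (a / c), (mat2 c d 0 (b - a / c * d)); split=> //.
  apply/iwahori_mat2; split.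
    by split=> //; [exact: vge0|apply/(vgeB hb)/intM].
  have -> : c * (b - a / c * d) - d * 0 = (-1) * (a * d - b * c) by field.
  apply: int_unitM hD; rewrite /int_unit oppr_eq0 oner_neq0 valN1 //.
by rewrite mat2M; congr mat2; field.
Qed.

(** Gaussian elimination, with the upper left entry, a unit, as pivot. *)
Lemma iwahori_factor g : iwahori F g -> exists c z a b,
  [/\ vge c 1, int_unit z, int_unit a, int b &
      g = lower c *m z%:M *m dilate a *m upper b].
Proof.
rewrite [g]mat2E; move: (g 0 0) (g 0 1) (g 1 0) (g 1 1) => a b c d.
move=> /iwahori_mat2[[ha hb hc hd] hD].
have had : int_unit (a * d).
  by rewrite -(subrK (b * c) (a * d)); apply: int_unitD => //; apply: vgeMl.
have ua : int_unit a.
  have [//|a1] := int_unitP ha.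
  by move: had; rewrite int_unitE (vgeMr a1 hd) andbF.
have a0 := unit_neq0 ua; have uaV := int_unitV ua.
have D0 := unit_neq0 hD; set D := a * d - b * c in hD D0.
exists (c / a), (D / a), (a ^+ 2 / D), (b / a); split.
- exact: vgeMr hc (int_unit_ge uaV).
- exact: int_unitM.
- by rewrite expr2; apply: int_unitM (int_unitV hD); apply: int_unitM.
- exact: int_div.
by rewrite mat2_scalar !mat2M; congr mat2; rewrite /D in D0 *; field; rewrite ?a0 ?D0.
Qed.

(** The Iwasawa decomposition: column operations over the integers clear the
    entry of larger valuation in the bottom row. *)
Lemma iwasawa g : GL2 F g -> exists a b k,
  [/\ a != 0, KZ F k & g = mat2 a b 0 1 *m k].
Proof.
rewrite [g]mat2E; move: (g 0 0) (g 0 1) (g 1 0) (g 1 1) => a b c d.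
move=> /GL2E; rewrite det_mat2 => D0.
have main a' b' c' d' : a' * d' - b' * c' != 0 -> d' != 0 -> int (c' / d') ->
    exists a b k, [/\ a != 0, KZ F k & mat2 a' b' c' d' = mat2 a b 0 1 *m k].
  move=> D'0 d'0 hx.
  exists ((a' * d' - b' * c') / d' ^+ 2), (b' / d'), (lower (c' / d') *m d'%:M).
  split; first by rewrite mulf_neq0 // invr_neq0 // expf_neq0.
    by exists (lower (c' / d')), d'%:M; split=> //; [exact: maxK_lower|exists d'].
  by rewrite mat2_scalar !mat2M; congr mat2; field.
have [hcd|hcd] := boolP ((d != 0) && int (c / d)).
  by have [d0 h] := andP hcd; apply: main.
have [|||a' [b' [k [a0 kKZ e]]]] := main b a d c.
- by move: D0; rewrite -oppr_eq0 opprB.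
- apply: contraNneq hcd => c0; rewrite c0 mul0r vge0 andbT.
  by apply: contraNneq D0 => ->; rewrite c0; apply/eqP; ring.
- have [d0|d0] := eqVneq d 0; first by rewrite d0 mul0r vge0.
  move: hcd; rewrite d0 /= /val_ge.
  have [c0|c0] := eqVneq c 0; first by rewrite c0 mul0r eqxx.
  rewrite !mulf_eq0 !invr_eq0 (negPf c0) (negPf d0) /= !lf_valM ?invr_neq0 // !valV //.
  lia.
exists a', b', (k *m bruhat 0); split=> //.
  have [_ _ KZM _] := KZ_subgroup F; apply: KZM => //.
  by apply/maxK_KZ/maxK_bruhat; rewrite vge0.
rewrite mulmxA -e mat2M; congr mat2; ring.
Qed.

(** An edge of the Bruhat-Tits tree cuts it into two half-trees, exchanged by
    [Pi]; every vertex lies in one of them. *)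
Lemma half_tree_cases g : GL2 F g -> exists h k,
  [/\ Ppos F h, KZ F k & g = h *m k \/ g = Pi w *m h *m k].
Proof.
move=> /iwasawa[a [b [k [a0 kKZ ->]]]]; have w0 := unif_neq0 w.
have [KZG _ KZM _] := KZ_subgroup F.
have [/andP[ha hb]|hab] := boolP (int a && int b).
  by exists (mat2 a b 0 1), k; split=> //; [exact: Ppos_affine|left].
have [hba|hba] := boolP (int (b / a)).
  have ha : ~~ int a.
    apply: contra hab => ha; rewrite ha /= -(divfK a0 b).
    exact: intM.
  exists (dilate ((w : F) * a)^-1), (mat2 0 1 1 (b / a) *m a%:M *m k); split.
  - apply: Ppos_affine; rewrite ?vge0 ?invr_neq0 ?mulf_neq0 //.
    rewrite /val_ge valV ?mulf_neq0 // lf_valM // vw.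
    by move: ha; rewrite /val_ge (negPf a0) /= => h; apply/orP; right; lia.
  - apply: (KZM) => //; exists (mat2 0 1 1 (b / a)), a%:M; split=> //; last by exists a.
    apply/maxK_mat2; rewrite mul0r mulr1 sub0r; split; first by split; rewrite ?vge0 ?int1.
    by rewrite /int_unit oppr_eq0 oner_neq0 valN1.
  right; rewrite !mulmxA; congr (_ *m k); rewrite mat2_scalar !mat2M.
  by congr mat2; field; rewrite ?w0 ?a0.
have b0 : b != 0 by apply: contraNneq hba => ->; rewrite mul0r vge0.
have lt_ba : v b < v a.
  move: hba; rewrite /val_ge mulf_eq0 invr_eq0 (negPf b0) (negPf a0) /=.
  by rewrite lf_valM ?invr_neq0 // valV //; lia.
have vb : v b <= -1.
  by move: hab; rewrite /val_ge (negPf b0) (negPf a0) /=; lia.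
exists (mat2 (- a / ((w : F) * b ^+ 2)) ((w : F) * b)^-1 0 1), (lower (a / b) *m b%:M *m k).
have bb0 : b ^+ 2 != 0 by rewrite expf_neq0.
split.
- apply: Ppos_affine; first by rewrite !mulf_neq0 ?invr_neq0 ?oppr_eq0 ?mulf_neq0.
    rewrite mulNr; apply: vgeN; rewrite /val_ge lf_valM ?invr_neq0 ?mulf_neq0 //.
    rewrite valV ?mulf_neq0 // lf_valM // vw expr2 lf_valM //; apply/orP; right; lia.
  by rewrite /val_ge valV ?mulf_neq0 // lf_valM // vw; apply/orP; right; lia.
- apply: KZM => //; exists (lower (a / b)), b%:M; split=> //; last by exists b.
  apply: maxK_lower; rewrite /val_ge lf_valM ?invr_neq0 // valV //.
  by apply/orP; right; lia.
right; rewrite !mulmxA; congr (_ *m k); rewrite mat2_scalar !mat2M.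
by congr mat2; field; rewrite ?w0 ?b0.
Qed.

End Matrices.

(** * Half-trees *)

Notation "g <.> x" := (rep_act _ g x) (at level 38, right associativity).
Local Notation int x := (vge x 0).

#[local] Hint Resolve GL2_upper GL2_lower GL2_bruhat GL2_step GL2_KZ GL2_maxK
  GL2_iwahori GL2_Ppos GL2M GL2V Pi_GL2 int1 int_w vge_w vge0 unif_neq0 : gl2.

Section HalfTree.
Context {p : nat} {F : local_field p} (w : uniformizer F) {C : closedFieldType}.
Variable V : rep C (GL2 F).
Local Notation M2 := 'M[F]_2.
Implicit Types (x y : V) (g h : M2) (a b c : F).

Lemma actM g h x : GL2 F g -> GL2 F h -> g <.> h <.> x = (g *m h) <.> x.
Proof. by move=> gG hG; rewrite rep_actM. Qed.

Lemma actK g x : GL2 F g -> invmx g <.> g <.> x = x.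
Proof. by move=> gG; rewrite actM ?mulVmx ?rep_act1 //; apply: GL2V. Qed.

Lemma act_lower c x :
  lower ((w : F) * c) <.> Pi w <.> x = Pi w <.> upper c <.> x.
Proof.
by rewrite !actM; auto with gl2; congr (_ <.> x); rewrite !mat2M; congr mat2; ring.
Qed.

Lemma act_upper_Pi c x :
  upper c <.> Pi w <.> x = Pi w <.> lower ((w : F) * c) <.> x.
Proof.
by rewrite !actM; auto with gl2; congr (_ <.> x); rewrite !mat2M; congr mat2; ring.
Qed.

Lemma act_step_bruhat a x : step w a <.> x = bruhat a <.> Pi w <.> x.
Proof. by rewrite actM; auto with gl2; rewrite bruhat_Pi. Qed.

(** For an irreducible [KZ]-stable [S] in an irreducible representation, this is
    the space [Iplus] of the canonical diagram. *)
Definition half (S : subspace V) : subspace V :=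
  span [set y | exists g x, [/\ Ppos F g, S x & y = g <.> x]]%classic.

Section Stable.
Variable S : subspace V.
Hypothesis KZ_S : stable (KZ F) S.

Lemma half_Ppos g x : Ppos F g -> half S x -> half S (g <.> x).
Proof.
move=> gP; apply: span_image => _ [h [y [hP Sy ->]]].
have [a [b [a0 ha hb eg]]] := gP; have [c [d [c0 hc hd eh]]] := hP.
apply: mem_span; exists (g *m h), y; split=> //; last by rewrite actM; auto with gl2.
rewrite eg eh affine_M; apply: Ppos_affine; first exact: mulf_neq0.
  exact: intM.
by apply: vgeD => //; apply: intM.
Qed.

Lemma half_base x : S x -> half S x.
Proof.
move=> Sx; apply: mem_span; exists 1%:M, x; split; rewrite ?rep_act1 //.
by rewrite mat2_scalar; apply: Ppos_affine; rewrite ?oner_neq0 ?int1 ?vge0.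
Qed.

Lemma half_affine a b x : a != 0 -> int a -> int b -> half S x ->
  half S (mat2 a b 0 1 <.> x).
Proof. by move=> a0 ha hb; apply/half_Ppos/Ppos_affine. Qed.

Lemma half_upper b x : int b -> half S x -> half S (upper b <.> x).
Proof. by move=> hb; apply: half_affine; auto with gl2; rewrite oner_neq0. Qed.

Lemma half_step b x : int b -> half S x -> half S (step w b <.> x).
Proof. by move=> hb; apply: half_affine; auto with gl2. Qed.

Lemma half_iwahori g x : iwahori F g -> half S x -> half S (g <.> x).
Proof.
move=> gI; apply: span_image => _ [h [y [hP Sy ->]]].
have [h' [k [hP' kKZ e]]] := iwahori_Ppos gI hP.
apply: mem_span; exists h', (k <.> y); split=> //; first exact: KZ_S.
by rewrite !actM; auto with gl2; rewrite e.
Qed.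

Lemma half_bruhat b x : int b -> half S x -> half S (bruhat b <.> Pi w <.> x).
Proof. by move=> hb Sx; rewrite -act_step_bruhat; apply: half_step. Qed.

(** The ball of radius [n] in the half-tree: the half-tree is its root
    together with the half-trees hanging from the neighbours of the root. *)
Fixpoint half_ball (n : nat) (x : V) : Prop :=
  if n is n'.+1 then exists s (m : F -> V),
    [/\ S s, forall a, half_ball n' (m a)
      & x = s + \sum_(a <- residues F) step w a <.> m a]
  else S x.

Lemma half_ball0 n : half_ball n 0.
Proof.
elim: n => [|n IH]; first exact: subspace0.
exists 0, (fun=> 0); split=> //; first exact: subspace0.
by rewrite add0r big1 // => a _; rewrite linear0.
Qed.

Lemma half_ballP n (e : C) x y : half_ball n x -> half_ball n y -> half_ball n (e *: x + y).
Proof.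
elim: n x y => [|n IH] x y; first exact: subspaceP.
move=> [s [m [Ss mb ->]]] [s' [m' [Ss' mb' ->]]].
exists (e *: s + s'), (fun a => e *: m a + m' a).
split; [exact: subspaceP|by move=> a; apply: IH (mb a) (mb' a)|].
rewrite scalerDr addrACA scaler_sumr -big_split /=; congr (_ + _).
by apply: eq_bigr => a _; rewrite linearP.
Qed.

Lemma half_ballS n x : half_ball n x -> half_ball n.+1 x.
Proof.
elim: n x => [|n IH] x.
  move=> Sx; exists x, (fun=> 0); split=> // [_|]; first exact: subspace0.
  by rewrite big1 ?addr0 // => a _; rewrite linear0.
by move=> [s [m [Ss mb ->]]]; exists s, m; split=> // a; apply: IH (mb a).
Qed.

Lemma half_ball_le n m x : (n <= m)%N -> half_ball n x -> half_ball m x.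
Proof.
move=> /subnK <-; elim: (m - n)%N => [//|k IH] bx.
by rewrite addSn; apply/half_ballS/IH.
Qed.

(** Unipotent matrices permute the branches at the root, and induce
    unipotent matrices on each of them. *)
Lemma half_ball_upper n b x : int b -> half_ball n x -> half_ball n (upper b <.> x).
Proof.
elim: n b x => [|n IH] b x hb; first by apply/KZ_S/maxK_KZ/iwahori_maxK/iwahori_upper.
move=> [s [m [Ss mb ->]]].
pose m' a := upper ((residue (a - b) + b - a) / (w : F)) <.> m (residue (a - b)).
have hm a : int a -> vge (residue (a - b) + b - a) 1.
  move=> ha; have [_ h] := residueP (vgeB ha hb).
  by move/vgeC: h; congr val_ge; ring.
exists (upper b <.> s), (fun a => if int a then m' a else 0); split.
- by apply: KZ_S => //; exact/maxK_KZ/iwahori_maxK/iwahori_upper.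
- move=> a; case: ifP => [ha|_]; last exact: half_ball0.
  by apply: IH (vge1_divw w (hm a ha)) (mb _).
rewrite linearD linear_sum /=; congr (_ + _).
pose f a := step w (residue a + b) <.> m (residue a).
transitivity (\sum_(a <- residues F) f a).
  apply: eq_big_seq => a ar; rewrite /f residue_id // actM; auto with gl2.
  by rewrite upper_step.
rewrite -(@sum_residues _ _ _ f (fun a => a - b)); first 1 last.
- by move=> x1 x2 h1 _ h; rewrite /f (residue_congr h1 h).
- by move=> a ha; apply: vgeB.
- by move=> x1 x2 _ _; congr val_ge; ring.
apply: eq_big_seq => a /residues_int ha; rewrite ha /m' actM; auto with gl2.
rewrite step_upper; congr (step w _ <.> _).
by have w0 := unif_neq0 w; field.
Qed.

Lemma half_ball_step n b x : int b -> half_ball n x -> half_ball n.+1 (step w b <.> x).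
Proof.
move=> hb bx; have [rs rb] := residueP hb.
have hd := vge1_divw w rb.
exists 0, (fun a => if a == residue b then upper ((b - residue b) / (w : F)) <.> x else 0).
split; first exact: subspace0.
  by move=> a; case: ifP => _; [exact: half_ball_upper|exact: half_ball0].
rewrite add0r (bigD1_seq (residue b)) ?residues_uniq //= eqxx big1 ?addr0.
  rewrite actM; auto with gl2; rewrite step_upper; congr (step w _ <.> _).
  by have w0 := unif_neq0 w; field.
by move=> a /negPf->; rewrite linear0.
Qed.

(** An element of [P^+] factors as a product of matrices [step w a] with an
    element of [K], the digits [a] being read off from its upper right entry. *)
Lemma half_ball_exists x : half S x -> exists n, half_ball n x.
Proof.
have base g y : Ppos F g -> S y -> exists n, half_ball n (g <.> y).
  move=> [a [b [a0 ha hb ->]]] Sy; have [n [u [uu ea]]] := int_wexp_unit w a0 ha.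
  have Su : S (dilate u <.> y).
    by apply: KZ_S => //; apply/maxK_KZ/iwahori_maxK/iwahori_dilate.
  have u0 := unit_neq0 uu; have wn := wexp_neq0 w.
  have -> : mat2 a b 0 1 <.> y = mat2 ((w : F) ^+ n) b 0 1 <.> dilate u <.> y.
    rewrite actM; [|exact: GL2_affine|exact: GL2_affine].
    by rewrite affine_M ea mulr0 add0r.
  exists n; elim: n b hb {ea} => [|n IH] b hb.
    by rewrite expr0; apply: half_ball_upper.
  have [rs rb] := residueP hb.
  have -> : mat2 ((w : F) ^+ n.+1) b 0 1 =
      step w (residue b) *m mat2 ((w : F) ^+ n) ((b - residue b) / (w : F)) 0 1.
    rewrite affine_M exprS; congr mat2; have w0 := unif_neq0 w; by field.
  rewrite -actM; [|exact: GL2_step|exact: GL2_affine].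
  by apply: half_ball_step; [exact: residue_int|apply: IH; exact: vge1_divw].
move=> [t tA ->]; elim: t tA => [|u t IH] tA.
  by exists 0%N; rewrite big_nil; exact: subspace0.
have [|n bn] := IH; first by move=> z zt; apply: tA; rewrite inE zt orbT.
have [g [y [gP Sy e]]] := tA u (mem_head _ _).
have [m bm] := base g y gP Sy.
exists (maxn m n); rewrite big_cons; apply: half_ballP.
  by rewrite e; apply: half_ball_le bm; rewrite leq_maxl.
by apply: half_ball_le bn; rewrite leq_maxr.
Qed.

End Stable.

Definition orbit_span (S : subspace V) : subspace V :=
  span [set y | exists g x, [/\ GL2 F g, S x & y = g <.> x]]%classic.

Lemma orbit_span_stable (S : subspace V) : stable (GL2 F) (orbit_span S).
Proof.
move=> g gG; apply: span_image => _ [h [x [hG Sx ->]]]; apply: mem_span.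
by exists (g *m h), x; split=> //; [exact: GL2M|rewrite actM].
Qed.

Lemma orbit_span_base (S : subspace V) x : S x -> orbit_span S x.
Proof.
move=> Sx; apply: mem_span; exists 1%:M, x; split; rewrite ?rep_act1 //.
exact: unitmx1.
Qed.

(** The vertices of the tree are distributed among the two half-trees. *)
Lemma orbit_span_half (S : subspace V) x : stable (KZ F) S -> orbit_span S x ->
  exists y z, [/\ half S y, half S z & x = y + Pi w <.> z].
Proof.
move=> KZ_S [t tA ->]; elim: t tA => [|u t IH] tA.
  by exists 0, 0; rewrite big_nil linear0 addr0; split=> //; exact: subspace0.
have [|y [z [hy hz e]]] := IH; first by move=> u' ut; apply: tA; rewrite inE ut orbT.
have [g [x' [gG Sx eu]]] := tA u (mem_head _ _).
have [h [k [hP kKZ eg]]] := half_tree_cases w gG.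
have hk : half S (h <.> k <.> x').
  by apply/half_Ppos/half_base/KZ_S.
rewrite big_cons e eu; case: eg => ->.
  exists (u.1 *: (h <.> k <.> x') + y), z; split=> //; first exact: subspaceP.
  by rewrite actM ?addrA; auto with gl2.
exists y, (u.1 *: (h <.> k <.> x') + z); split=> //; first exact: subspaceP.
by rewrite linearP addrCA !actM ?mulmxA; auto with gl2.
Qed.

End HalfTree.

(** * Fixed vectors of unipotent groups *)

Section Smooth.
Context {p : nat} {F : local_field p} {C : closedFieldType}.
Variable V : rep C (GL2 F).
Hypothesis V_smooth : smooth V.

Lemma smooth_congr (x : V) : exists N : nat, forall g : 'M[F]_2, GL2 F g ->
  (forall i j, vge (g i j - (1%:M : 'M_2) i j) N%:Z) -> g <.> x = x.
Proof.
have [U [UG [_ U1 _ _] Uo] Ux] := V_smooth x; have [n Un] := Uo _ U1.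
exists `|n|%N => g gG gN; apply/Ux/Un => // i j.
by apply: vge_trans (gN i j); lia.
Qed.

Lemma smooth_upper (x : V) : exists N : nat, forall b : F, vge b N%:Z -> upper b <.> x = x.
Proof.
have [N NP] := smooth_congr x; exists N => b hb; apply: NP => [|i j]; first exact: GL2_upper.
by rewrite mat2_scalar; move: i j; do 2 apply: ord2P; rewrite !mat2s ?subrr ?subr0 ?vge0.
Qed.

Lemma smooth_upper_seq (I : eqType) (r : seq I) (f : I -> V) : exists N : nat,
  forall i, i \in r -> forall b : F, vge b N%:Z -> upper b <.> f i = f i.
Proof.
elim: r => [|i r [N NP]]; first by exists 0%N.
have [M MP] := smooth_upper (f i); exists (maxn M N) => j.
rewrite inE => /orP[/eqP->|jr] b hb; [apply: MP|apply: (NP j jr)].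
  by apply: vge_trans hb; rewrite lez_nat leq_maxl.
by apply: vge_trans hb; rewrite lez_nat leq_maxr.
Qed.

End Smooth.

Section UnipotentFixedVector.
Context {p : nat} {F : local_field p} (w : uniformizer F) {C : closedFieldType}.
Variables (X : lmodType C) (rho : F -> {linear X -> X}) (W : subspace X).
Hypotheses (p_prime : prime p) (charC : p \in GRing.pchar C).
Hypothesis rhoD : forall a b x, rho a (rho b x) = rho (a + b) x.
Hypothesis rho0 : forall x, rho 0 x = x.
Hypothesis rho_W : forall b x, int b -> W x -> W (rho b x).

Lemma rho_iter n b x : iter n (rho b) x = rho (n%:R * b) x.
Proof.
elim: n => [|n IH]; first by rewrite mul0r rho0.
by rewrite iterS IH rhoD mulrS mulrDl mul1r.
Qed.

Definition fixed_by (N : nat) x : Prop := W x /\ forall b, vge b N%:Z -> rho b x = x.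

Lemma fixed_by0 N : fixed_by N 0.
Proof. by split=> [|b _]; [exact: subspace0|rewrite linear0]. Qed.

Lemma fixed_byP N e x y : fixed_by N x -> fixed_by N y -> fixed_by N (e *: x + y).
Proof.
move=> [Wx fx] [Wy fy]; split=> [|b hb]; first exact: subspaceP.
by rewrite linearP /= fx ?fy.
Qed.

Definition fixed_space N : subspace X := Subspace (fixed_by0 N) (@fixed_byP N).

(** The group [w^N O / w^N.+1 O] is killed by [p], so its action on a nonzero
    space in characteristic [p] has a nonzero fixed vector. *)
Lemma fixed_vector_step N x : fixed_by N.+1 x -> x != 0 ->
  exists2 y, fixed_by N y & y != 0.
Proof.
move=> fx x0.
have wN b : int b -> vge ((w : F) ^+ N * b) N%:Z by apply: vgeMr (vge_wexp w N).
have intN b : vge b N%:Z -> int b by apply: vge_trans.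
have [| | |y [[Wy fy] y0 Ly]] := @common_fixed_vector _ _ p _ (residues F)
  (fun a => rho ((w : F) ^+ N * a)) (fixed_space N.+1) x p_prime charC fx x0.
- move=> a /residues_int ha u [Wu fu]; split=> [|b hb].
    by apply: rho_W => //; apply/intN/wN.
  by rewrite rhoD addrC -rhoD fu.
- by move=> a b _ _ u _; rewrite !rhoD addrC.
- move=> a /residues_int ha u [Wu fu]; rewrite rho_iter fu //.
  by rewrite intS; apply: vgeM (wN _ ha); exact: lf_residue_char.
exists y => //; split=> // b hb; have hq := vge_divw w hb.
have [rs rb] := residueP hq.
have e : b = (w : F) ^+ N * residue (b / (w : F) ^+ N) +
   (w : F) ^+ N * (b / (w : F) ^+ N - residue (b / (w : F) ^+ N)).
  by have w0 := wexp_neq0 w N; field.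
rewrite e -rhoD fy ?Ly // intS addrC.
exact: vgeM (vge_wexp w N) rb.
Qed.

Lemma unipotent_fixed_vector x N : W x -> x != 0 ->
  (forall b, vge b N%:Z -> rho b x = x) ->
  exists y, [/\ W y, y != 0 & forall b, int b -> rho b y = y].
Proof.
move=> Wx x0 fx; have : exists2 y, fixed_by N y & y != 0 by exists x.
elim: N {fx} => [[y [Wy fy] y0]|N IH [y fy y0]]; first by exists y.
exact/IH/(fixed_vector_step fy).
Qed.

End UnipotentFixedVector.

Section DirectSum.
Context {p : nat} {F : local_field p} (w : uniformizer F) {C : closedFieldType}.
Variable V : rep C (GL2 F).
Hypotheses (p_prime : prime p) (charC : p \in GRing.pchar C) (V_smooth : smooth V).
Variables R B : subspace V.
Hypothesis R_upper : forall b x, int (b : F) -> R x -> R (upper b <.> x).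
Hypothesis B_upper : forall b x, vge (b : F) 1 -> B x -> B (upper b <.> x).
Hypothesis free : forall r b, R r -> B b ->
  (forall c, int (c : F) -> upper c <.> r = r) ->
  (forall c, vge (c : F) 1 -> upper c <.> b = b) ->
  r + \sum_(a <- residues F) upper a <.> b = 0 -> r = 0 /\ b = 0.

(** A family of summands, one in [R] and one in each translate
    [upper a <.> B]; the latter are indexed by all integers [a] and constant
    on residue classes, so that [upper b] acts by shifting the index. *)
Let family := (V * (F -> V))%type.

Definition shift (b : F) (u : family) : family :=
  (upper b <.> u.1, fun a => upper b <.> u.2 (a - b)).

Lemma shift_is_linear b : linear (shift b).
Proof.
move=> e u u'; congr pair; first exact: linearP.
by apply/funext => a; rewrite linearP.
Qed.

HB.instance Definition _ b :=
  GRing.isLinear.Build C family family _ (shift b) (shift_is_linear b).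

Lemma shiftD a b u : shift a (shift b u) = shift (a + b) u.
Proof.
congr pair => /=; first by rewrite actM ?upperD //; exact: GL2_upper.
by apply/funext => c; rewrite actM ?upperD ?opprD ?addrA //; exact: GL2_upper.
Qed.

Lemma shift0 u : shift 0 u = u.
Proof.
case: u => r m; congr pair; rewrite /= upper0 ?rep_act1 //.
by apply/funext => a; rewrite rep_act1 subr0.
Qed.

(** The values at non-integers are normalized to [0], so that a relation is
    determined by its summands. *)
Definition relation (u : family) : Prop :=
  [/\ R u.1,
      forall a, int a -> exists2 b, B b & u.2 a = upper a <.> b,
      forall a, ~~ int a -> u.2 a = 0,
      forall a b, int a -> vge (a - b) 1 -> u.2 a = u.2 b
    & u.1 + \sum_(a <- residues F) u.2 a = 0].

Lemma relation0 : relation 0.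
Proof.
split=> //=; first exact: subspace0.
- by move=> a _; exists 0; [exact: subspace0|rewrite linear0].
- by rewrite add0r big1.
Qed.

Lemma relationP e u u' : relation u -> relation u' -> relation (e *: u + u').
Proof.
move=> [Ru Bu Ou Cu Su] [Ru' Bu' Ou' Cu' Su']; split=> /=.
- exact: subspaceP.
- move=> a ha; have [b Bb eb] := Bu a ha; have [b' Bb' eb'] := Bu' a ha.
  exists (e *: b + b'); first exact: subspaceP.
  by rewrite linearP -eb -eb'.
- by move=> a ha; rewrite -[LHS]/(e *: u.2 a + u'.2 a) Ou // Ou' // scaler0 addr0.
- move=> a b ha ab; rewrite -[LHS]/(e *: u.2 a + u'.2 a) -[RHS]/(e *: u.2 b + u'.2 b).
  by rewrite (Cu _ b) // (Cu' _ b).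
rewrite -[X in _ + X]/(\sum_(a <- residues F) (e *: u.2 a + u'.2 a)).
by rewrite big_split /= -scaler_sumr addrACA -scalerDr Su Su' scaler0 addr0.
Qed.

Lemma relation_shift b u : int b -> relation u -> relation (shift b u).
Proof.
move=> hb [Ru Bu Ou Cu Su]; split=> /=.
- exact: R_upper.
- move=> a ha; have [c Bc ec] := Bu (a - b) (vgeB ha hb); exists c => //.
  rewrite ec actM; [|exact: GL2_upper|exact: GL2_upper].
  by rewrite upperD addrC subrK.
- move=> a ha; have hab : ~~ int (a - b).
    by apply: contra ha => h; rewrite -(subrK b a); apply: vgeD.
  by rewrite Ou // linear0.
- by move=> a c ha ac; rewrite (Cu _ (c - b)) ?opprB ?addrA ?subrK //; exact: vgeB.
rewrite -linear_sum (@sum_residues _ _ _ u.2 (fun a => a - b)).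
- by rewrite -linearD Su linear0.
- by move=> x y hx _; apply: Cu.
- by move=> a ha; apply: vgeB.
- by move=> x y _ _; congr val_ge; ring.
Qed.

Definition relations : subspace family := Subspace relation0 relationP.

(** By smoothness a nonzero relation is fixed by a subgroup of finite index of
    the unipotent group; hence there is a nonzero relation fixed by the
    whole group, and its summands contradict the hypothesis [free]. *)
Lemma relation_trivial u : relation u -> u = 0.
Proof.
move=> ru; apply/eqP/negPn/negP => u0.
have [Ru Bu Ou Cu Su] := ru.
have [N1 N1P] := smooth_upper V_smooth u.1.
have [N2 N2P] := smooth_upper_seq V_smooth (residues F) u.2.
have fu b : vge b (maxn N1 N2).+1%:Z -> shift b u = u.
  move=> hb.
  have hb1 : vge b 1 by apply: vge_trans hb.
  case: (u) Ru Bu Ou Cu N1P N2P {Su ru u0} => r m /= Ru Bu Ou Cu N1P N2P.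
  congr pair; first by apply: N1P; apply: vge_trans hb; lia.
  apply/funext => a; have [ha|ha] := boolP (int a); last first.
    have hab : ~~ int (a - b).
      by apply: contra ha => h; rewrite -(subrK b a); apply: vgeD (intW hb1).
    by rewrite /= (Ou _ hab) (Ou _ ha) linear0.
  have [rs ra] := residueP ha.
  rewrite /= (Cu (a - b) (residue a)) ?(Cu a (residue a)) //.
  - by apply: N2P => //; apply: vge_trans hb; lia.
  - by apply: vgeB (intW hb1).
  - by have := vgeB ra hb1; congr val_ge; ring.
have [u' [[R' B' O' C' S'] /eqP u'0 fix']] := unipotent_fixed_vector w
  (rho := fun b => shift b : {linear _ -> _}) (W := relations)
  p_prime charC shiftD shift0 relation_shift ru u0 fu.
have fr c : int c -> upper c <.> u'.1 = u'.1 by move=> /fix'{2}<-.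
have fm c : int c -> u'.2 c = upper c <.> u'.2 0.
  by move=> /fix'{1}<- /=; rewrite subrr.
have fb c : vge c 1 -> upper c <.> u'.2 0 = u'.2 0.
  by move=> hc; rewrite -fm ?(C' c 0) ?subr0 ?intW.
have B0 : B (u'.2 0).
  by have [b Bb ->] := B' 0 (vge0 _ _); rewrite upper0 rep_act1.
have [|r0 m0] := free R' B0 fr fb.
  by rewrite -[RHS]S'; congr (_ + _); apply: eq_big_seq => a /residues_int/fm->.
apply: u'0; rewrite [u']surjective_pairing r0; congr pair; apply/funext => a.
by have [/fm->|/O'->//] := boolP (int a); rewrite m0 linear0.
Qed.

(** As the sum of [R] and of the translates of [B] is direct, the unipotent group
    permutes the summands of a fixed vector. *)
Lemma fixed_sum r (m : F -> V) : R r -> (forall a, a \in residues F -> B (m a)) ->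
  (forall c, int (c : F) ->
    upper c <.> (r + \sum_(a <- residues F) upper a <.> m a) =
    r + \sum_(a <- residues F) upper a <.> m a) ->
  (forall c, int c -> upper c <.> r = r) /\
  exists b, [/\ B b, forall c, vge c 1 -> upper c <.> b = b
    & forall a, a \in residues F -> m a = b].
Proof.
move=> Rr Bm fx.
pose n a := if int a then upper (residue a) <.> m (residue a) else 0.
have sn : \sum_(a <- residues F) n a = \sum_(a <- residues F) upper a <.> m a.
  by apply: eq_big_seq => a ar; rewrite /n residues_int // residue_id.
have nC a b : int a -> vge (a - b) 1 -> n a = n b.
  by move=> ha ab; rewrite /n ha (int_congr ha ab) (residue_congr ha ab).
have nB a : int a -> exists2 b, B b & n a = upper a <.> b.
  move=> ha; have [rs ra] := residueP ha.
  exists (upper (residue a - a) <.> m (residue a)).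
    by apply: B_upper; [exact: vgeC|exact: Bm].
  rewrite actM; [|exact: GL2_upper|exact: GL2_upper].
  by rewrite upperD addrC subrK /n ha.
have key c : int c -> shift c (r, n) = (r, n).
  move=> hc; apply/eqP; rewrite -subr_eq0; apply/eqP/relation_trivial.
  split=> /=.
  - by apply: subspace_sub => //; apply: R_upper.
  - move=> a ha; have [b Bb eb] := nB (a - c) (vgeB ha hc).
    have [b' Bb' eb'] := nB a ha.
    exists (b - b'); first exact: subspace_sub.
    rewrite linearB -eb' -[LHS]/(upper c <.> n (a - c) - n a) eb actM ?upperD.
    + by rewrite [c + _]addrC subrK.
    + exact: GL2_upper.
    + exact: GL2_upper.
  - move=> a ha; rewrite -[LHS]/(upper c <.> n (a - c) - n a) /n (negPf ha).
    have /negPf-> : ~~ int (a - c).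
      by apply: contra ha => h; rewrite -(subrK c a); apply: vgeD.
    by rewrite linear0 subrr.
  - move=> a b ha ab; rewrite -[LHS]/(upper c <.> n (a - c) - n a).
    rewrite -[RHS]/(upper c <.> n (b - c) - n b) (nC a b) // (nC _ (b - c)) //.
      exact: vgeB.
    by move: ab; congr val_ge; ring.
  rewrite -[X in _ + X]/(\sum_(a <- residues F) (upper c <.> n (a - c) - n a)).
  rewrite sumrB sn -linear_sum (@sum_residues _ _ _ n (fun a => a - c)).
  - by rewrite sn addrACA -opprD -linearD fx // subrr.
  - by move=> x y hx _; apply: nC.
  - by move=> a ha; apply: vgeB.
  - by move=> x y _ _; congr val_ge; ring.
have key1 c : int c -> upper c <.> r = r by move=> /key[].
have key2 c : int c -> upper c <.> n 0 = n c.
  by move=> /key[_ /(congr1 (@^~ c)) /=]; rewrite subrr.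
split=> //; exists (n 0); split.
- by have [b Bb ->] := nB 0 (vge0 _ _); rewrite upper0 rep_act1.
- by move=> c hc; rewrite key2 ?intW // (nC c 0) ?subr0 // intW.
move=> a ar; have ha := residues_int ar.
have : upper a <.> m a = upper a <.> n 0 by rewrite key2 // /n ha residue_id.
by move/(congr1 (rep_act V (invmx (upper a)))); rewrite !actK //; exact: GL2_upper.
Qed.

End DirectSum.

(** * Iwahori eigenvectors and the quadratic relation *)

Section Hecke.
Context {p : nat} {F : local_field p} (w : uniformizer F) {C : closedFieldType}.
Variables (V : rep C (GL2 F)) (omega : F -> C).
Hypotheses (p_prime : prime p) (charC : p \in GRing.pchar C).
Hypothesis omega_neq0 : forall a, a != 0 -> omega a != 0.
Hypothesis omegaM : forall a b, a != 0 -> b != 0 -> omega (a * b) = omega a * omega b.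
Hypothesis omegaP : forall a, a != 0 -> forall x : V, a%:M <.> x = omega a *: x.
Implicit Types (x u : V) (a b c : F) (chi : F -> C).

Let w0 : (w : F) != 0 := unif_neq0 w.

(** The eigenvectors of the Iwahori group: by the Iwahori factorization, this
    group is generated by the matrices considered here and by scalars. *)
Definition iwahori_eigen chi x : Prop :=
  [/\ forall b, int b -> upper b <.> x = x,
      forall c, vge c 1 -> lower c <.> x = x
    & forall a, int_unit a -> dilate a <.> x = chi a *: x].

(** The character of the torus on [Pi x] when [chi] is its character on [x]:
    conjugation by [Pi] exchanges the diagonal entries. *)
Definition twist chi a : C := omega a * chi a^-1.

Lemma iwahori_eigen_ext chi chi' x : (forall a, int_unit a -> chi a = chi' a) ->
  iwahori_eigen chi x -> iwahori_eigen chi' x.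
Proof. by move=> e [h1 h2 h3]; split=> // a ha; rewrite h3 // e. Qed.

Lemma twistK chi a : int_unit a -> twist (twist chi) a = chi a.
Proof.
move=> /unit_neq0 a0; rewrite /twist mulrA -omegaM ?invr_neq0 // divff // invrK.
have o1 : omega 1 = 1.
  have := omegaM (oner_neq0 F) (oner_neq0 F); rewrite mul1r => /eqP.
  rewrite -subr_eq0 -{1}[omega 1]mulr1 -mulrBr mulf_eq0 (negPf (omega_neq0 (oner_neq0 F))).
  by rewrite subr_eq0 => /eqP <-.
by rewrite o1 mul1r.
Qed.

Lemma iwahori_eigen0 chi : iwahori_eigen chi 0.
Proof. by split=> *; rewrite ?linear0 ?scaler0. Qed.

Lemma iwahori_eigenP chi e x y : iwahori_eigen chi x -> iwahori_eigen chi y ->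
  iwahori_eigen chi (e *: x + y).
Proof.
move=> [h1 h2 h3] [k1 k2 k3]; split=> a ha; rewrite linearP ?h1 ?h2 ?h3 //.
- by rewrite k1.
- by rewrite k2.
- by rewrite k3 // scalerDr !scalerA mulrC.
Qed.

Definition iwahori_eigenspace chi : subspace V :=
  Subspace (iwahori_eigen0 chi) (@iwahori_eigenP chi).

(** On Iwahori eigenvectors these are the Hecke operators of the double cosets
    of [step w 0] and of [bruhat 0]. *)
Definition step_sum x : V := \sum_(a <- residues F) step w a <.> x.
Definition bruhat_sum x : V := \sum_(a <- residues F) bruhat a <.> x.

Lemma step_sum_linear : linear step_sum.
Proof.
move=> e x y; rewrite /step_sum scaler_sumr -big_split /=.
by apply: eq_bigr => a _; rewrite linearP.
Qed.

Lemma bruhat_sum_linear : linear bruhat_sum.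
Proof.
move=> e x y; rewrite /bruhat_sum scaler_sumr -big_split /=.
by apply: eq_bigr => a _; rewrite linearP.
Qed.

HB.instance Definition _ :=
  GRing.isLinear.Build C V V _ step_sum step_sum_linear.
HB.instance Definition _ :=
  GRing.isLinear.Build C V V _ bruhat_sum bruhat_sum_linear.

Local Notation S := step_sum.
Local Notation T := bruhat_sum.
Local Notation PI := (Pi w).

Lemma step_sumE x : S x = T (PI <.> x).
Proof. by apply: eq_bigr => a _; rewrite act_step_bruhat. Qed.

Lemma Pi_Pi x : PI <.> PI <.> x = omega w *: x.
Proof. by rewrite actM; auto with gl2; rewrite Pi_sqr omegaP. Qed.

Lemma bruhat_congr chi u a b : iwahori_eigen chi u -> vge (a - b) 1 ->
  bruhat a <.> u = bruhat b <.> u.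
Proof.
move=> [_ h _] /vgeC ab; rewrite -[in RHS](subrK a b) [b - a + a]addrC -bruhat_lower -actM ?h //.
  exact: GL2_bruhat.
exact: GL2_lower.
Qed.

Lemma iwahori_eigen_Pi chi x : iwahori_eigen chi x ->
  iwahori_eigen (twist chi) (PI <.> x).
Proof.
move=> [h1 h2 h3]; split.
- by move=> b hb; rewrite act_upper_Pi h2 //; exact: vge_wM.
- move=> c hc; have -> : c = (w : F) * (c / (w : F)) by rewrite mulrC divfK.
  by rewrite act_lower // h1 //; exact: vge1_divw.
move=> a ha; have a0 := unit_neq0 ha.
have -> : dilate a <.> PI <.> x = PI <.> a%:M <.> dilate a^-1 <.> x.
  have aG := GL2_scalar a0; have a1G : GL2 F (dilate a^-1) by apply: GL2_affine; rewrite invr_neq0.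
  have aG' : GL2 F (dilate a) by exact: GL2_affine.
  rewrite !actM; auto with gl2; congr (_ <.> x).
  by rewrite mat2_scalar !mat2M; congr mat2; field.
by rewrite h3 ?int_unitV // omegaP // scalerA linearZ.
Qed.

Definition unipotent_scalar chi a : C := omega (- a^-1) * chi (- a ^+ 2).

Lemma act_torus_unipotent chi u a : iwahori_eigen chi u -> int_unit a ->
  mat2 a 1 0 (- a^-1) <.> u = unipotent_scalar chi a *: u.
Proof.
move=> [h1 h2 h3] ha; have a0 := unit_neq0 ha; rewrite torus_unipotent //.
have ua : int_unit (- a ^+ 2).
  rewrite -mulN1r expr2; apply: int_unitM; last exact: int_unitM.
  by rewrite /int_unit oppr_eq0 oner_neq0 valN1.
have na0 : - a^-1 != 0 by rewrite oppr_eq0 invr_neq0.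
have G1 := GL2_scalar na0; have G2 : GL2 F (dilate (- a ^+ 2)).
  by apply: GL2_affine; exact: unit_neq0.
rewrite -!actM; auto with gl2.
by rewrite h1 ?h3 ?int_unit_ge ?int_unitV // linearZ /= omegaP // scalerA mulrC.
Qed.

Lemma bruhat_bruhat_unit chi u a b : iwahori_eigen chi u -> int_unit b ->
  bruhat a <.> bruhat b <.> u = unipotent_scalar chi b *: bruhat (a + b^-1) <.> u.
Proof.
move=> eu hb; have b0 := unit_neq0 hb; rewrite actM; auto with gl2.
have G : GL2 F (mat2 b 1 0 (- b^-1)).
  by apply/GL2E; rewrite det_mat2 mulr0 subr0 mulrN divff // oppr_eq0 oner_neq0.
rewrite bruhat_mul_unit // -actM; auto with gl2.
by rewrite (act_torus_unipotent eu) // linearZ.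
Qed.

Lemma bruhat_bruhat_nonunit chi u a b : iwahori_eigen chi u -> int a -> vge b 1 ->
  bruhat a <.> bruhat b <.> u = u.
Proof.
move=> [h1 h2 _] ha hb; rewrite actM; auto with gl2.
by rewrite bruhat_mul -actM; auto with gl2; rewrite h2 // h1.
Qed.

Lemma sum_nonunit (U : zmodType) (y : U) :
  \sum_(a <- residues F | ~~ int_unit a) y = y.
Proof.
have [rs r0] := residueP (vge0 F 0); rewrite sub0r in r0.
have rn : ~~ int_unit (residue (0 : F)).
  by rewrite int_unitE -[X in vge X 1]opprK (vgeN r0) andbF.
rewrite big_mkcond (bigD1_seq (residue (0 : F))) ?residues_uniq //= rn.
rewrite big_seq_cond big1 ?addr0 // => a /andP[ar ra]; case: ifP => // na.
have a1 : vge a 1 by have [/(negP na)|] := int_unitP (residues_int ar).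
case/eqP: ra; rewrite -(residue_id ar); apply: residue_congr.
  exact: residues_int.
by rewrite subr0.
Qed.

Definition hecke_scalar chi : C :=
  \sum_(a <- residues F | int_unit a) unipotent_scalar chi a.

(** The quadratic relation. In the double sum over [bruhat a *m bruhat b], the
    terms with [b] a unit give multiples of [T u]; the others give [u] once for
    each element of the residue field, that is [0] in characteristic [p]. *)
Lemma bruhat_sum_sqr chi u : iwahori_eigen chi u -> T (T u) = hecke_scalar chi *: T u.
Proof.
move=> eu; rewrite {1}/bruhat_sum.
under eq_bigr => a _ do rewrite /bruhat_sum linear_sum.
rewrite exchange_big /= (bigID (@int_unit p F)) /= [X in _ + X]big_seq_cond [X in _ + X]big1.
  rewrite addr0 /hecke_scalar scaler_suml; apply: eq_bigr => b hb.
  under eq_bigr => a _ do rewrite (bruhat_bruhat_unit _ eu hb).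
  rewrite -scaler_sumr; congr (_ *: _).
  apply: (@sum_residues _ _ _ (fun a => bruhat a <.> u) (fun a => a + b^-1)).
  - by move=> x y _ _; apply: bruhat_congr eu.
  - by move=> a ha; apply: vgeD => //; exact/int_unit_ge/int_unitV.
  - by move=> x y _ _; congr val_ge; ring.
move=> b /andP[br nb].
have b1 : vge b 1 by have [/(negP nb)|] := int_unitP (residues_int br).
under eq_big_seq => a ar do rewrite (bruhat_bruhat_nonunit eu (residues_int ar) b1).
by rewrite big_const_seq count_predT iter_addr_0 -scaler_nat size_residues0 // scale0r.
Qed.

Lemma bruhat_bruhat_sum chi u : iwahori_eigen chi u -> bruhat 0 <.> T u =
  u + \sum_(b <- residues F | int_unit b) unipotent_scalar chi b *: bruhat b^-1 <.> u.
Proof.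
move=> eu; rewrite /bruhat_sum linear_sum (bigID (@int_unit p F)) /= addrC; congr (_ + _).
  rewrite -[RHS]sum_nonunit big_seq_cond [RHS]big_seq_cond.
  apply: eq_bigr => b /andP[br nb].
  have b1 : vge b 1 by have [/(negP nb)|] := int_unitP (residues_int br).
  exact: (bruhat_bruhat_nonunit eu (vge0 F 0) b1).
by apply: eq_bigr => b hb; rewrite (bruhat_bruhat_unit _ eu hb) add0r.
Qed.

(** The operator [T] is a sum over a double coset of the pro-[p] Iwahori group.
    For the lower unipotent matrices, [lower c *m bruhat a] is
    [bruhat (a / e) *m mat2 e c 0 e^-1] with [e = 1 + c * a], where the last
    factor is a product of unipotent matrices that fix [u]. *)
Lemma iwahori_eigen_bruhat chi u : iwahori_eigen chi u -> iwahori_eigen (twist chi) (T u).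
Proof.
move=> eu; have [h1 h2 h3] := eu.
have bC a b : int a -> int b -> vge (a - b) 1 -> bruhat a <.> u = bruhat b <.> u.
  by move=> _ _; apply: bruhat_congr eu.
split.
- move=> b hb; rewrite linear_sum /=.
  rewrite -[RHS](sum_residues (phi := fun a => a + b) bC).
  + by apply: eq_bigr => a _; rewrite actM ?bruhat_upper; auto with gl2.
  + by move=> a ha; apply: vgeD.
  + by move=> x y _ _; congr val_ge; ring.
- move=> c hc; rewrite linear_sum /=; apply: eq_big_seq => a /residues_int ha.
  pose e := 1 + c * a; have ue : int_unit e.
    by apply: int_unitD; [exact: int_unit1|exact: vgeMr].
  have e0 := unit_neq0 ue; have eO := int_unit_ge (int_unitV ue).
  have fixu : (mat2 e c 0 e^-1) <.> u = u.
    have -> : mat2 e c 0 e^-1 =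
        lower (- c / e) *m upper a *m lower c *m upper ((c - a) / e).
      by rewrite !mat2M; congr mat2; rewrite /e in e0 *; field.
    rewrite -!actM; auto with gl2; rewrite h1; last first.
      by apply: intM => //; apply: vgeB => //; exact: intW.
    rewrite h2 // h1 // h2 //; exact/(vgeMr _ eO)/vgeN.
  have G : GL2 F (mat2 e c 0 e^-1).
    by apply/GL2E; rewrite det_mat2 divff // mulr0 subr0 oner_neq0.
  have -> : lower c <.> bruhat a <.> u = bruhat (a / e) <.> mat2 e c 0 e^-1 <.> u.
    rewrite !actM; auto with gl2; congr (_ <.> u).
    by rewrite !mat2M; congr mat2; rewrite /e in e0 *; field.
  rewrite fixu; apply: bruhat_congr eu _.
  have -> : a / e - a = - (c * (a * (a / e))) by rewrite /e in e0 *; field.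
  by apply/vgeN/(vgeMr hc)/intM/intM.
move=> d hd; have d0 := unit_neq0 hd.
rewrite linear_sum /= scaler_sumr.
pose f a := twist chi d *: bruhat a <.> u.
rewrite -[RHS](sum_residues (f := f) (phi := fun a => d * a)).
- apply: eq_bigr => a _; rewrite /f.
  have G1 := GL2_scalar d0; have G2 : GL2 F (dilate d) by exact: GL2_affine.
  have G3 : GL2 F (dilate d^-1) by apply: GL2_affine; rewrite invr_neq0.
  have -> : dilate d <.> bruhat a <.> u = bruhat (d * a) <.> d%:M <.> dilate d^-1 <.> u.
    rewrite !actM; auto with gl2; congr (_ <.> u).
    by rewrite mat2_scalar !mat2M; congr mat2; field.
  by rewrite h3 ?int_unitV // omegaP // scalerA linearZ.
- by move=> x y hx hy /(bC x y hx hy); rewrite /f => ->.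
- by move=> a; apply: intM; exact: int_unit_ge.
move=> x y _ _ h; have := vgeMl (int_unit_ge (int_unitV hd)) h.
by congr val_ge; field.
Qed.

Lemma iwahori_eigen_step chi x : iwahori_eigen chi x -> iwahori_eigen chi (S x).
Proof.
move=> ex; rewrite step_sumE; apply: iwahori_eigen_ext (@twistK chi) _.
exact/iwahori_eigen_bruhat/iwahori_eigen_Pi.
Qed.

Lemma iwahori_eigen_iter chi x i : iwahori_eigen chi x -> iwahori_eigen chi (iter i S x).
Proof. by move=> ex; elim: i => //= i; apply: iwahori_eigen_step. Qed.

Lemma iwahori_eigen_poly chi x P : iwahori_eigen chi x -> iwahori_eigen chi (poly_act S x P).
Proof.
move=> ex; apply: (@subspace_sum _ _ (iwahori_eigenspace chi)) => i _.
by apply: subspaceZ; exact: iwahori_eigen_iter.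
Qed.

Lemma step_Pi x : S (PI <.> x) = omega w *: T x.
Proof. by rewrite step_sumE Pi_Pi linearZ. Qed.

Lemma step_Pi_step chi x : iwahori_eigen chi x ->
  S (PI <.> S x) = (omega w * hecke_scalar (twist chi)) *: S x.
Proof.
move=> ex; rewrite step_Pi {1}step_sumE (bruhat_sum_sqr (iwahori_eigen_Pi ex)).
by rewrite -step_sumE scalerA.
Qed.

Section Absorption.
Variable Sg : subspace V.
Hypotheses (KZ_Sg : stable (KZ F) Sg) (Sg_gen : forall x, orbit_span Sg x).

(** The vectors that translations by [w ^ n] bring into the half-tree. *)
Definition absorbed (n : nat) x : Prop :=
  forall a, int a -> half Sg (mat2 ((w : F) ^+ n) a 0 1 <.> x).

Lemma absorbed_zero n : absorbed n 0.
Proof. by move=> a _; rewrite linear0; exact: subspace0. Qed.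

Lemma absorbedP n e x y : absorbed n x -> absorbed n y -> absorbed n (e *: x + y).
Proof. by move=> hx hy a ha; rewrite linearP; apply: subspaceP; [exact: hx|exact: hy]. Qed.

Definition absorbed_space n : subspace V := Subspace (absorbed_zero n) (@absorbedP n).

Lemma absorbed0 x : absorbed 0 x <-> half Sg x.
Proof.
split=> [h|h a ha]; last by rewrite expr0; apply: half_upper.
by have := h 0 (vge0 _ _); rewrite expr0 -[mat2 _ _ _ _]/(upper 0) upper0 rep_act1.
Qed.

Lemma act_affine a b c d x : a != 0 -> c != 0 ->
  mat2 a b 0 1 <.> mat2 c d 0 1 <.> x = mat2 (a * c) (a * d + b) 0 1 <.> x.
Proof. by move=> a0 c0; rewrite actM ?affine_M //; exact: GL2_affine. Qed.

Lemma absorbedS n x : absorbed n x -> absorbed n.+1 x.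
Proof.
move=> h a ha; have -> : mat2 ((w : F) ^+ n.+1) a 0 1 <.> x =
    step w a <.> mat2 ((w : F) ^+ n) 0 0 1 <.> x.
  by rewrite act_affine ?wexp_neq0 // exprS mulr0 add0r.
by apply: half_step => //; apply: h; exact: vge0.
Qed.

Lemma absorbed_le n m x : (n <= m)%N -> absorbed n x -> absorbed m x.
Proof.
by move=> /subnK <-; elim: (m - n)%N => // k IH h; rewrite addSn; apply/absorbedS/IH.
Qed.

(** By the Iwasawa decomposition the translates of [Sg] by affine
    matrices span the representation, and [w ^+ n] makes these integral. *)
Lemma absorbed_exists x : exists n, absorbed n x.
Proof.
have [t tA ->] := Sg_gen x; elim: t tA => [|u t IH] tA.
  by exists 0%N; rewrite big_nil; exact: absorbed_zero.
have [|n bn] := IH; first by move=> z zt; apply: tA; rewrite inE zt orbT.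
have [g [y [gG Sy eu]]] := tA u (mem_head _ _).
have [a [b [k [a0 kKZ eg]]]] := iwasawa gG.
have [n1 h1] := vge_exists w a; have [n2 h2] := vge_exists w b.
have hle (m k' : nat) c : (m <= k')%N -> int ((w : F) ^+ m * c) -> int ((w : F) ^+ k' * c).
  move=> /subnK <- h; rewrite exprD -mulrA; apply: intM h; exact: int_wexp.
pose m := maxn n1 n2; have [m1 m2] : (n1 <= m)%N /\ (n2 <= m)%N.
  by rewrite leq_maxl leq_maxr.
have bm : absorbed m ((mat2 a b 0 1 *m k) <.> y).
  move=> c hc; rewrite -actM; [|exact: GL2_affine|exact: GL2_KZ].
  rewrite act_affine ?wexp_neq0 //; apply: half_affine.
  - by rewrite mulf_neq0 ?wexp_neq0.
  - exact: hle h1.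
  - by apply: vgeD hc; exact: hle h2.
  - exact/half_base/KZ_Sg.
exists (maxn m n); rewrite big_cons eu eg; apply: absorbedP.
  by apply: absorbed_le bm; exact: leq_maxl.
by apply: absorbed_le bn; exact: leq_maxr.
Qed.

Lemma absorbed_step n x : absorbed n.+1 x -> absorbed n (S x).
Proof.
move=> h a ha; rewrite linear_sum; apply: subspace_sum => b /residues_int hb /=.
rewrite act_affine ?wexp_neq0 // -exprSr; apply: h.
by apply: vgeD ha; apply: intM hb; exact: int_wexp.
Qed.

(** Let [u = Pi x]. Then [bruhat 0 <.> T u] is [u] plus a combination of vectors
    [bruhat b <.> u = step w b <.> x], and [bruhat 0 <.> T u = bruhat 0 <.> S x]
    is a translate of [Pi (S x)]. *)
Lemma absorbed_Pi chi n x : iwahori_eigen chi x -> absorbed n.+1 x ->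
  absorbed n.+1 (PI <.> S x) -> absorbed n (PI <.> x).
Proof.
move=> ex hx hS a ha; have := bruhat_bruhat_sum (iwahori_eigen_Pi ex).
move=> /(congr1 (rep_act V (mat2 ((w : F) ^+ n) a 0 1))) e.
rewrite linearD /= -step_sumE in e; move/eqP: e; rewrite -subr_eq => /eqP <-.
apply: subspaceD; last first.
  apply: subspaceN; rewrite linear_sum -big_filter; apply: subspace_sum => b.
  rewrite mem_filter => /andP[hb _].
  rewrite linearZ; apply: subspaceZ; rewrite -act_step_bruhat act_affine ?wexp_neq0 //.
  rewrite -exprSr; apply: hx; apply: vgeD ha.
  by apply: intM; [exact: int_wexp|exact/int_unit_ge/int_unitV].
have -> : mat2 ((w : F) ^+ n) a 0 1 <.> bruhat 0 <.> S x =
    (omega w)^-1 *: mat2 ((w : F) ^+ n.+1) a 0 1 <.> PI <.> S x.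
  have e : bruhat 0 <.> PI <.> PI <.> S x = dilate (w : F) <.> PI <.> S x.
    by rewrite -act_step_bruhat; congr (_ <.> _).
  rewrite Pi_Pi linearZ /= in e.
  have ow : omega w != 0 by exact: omega_neq0.
  have {e} -> : bruhat 0 <.> S x = (omega w)^-1 *: dilate (w : F) <.> PI <.> S x.
    by rewrite -e scalerA mulVf // scale1r.
  by rewrite linearZ /= act_affine ?wexp_neq0 // -exprSr mulr0 add0r.
by apply: subspaceZ; apply: hS.
Qed.

(** As the [S^i v] span a finite-dimensional space, they and the [Pi (S^i v)] are
    absorbed by a common [w ^ N]; [S] contracts towards the half-tree and
    the previous lemma transports this to the other side, first for [i >= N]
    and then for decreasing [i]. *)
Lemma torsion_in_both_halves chi (e0 : C) v P : iwahori_eigen chi v -> T v = e0 *: v ->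
  P != 0 -> poly_act S v P = 0 -> half Sg v /\ half Sg (PI <.> v).
Proof.
move=> ev Tv P0 Pv; pose y i := iter i S v.
have ey i : iwahori_eigen chi (y i) by exact: iwahori_eigen_iter.
have SPy i : exists e : C, S (PI <.> y i) = e *: y i.
  case: i => [|i]; first by exists (omega w * e0); rewrite step_Pi Tv scalerA.
  by eexists; apply: step_Pi_step (ey i).
have bound (g : {linear V -> V}) : exists N, forall i, absorbed N (g (y i)).
  have [N NP] : exists N, forall i, (i < size P)%N -> absorbed N (g (y i)).
    elim: (size P) => [|k [N NP]]; first by exists 0%N.
    have [M MP] := absorbed_exists (g (y k)).
    exists (maxn M N) => i; rewrite ltnS leq_eqVlt => /orP[/eqP->|/NP].
      by apply: absorbed_le MP; exact: leq_maxl.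
    by apply: absorbed_le; exact: leq_maxr.
  by exists N; apply: (@iter_in_subspace _ _ _ P (absorbed_space N) g v).
have [N1 N1P] := bound idfun; have [N2 N2P] := bound (rep_act V PI).
pose N := maxn N1 N2.
have yN i : absorbed N (y i) by apply: absorbed_le (N1P i); exact: leq_maxl.
have PyN i : absorbed N (PI <.> y i) by apply: absorbed_le (N2P i); exact: leq_maxr.
have y0 i : (N <= i)%N -> absorbed 0 (y i).
  have aux k j : absorbed k (y j) -> absorbed 0 (y (k + j)%N).
    elim: k j => // k IH j h; rewrite addSnnS; apply: IH; exact: absorbed_step.
  by move=> /subnK <-; rewrite addnC; apply: aux.
have Py0 i : (N <= i)%N -> absorbed 0 (PI <.> y i).
  have aux k j : (k <= N)%N -> (N <= j)%N -> absorbed (N - k) (PI <.> y j).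
    elim: k j => [|k IH] j lek le_j; first by rewrite subn0; exact: PyN.
    have e : (N - k = (N - k.+1).+1)%N by lia.
    apply: (absorbed_Pi (ey j)); last by rewrite -e; apply: (IH j.+1); lia.
    by apply: absorbed_le (y0 j le_j).
  by move=> le_i; rewrite -(subnn N); apply: aux.
have key k : absorbed 0 (y (N - k)%N) /\ absorbed 0 (PI <.> y (N - k)%N).
  elim: k => [|k [IHy IHP]]; first by rewrite subn0; split; [exact: y0|exact: Py0].
  have [le_k|lt_k] := leqP N k.
    by have -> : (N - k.+1 = N - k)%N by lia.
  have e : (N - k = (N - k.+1).+1)%N by lia.
  move: (N - k.+1)%N e => i e; rewrite e in IHy IHP.
  have [e1 ec] := SPy i.
  (* Since [S (Pi y)] is a multiple of [y], the previous lemma also applies to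
   [Pi y], and its conclusion is then about [Pi (Pi y)], a multiple of [y]. *)
  have down n : absorbed n.+1 (y i) -> absorbed n (PI <.> y i).
    by move=> h; apply: (absorbed_Pi (ey i) h); apply: absorbed_le IHP.
  have up n : absorbed n.+1 (PI <.> y i) -> absorbed n (y i).
    move=> h; have := absorbed_Pi (iwahori_eigen_Pi (ey i)) h.
    rewrite ec Pi_Pi linearZ => /(_ (subspaceZ (W := absorbed_space n.+1) e1 h)).
    move=> /(subspaceZ (W := absorbed_space n) (omega w)^-1).
    by rewrite scalerA mulVf ?scale1r //; exact: omega_neq0.
  have all n : absorbed n (y i) -> absorbed 0 (y i).
    elim: n => // n IH h; apply: IH; apply: up; apply: absorbedS; exact: down.
  have h0 := all _ (yN i); split=> //.
  by apply: down; apply: absorbedS.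
have := key N; rewrite subnn => -[/absorbed0 h /absorbed0 h']; by split.
Qed.

End Absorption.

End Hecke.

(** * Torsion under the Hecke operator *)

Section Torsion.
Context {p : nat} {F : local_field p} (w : uniformizer F) {C : closedFieldType}.
Variables (V : rep C (GL2 F)) (omega : F -> C).
Hypotheses (p_prime : prime p) (charC : p \in GRing.pchar C).
Hypothesis omega_neq0 : forall a, a != 0 -> omega a != 0.
Hypothesis omegaM : forall a b, a != 0 -> b != 0 -> omega (a * b) = omega a * omega b.
Hypothesis omegaP : forall a, a != 0 -> forall x : V, a%:M <.> x = omega a *: x.
Hypotheses (V_smooth : smooth V) (V_irr : irreducible V).
Implicit Types (x y u : V) (a b c : F) (chi : F -> C) (P Q : {poly C}).

Local Notation S := (@step_sum p F w C V).
Local Notation T := (@bruhat_sum p F C V).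
Local Notation PI := (Pi w).
Let w0 : (w : F) != 0 := unif_neq0 w.

Lemma upper_fixed_vector (W : subspace V) x :
  (forall b y, int (b : F) -> W y -> W (upper b <.> y)) -> W x -> x != 0 ->
  exists y, [/\ W y, y != 0 & forall b, int (b : F) -> upper b <.> y = y].
Proof.
move=> WU Wx x0; have [N NP] := smooth_upper V_smooth x.
apply: (unipotent_fixed_vector w (rho := fun b => rep_act V (upper b)) p_prime charC
  _ _ WU Wx x0 NP).
- by move=> a b y; rewrite actM ?upperD //; exact: GL2_upper.
- by move=> y; rewrite upper0 rep_act1.
Qed.

Lemma iwahori_eigen_act chi g x : iwahori_eigen chi x -> iwahori F g ->
  exists e : C, g <.> x = e *: x.
Proof.
move=> [h1 h2 h3] /iwahori_factor[c [z [a [b [hc hz ha hb ->]]]]].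
have z0 := unit_neq0 hz; have Gz := GL2_scalar z0.
have Ga : GL2 F (dilate a) by apply: GL2_affine; exact: unit_neq0.
exists (omega z * chi a); rewrite -!actM; auto with gl2.
by rewrite h1 // h3 // linearZ /= omegaP // scalerA !linearZ /= h2 // mulrC.
Qed.

Variables (chi : F -> C) (v : V) (e0 : C).
Hypotheses (ev : iwahori_eigen chi v) (Tv : T v = e0 *: v).

Section Free.
Hypothesis free : forall P, poly_act S v P = 0 -> P = 0.

Lemma PI_inj x y : PI <.> x = PI <.> y -> x = y.
Proof.
move/(congr1 (rep_act V PI)); rewrite !(Pi_Pi w omegaP).
exact/scalerI/omega_neq0.
Qed.

(** The relations [S Pi S = const S] and [S Pi v = const v] turn a relation
    between the [S^i v] and the [Pi (S^i v)] into one between the [S^i v]. *)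
Lemma relation_size P Q : poly_act S v P + PI <.> poly_act S v Q = 0 ->
  (size P <= (size Q).-1)%N.
Proof.
elim/poly_ind: Q => [|Q q0 _].
  rewrite linear0 linear0 addr0 => /free->; by rewrite size_poly0.
set e1 := omega w * hecke_scalar omega (twist omega chi).
have eQ : S (PI <.> poly_act S v (Q * 'X + q0%:P)) =
    poly_act S v (e1 *: (Q * 'X) + (q0 * (omega w * e0))%:P).
  rewrite !linearD /= poly_actMX !poly_actC !linearZ /= poly_actMX.
  have eQ := iwahori_eigen_poly w omega_neq0 omegaM omegaP Q ev.
  rewrite (step_Pi_step w p_prime charC omegaP eQ).
  by rewrite (step_Pi w omegaP) Tv !scalerA.
move=> /(congr1 S); rewrite /= [LHS]linearD /= eQ [RHS]linear0 -poly_actMX.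
rewrite -linearD => /free h.
have -> : P = - e1 *: Q.
  apply/polyP => i; have := congr1 (fun R : {poly C} => R`_i.+1) h.
  rewrite !coefD coefZ !coefMX coefC coefZ /= addr0 coef0 mulNr => /eqP.
  by rewrite addr_eq0 => /eqP.
apply: leq_trans (size_scale_leq _ _) _; rewrite size_MXaddC.
by case: eqVneq => //= ->; rewrite size_poly0.
Qed.

(** By the previous lemma, applied to a relation and to its image under [Pi],
    each of [P] and [Q], if nonzero, has smaller size than the other. *)
Lemma relation_free P Q : poly_act S v P + PI <.> poly_act S v Q = 0 -> P = 0 /\ Q = 0.
Proof.
move=> h; have h1 := relation_size h.
have h2 : (size Q <= (size P).-1)%N.
  rewrite -(@size_scale _ (omega w) Q); last exact: omega_neq0.
  apply: relation_size; rewrite linearZ /= -(Pi_Pi w omegaP) -linearD addrC h.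
  exact: linear0.
by split; apply/eqP; rewrite -size_poly_eq0; lia.
Qed.

Let u := PI <.> v.
Let v1 := S v.
Let eu : iwahori_eigen (twist omega chi) u := iwahori_eigen_Pi w omegaP ev.
Let ev1 : iwahori_eigen chi v1 :=
  iwahori_eigen_step w omega_neq0 omegaM omegaP ev.

Let v1E : v1 = T u. Proof. exact: step_sumE. Qed.

Lemma vS_poly P : poly_act S v1 P = poly_act S v (P * 'X).
Proof. by rewrite poly_actM poly_actX. Qed.

Lemma free1 P : poly_act S v1 P = 0 -> P = 0.
Proof. by rewrite vS_poly => /free/eqP; rewrite mulf_eq0 polyX_eq0 orbF => /eqP. Qed.

Lemma relation_uv1 (e e' : C) : e *: u + e' *: v1 = 0 -> e = 0 /\ e' = 0.
Proof.
move=> h; have [|h1 h2] := @relation_free (e' *: 'X) e%:P.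
  rewrite linearZ /= poly_actX poly_actC linearZ.
  by rewrite addrC.
split; apply/eqP; first by rewrite -polyC_eq0 h2.
by move/eqP: h1; rewrite scaler_eq0 polyX_eq0 orbF.
Qed.

Lemma u_neq0 : u != 0.
Proof.
apply/eqP => u0; have [|/eqP] := @relation_uv1 1 0; last by rewrite oner_eq0.
by rewrite u0 scaler0 scale0r addr0.
Qed.

Lemma v1_neq0 : v1 != 0.
Proof.
apply/eqP => u0; have [|_ /eqP] := @relation_uv1 0 1; last by rewrite oner_eq0.
by rewrite u0 scaler0 scale0r addr0.
Qed.

Lemma bruhat_u_neq0 a : bruhat a <.> u != 0.
Proof.
apply: contraNneq u_neq0 => h.
by rewrite -[u](actK (g := bruhat a)) ?h ?linear0 //; exact: GL2_bruhat.
Qed.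

Lemma line0 x : exists e : C, 0 = e *: x. Proof. by exists 0; rewrite scale0r. Qed.

Lemma lineP x (e : C) y z : (exists d : C, y = d *: x) -> (exists d : C, z = d *: x) ->
  exists d : C, e *: y + z = d *: x.
Proof.
by move=> [d ->] [d' ->]; exists (e * d + d'); rewrite scalerDl scalerA.
Qed.

Definition line x : subspace V := Subspace (line0 x) (@lineP x).

Definition comb (e : C) (m : F -> C) : V :=
  e *: u + \sum_(a <- residues F) m a *: bruhat a <.> u.

(** The unipotent group fixes [u] and permutes the [bruhat a <.> u], which sum to
    [v1]; a relation fixed by this group is thus one between [u] and [v1]. *)
Lemma comb_fixed e m : (forall c, int (c : F) -> upper c <.> comb e m = comb e m) ->
  exists e' : C, comb e m = e *: u + e' *: v1 /\ forall a, a \in residues F -> m a = e'.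
Proof.
have eb a : bruhat a <.> u = upper a <.> bruhat 0 <.> u.
  rewrite actM; [|exact: GL2_upper|exact: GL2_bruhat].
  by rewrite bruhat_upper add0r.
move=> fx.
have RU b x : int b -> line u x -> line u (upper b <.> x).
  by move=> hb [d ->]; exists d; rewrite linearZ /=; case: eu => ->.
have BU b x : vge b 1 -> line (bruhat 0 <.> u) x -> line (bruhat 0 <.> u) (upper b <.> x).
  move=> hb [d ->]; exists d; rewrite linearZ /= -eb.
  by rewrite (bruhat_congr eu (b := 0)) // subr0.
have RB (r b : V) : line u r -> line (bruhat 0 <.> u) b ->
    (forall c, int (c : F) -> upper c <.> r = r) ->
    (forall c, vge (c : F) 1 -> upper c <.> b = b) ->
    r + \sum_(a <- residues F) upper a <.> b = 0 -> r = 0 /\ b = 0.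
  move=> [d ->] [d' ->] _ _.
  have -> : \sum_(a <- residues F) upper a <.> (d' *: bruhat 0 <.> u) = d' *: v1.
    by rewrite v1E /bruhat_sum scaler_sumr; apply: eq_bigr => a _; rewrite linearZ /= -eb.
  by move=> /relation_uv1[-> ->]; rewrite !scale0r.
have ec : e *: u + \sum_(a <- residues F) upper a <.> (m a *: bruhat 0 <.> u) = comb e m.
  by congr (_ + _); apply: eq_bigr => a _; rewrite linearZ /= -eb.
have [| | |_ [b [[e' ->] _ mb]]] := fixed_sum w p_prime charC V_smooth RU BU RB
    (r := e *: u) (m := fun a => m a *: bruhat 0 <.> u).
- by exists e.
- by move=> a _; exists (m a).
- by move=> c hc; rewrite ec; exact: fx.
have me a : a \in residues F -> m a = e'.
  move=> /mb/eqP; rewrite -subr_eq0 -scalerBl scaler_eq0 (negPf (bruhat_u_neq0 0)) orbF.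
  by rewrite subr_eq0 => /eqP.
exists e'; split=> //; congr (_ + _); rewrite v1E /bruhat_sum scaler_sumr.
by apply: eq_big_seq => a /me->.
Qed.

Lemma comb_free e m : comb e m = 0 -> e = 0 /\ forall a, a \in residues F -> m a = 0.
Proof.
move=> h; have [c hc|e' [e1 me]] := @comb_fixed e m; first by rewrite h linear0.
by move: e1; rewrite h => /esym/relation_uv1[-> e'0]; split=> // a /me->.
Qed.

Let ce := hecke_scalar omega (twist omega chi).

(** A hyperplane of the representation of [K] generated by [u], in the coordinates
    given by [comb]. It contains the translates of [v1]: for [v1] itself, [e] is
    [0] and the sum of the [m a] is the number of residues, which is [0] in
    [C]; for [bruhat b <.> v1], [e] is [1] and the sum of the [m a] is the Hecke
    eigenvalue [ce]. *)
Definition hyperplane_set x : Prop :=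
  exists e m, x = comb e m /\ \sum_(a <- residues F) m a = ce * e.

Lemma hyperplane0 : hyperplane_set 0.
Proof.
exists 0, (fun=> 0); rewrite /comb scale0r add0r !big1 ?mulr0 // => a _.
by rewrite scale0r.
Qed.

Lemma hyperplaneP e x y : hyperplane_set x -> hyperplane_set y -> hyperplane_set (e *: x + y).
Proof.
move=> [d [m [-> sm]]] [d' [m' [-> sm']]]; exists (e * d + d'), (fun a => e * m a + m' a).
split; last by rewrite big_split /= -mulr_sumr sm sm'; ring.
rewrite /comb scalerDr addrACA scalerDl scalerA; congr (_ + _).
rewrite scaler_sumr -big_split /=; apply: eq_bigr => a _.
by rewrite scalerDl scalerA.
Qed.

Definition hyperplane : subspace V := Subspace hyperplane0 hyperplaneP.

Definition indic a b : C := (b == residue a)%:R.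

Lemma sum_indic (U : lmodType C) (f : F -> U) a : int a ->
  \sum_(b <- residues F) indic a b *: f b = f (residue a).
Proof.
move=> ha; have [rs _] := residueP ha.
rewrite (bigD1_seq (residue a)) ?residues_uniq //= /indic eqxx scale1r big1 ?addr0 //.
by move=> b /negPf->; rewrite scale0r.
Qed.

Lemma bruhat_indic a : int a ->
  bruhat a <.> u = \sum_(b <- residues F) indic a b *: bruhat b <.> u.
Proof.
move=> ha; rewrite (sum_indic (fun b => bruhat b <.> u)) //.
by apply: bruhat_congr eu _; have [] := residueP ha.
Qed.

Lemma sum_indic1 a : int a -> \sum_(b <- residues F) indic a b = 1.
Proof.
move=> ha; rewrite -[RHS](sum_indic (fun=> 1 : C^o) ha); apply: eq_bigr => b _.
by rewrite -[RHS]/(indic a b * 1) mulr1.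
Qed.

Lemma hyperplane_v1 : hyperplane v1.
Proof.
exists 0, (fun=> 1); split.
  by rewrite /comb scale0r add0r v1E; apply: eq_bigr => a _; rewrite scale1r.
by rewrite big_const_seq count_predT iter_addr_0 size_residues0 // mulr0.
Qed.

Lemma hyperplane_bruhat_v1 a : int a -> hyperplane (bruhat a <.> v1).
Proof.
move=> ha; have -> : bruhat a <.> v1 = upper a <.> bruhat 0 <.> v1.
  rewrite actM; [|exact: GL2_upper|exact: GL2_bruhat].
  by rewrite bruhat_upper add0r.
rewrite v1E (bruhat_bruhat_sum omegaP eu).
pose us := unipotent_scalar omega (twist omega chi).
exists 1, (fun c => \sum_(b <- residues F | int_unit b) us b * indic (b^-1 + a) c).
have hb b : int_unit b -> int (b^-1 + a).
  by move=> /int_unitV/int_unit_ge hb; apply: vgeD.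
split.
  rewrite linearD /= /comb scale1r; congr (_ + _); first by case: eu => ->.
  rewrite linear_sum /=.
  under [RHS]eq_bigr => c _ do rewrite scaler_suml.
  rewrite exchange_big /=; apply: eq_bigr => b ub.
  rewrite linearZ /= actM ?bruhat_upper; auto with gl2.
  rewrite (bruhat_indic (hb _ ub)) scaler_sumr.
  by apply: eq_bigr => c _; rewrite scalerA.
rewrite exchange_big /= mulr1; apply: eq_bigr => b ub.
by rewrite -mulr_sumr sum_indic1 ?mulr1 // hb.
Qed.

Definition sigma1 : subspace V :=
  span [set y | exists2 k, KZ F k & y = k <.> v1]%classic.

Lemma sigma1_stable : stable (KZ F) sigma1.
Proof.
have [_ _ KZM _] := KZ_subgroup F.
move=> k kKZ; apply: span_image => _ [k' kKZ' ->]; apply: mem_span.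
by exists (k *m k'); [exact: KZM|rewrite actM //; exact: GL2_KZ].
Qed.

Lemma sigma1_v1 : sigma1 v1.
Proof.
have [_ KZ1 _ _] := KZ_subgroup F.
by apply: mem_span; exists 1%:M; rewrite ?rep_act1.
Qed.

Lemma sigma1_hyperplane x : sigma1 x -> hyperplane x.
Proof.
apply: span_subset => _ [_ [k [z [kK [a a0 ->] ->]]] ->].
rewrite -actM; [|exact: GL2_maxK|exact: GL2_scalar].
rewrite omegaP // linearZ; apply: (subspaceZ (W := hyperplane)).
have [kI|[b [i [hb iI ->]]]] := maxK_cases kK.
  by have [d ->] := iwahori_eigen_act ev1 kI; apply: (subspaceZ (W := hyperplane)) hyperplane_v1.
rewrite -actM; [|exact: GL2_bruhat|exact: GL2_iwahori].
have [d ->] := iwahori_eigen_act ev1 iI.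
by rewrite linearZ; apply: (subspaceZ (W := hyperplane)) (hyperplane_bruhat_v1 hb).
Qed.

(** A fixed vector of [sigma1] is a combination of [u] and [v1]. If [u] occurred
    in it, then [sigma1] would contain [u], hence [bruhat 0 <.> u], which is not
    in the hyperplane. *)
Lemma sigma1_fixed x : sigma1 x -> (forall c, int (c : F) -> upper c <.> x = x) ->
  exists e : C, x = e *: v1.
Proof.
move=> sx fx; have [e [m [ex _]]] := sigma1_hyperplane sx.
have [|e' [e1 _]] := @comb_fixed e m; first by rewrite -ex.
have [eq0|en0] := eqVneq e 0.
  by exists e'; rewrite ex e1 eq0 scale0r add0r.
have su : sigma1 u.
  have -> : u = e^-1 *: (x - e' *: v1) by rewrite ex e1 addrK scalerA mulVf ?scale1r.
  by apply/subspaceZ/subspaceB => //; exact: sigma1_v1.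
have : sigma1 (bruhat 0 <.> u).
  by apply: sigma1_stable su; apply/maxK_KZ/maxK_bruhat; exact: vge0.
move=> /sigma1_hyperplane[d [m' [ed sm]]].
have [|d0 md] := @comb_free d (fun a => m' a - indic 0 a).
  rewrite /comb; under eq_bigr => a _ do rewrite scalerBl.
  rewrite sumrB -bruhat_indic ?vge0 // addrA -/(comb d m') -ed.
  by rewrite subrr.
have /eqP : \sum_(a <- residues F) indic 0 a = 0.
  have sm0 : \sum_(a <- residues F) m' a = 0 by rewrite sm d0 mulr0.
  rewrite -[RHS]sm0; apply: eq_big_seq => a /md/eqP.
  by rewrite subr_eq0 => /eqP.
by rewrite sum_indic1 ?vge0 // oner_eq0.
Qed.

(** The fixed vectors of a ball come from a fixed vector at the root and from the
    same fixed vector on all branches, that is from [sigma1] and from the image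
    under [S] of a fixed vector of a smaller ball. *)
Lemma half_ball_fixed n x : half_ball w sigma1 n x ->
  (forall c, int (c : F) -> upper c <.> x = x) -> exists P, x = poly_act S v1 P.
Proof.
elim: n x => [|n IH] x.
  by move=> sx /(sigma1_fixed sx)[e ->]; exists e%:P; rewrite poly_actC.
move=> [s [m [ss mb ex]]] fx.
have dG : GL2 F (dilate (w : F)) by exact: GL2_affine.
have B0 : exists2 y, half_ball w sigma1 n y & 0 = dilate (w : F) <.> y.
  by exists 0; [exact: half_ball0|rewrite linear0].
have BP (e : C) y z : (exists2 y', half_ball w sigma1 n y' & y = dilate (w : F) <.> y') ->
    (exists2 y', half_ball w sigma1 n y' & z = dilate (w : F) <.> y') ->
    exists2 y', half_ball w sigma1 n y' & e *: y + z = dilate (w : F) <.> y'.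
  move=> [y' hy' ->] [z' hz' ->]; exists (e *: y' + z'); first exact: half_ballP.
  by rewrite linearP.
pose B := Subspace B0 BP.
have dU c y : upper ((w : F) * c) <.> dilate (w : F) <.> y = dilate (w : F) <.> upper c <.> y.
  rewrite !actM; auto with gl2; congr (_ <.> y).
  by rewrite !mat2M; congr mat2; ring.
have fixB y : half_ball w sigma1 n y ->
    (forall c, vge (c : F) 1 -> upper c <.> dilate (w : F) <.> y = dilate (w : F) <.> y) ->
    exists P, y = poly_act S v1 P.
  move=> hy fy; apply: IH => // c hc.
  have /(congr1 (rep_act V (invmx (dilate (w : F))))) := fy _ (vge_wM w hc).
  by rewrite dU !actK.
have sumE y : \sum_(a <- residues F) upper a <.> dilate (w : F) <.> y = S y.
  apply: eq_bigr => a _; rewrite actM; auto with gl2; congr (_ <.> y).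
  by rewrite !mat2M; congr mat2; ring.
have RU b y : int b -> sigma1 y -> sigma1 (upper b <.> y).
  by move=> hb; apply/sigma1_stable/maxK_KZ/iwahori_maxK/iwahori_upper.
have BU b y : vge b 1 -> B y -> B (upper b <.> y).
  move=> hb [z hz ->]; exists (upper (b / (w : F)) <.> z).
    by apply: (half_ball_upper sigma1_stable) => //; exact: vge1_divw.
  by rewrite -dU mulrC divfK.
have RB (r b : V) : sigma1 r -> B b -> (forall c, int (c : F) -> upper c <.> r = r) ->
    (forall c, vge (c : F) 1 -> upper c <.> b = b) ->
    r + \sum_(a <- residues F) upper a <.> b = 0 -> r = 0 /\ b = 0.
  move=> sr [y hy ->] fr fy; have [e er] := sigma1_fixed sr fr.
  have [P eP] := fixB y hy fy; rewrite sumE er eP.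
  rewrite -[e *: v1](poly_actC [the {linear _ -> _} of S]) -poly_actMX -linearD => /free1 h.
  have P0 : P = 0.
    apply/polyP => i; have := congr1 (fun R : {poly C} => R`_i.+1) h.
    by rewrite coefD coefMX coefC add0r !coef0.
  move: h; rewrite P0 mul0r addr0 => /eqP; rewrite polyC_eq0 => /eqP->.
  by rewrite polyC0 !linear0.
have ec : s + \sum_(a <- residues F) upper a <.> dilate (w : F) <.> m a = x.
  rewrite ex; congr (_ + _); apply: eq_bigr => a _; rewrite actM; auto with gl2.
  by congr (_ <.> _); rewrite !mat2M; congr mat2; ring.
have [| | |fs [b [[y hy eb] fb mbE]]] := fixed_sum w p_prime charC V_smooth RU BU RB
    (r := s) (m := fun a => dilate (w : F) <.> m a).
- exact: ss.
- by move=> a _; exists (m a); [exact: mb|].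
- by move=> c hc; rewrite ec; exact: fx.
have [e es] := sigma1_fixed ss fs.
rewrite eb in fb; have [P eP] := fixB y hy fb.
exists (e%:P + P * 'X); rewrite linearD /= poly_actC poly_actMX -eP ex es; congr (_ + _).
rewrite /= -[RHS]sumE; apply: eq_big_seq => a /mbE em; rewrite -eb -em actM; auto with gl2.
by congr (_ <.> _); rewrite !mat2M; congr mat2; ring.
Qed.

Lemma half_fixed x : half sigma1 x ->
  (forall c, int (c : F) -> upper c <.> x = x) -> exists P, x = poly_act S v1 P.
Proof.
by move=> /(half_ball_exists w sigma1_stable)[n]; exact: half_ball_fixed.
Qed.

(** A nonzero intersection has a nonzero vector fixed by the unipotent group. It
    is of the form [P(S) v1], hence an Iwahori eigenvector, so that its
    image under [Pi] is fixed too and of the same form: a relation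
    excluded by [relation_free]. *)
Lemma halves_disjoint x y : half sigma1 x -> half sigma1 y -> x = PI <.> y -> x = 0.
Proof.
move=> hx hy exy; apply/eqP/negPn/negP => x0.
have W0 : half sigma1 0 /\ exists2 y, half sigma1 y & 0 = PI <.> y.
  by split; [exact: subspace0|exists 0; [exact: subspace0|rewrite linear0]].
have WP (e : C) z z' : half sigma1 z /\ (exists2 y, half sigma1 y & z = PI <.> y) ->
    half sigma1 z' /\ (exists2 y, half sigma1 y & z' = PI <.> y) ->
    half sigma1 (e *: z + z') /\ exists2 y, half sigma1 y & e *: z + z' = PI <.> y.
  move=> [hz [t ht et]] [hz' [t' ht' et']]; split; first exact: subspaceP.
  by exists (e *: t + t'); [exact: subspaceP|rewrite linearP et et'].
have [||z [[hz [t ht et]] z0 fz]] := @upper_fixed_vector (Subspace W0 WP) x _ _ x0.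
- move=> b z hb [hz [t ht et]]; split; first exact: half_upper.
  rewrite et act_upper_Pi; exists (lower ((w : F) * b) <.> t) => //.
  by apply: half_iwahori sigma1_stable _ _ _ ht; apply/iwahori_lower/vge_wM.
- by split=> //; exists y.
have [P eP] := half_fixed hz fz.
have et' : t = (omega w)^-1 *: PI <.> z.
  by rewrite et (Pi_Pi w omegaP) scalerA mulVf ?scale1r //; exact: omega_neq0.
have ez : iwahori_eigen chi z.
  by rewrite eP; exact: (iwahori_eigen_poly w omega_neq0 omegaM omegaP P ev1).
have [|Q eQ] := half_fixed ht.
  move=> c hc; rewrite et' linearZ /=.
  by have [fU _ _] := iwahori_eigen_Pi w omegaP ez; rewrite fU.
have [|/eqP h _] := @relation_free (P * 'X) (- (Q * 'X)).
  by rewrite linearN linearN /= -!vS_poly -eP -eQ -et subrr.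
move: h; rewrite mulf_eq0 polyX_eq0 orbF => /eqP P0.
by move/eqP: z0; rewrite eP P0 linear0.
Qed.

(** As the two half-tree spaces form a direct sum, the components of the fixed
    vector [v] are fixed by the unipotent matrices of their respective side, and
    are therefore polynomials in [S] applied to [v1 = S v]. *)
Lemma free_contradiction : False.
Proof.
have vs x : orbit_span sigma1 x.
  have [_ irr] := V_irr; have [h|//] := irr _ (@orbit_span_stable _ _ _ _ sigma1).
  by have /eqP := v1_neq0; case; apply/h/orbit_span_base/sigma1_v1.
have [a [b [ha hb e]]] := orbit_span_half w sigma1_stable (vs v).
have [vU vL _] := ev.
have lowU c : int c -> half sigma1 (lower ((w : F) * c) <.> a) /\
    half sigma1 (lower ((w : F) * c) <.> b).
  by move=> hc; split; apply: half_iwahori sigma1_stable _ _ _ _ => //;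
    apply/iwahori_lower/vge_wM.
have fa c : int c -> upper c <.> a = a.
  move=> hc; apply/eqP; rewrite -subr_eq0; apply/eqP.
  apply: (@halves_disjoint _ (b - lower ((w : F) * c) <.> b)).
  - by apply: subspace_sub => //; apply: half_upper.
  - by apply: subspace_sub => //; apply: (lowU c hc).2.
  have := vU c hc; rewrite e linearD /= act_upper_Pi linearB /= => h.
  by apply/eqP; rewrite subr_eq addrAC [PI <.> b + a]addrC -h addrK.
have fb c : int c -> upper c <.> b = b.
  move=> hc; apply/eqP; rewrite -subr_eq0; apply/eqP.
  have : a - lower ((w : F) * c) <.> a = 0.
    apply: (@halves_disjoint _ (upper c <.> b - b)).
    - by apply: subspace_sub => //; apply: (lowU c hc).1.
    - by apply: subspace_sub => //; apply: half_upper.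
    have := vL _ (vge_wM w hc); rewrite e linearD /= act_lower // linearB /= => h.
    by apply/eqP; rewrite subr_eq addrAC [_ + lower _ <.> a]addrC h addrK.
  move=> /eqP; rewrite subr_eq0 => /eqP ea.
  have := vL _ (vge_wM w hc); rewrite e linearD /= -ea act_lower //.
  by move=> /addrI/PI_inj->; rewrite subrr.
have [P eP] := half_fixed ha fa; have [Q eQ] := half_fixed hb fb.
have [|/(congr1 (fun R : {poly C} => R`_0)) h _] := @relation_free (P * 'X - 1%:P) (Q * 'X).
  by rewrite linearB /= poly_actC scale1r -!vS_poly -eP -eQ addrAC -e subrr.
by move: h; rewrite coefB coefMX coefC coef0 sub0r => /eqP; rewrite oppr_eq0 oner_eq0.
Qed.

End Free.

(** Otherwise [S v] would generate a proper subrepresentation. *)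
Theorem step_torsion : exists2 P : {poly C}, P != 0 & poly_act S v P = 0.
Proof.
have [//|h] := pselect (exists2 P : {poly C}, P != 0 & poly_act S v P = 0).
case: free_contradiction => P hP; apply/eqP/negPn/negP => P0.
by apply: h; exists P.
Qed.

End Torsion.

(** * Eigenvectors in a weight *)

Section PrincipalCongruence.
Context {p : nat} {F : local_field p} (w : uniformizer F).
Local Notation M2 := 'M[F]_2.
Implicit Types (A B g h k : M2) (n : nat).

Definition congruent n g h : Prop := forall i j, vge (g i j - h i j) n%:Z.

Definition integral A : Prop := forall i j, int (A i j).

Lemma mulmx2E A B i j : (A *m B) i j = A i 0 * B 0 j + A i 1 * B 1 j.
Proof.
rewrite mxE big_ord_recl big_ord1; congr (_ + A _ _ * B _ _); exact: val_inj.
Qed.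

Lemma integral_maxK k : maxK F k -> integral k. Proof. by case. Qed.

Lemma congruent_mull n A g h : integral A -> congruent n g h ->
  congruent n (A *m g) (A *m h).
Proof.
move=> hA gh i j; rewrite !mulmx2E.
have -> : A i 0 * g 0 j + A i 1 * g 1 j - (A i 0 * h 0 j + A i 1 * h 1 j) =
  A i 0 * (g 0 j - h 0 j) + A i 1 * (g 1 j - h 1 j) by ring.
by apply: vgeD; apply: vgeMl.
Qed.

Lemma congruent_mulr n A g h : integral A -> congruent n g h ->
  congruent n (g *m A) (h *m A).
Proof.
move=> hA gh i j; rewrite !mulmx2E.
have -> : g i 0 * A 0 j + g i 1 * A 1 j - (h i 0 * A 0 j + h i 1 * A 1 j) =
  (g i 0 - h i 0) * A 0 j + (g i 1 - h i 1) * A 1 j by ring.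
by apply: vgeD; apply: vgeMr.
Qed.

Lemma congruent_mat2 n (a b c d a' b' c' d' : F) :
  vge (a - a') n%:Z -> vge (b - b') n%:Z -> vge (c - c') n%:Z -> vge (d - d') n%:Z ->
  congruent n (mat2 a b c d) (mat2 a' b' c' d').
Proof. by move=> ? ? ? ?; do 2 apply: ord2P; rewrite !mat2s. Qed.

(** For [n > 0] this induces an isomorphism from the additive group of integral
    matrices modulo [w] to the quotient of two successive principal
    congruence subgroups. *)
Definition near1 n A : M2 := 1%:M + (w : F) ^+ n *: A.

Lemma near1E n A : near1 n A =
  mat2 (1 + (w : F) ^+ n * A 0 0) ((w : F) ^+ n * A 0 1)
       ((w : F) ^+ n * A 1 0) (1 + (w : F) ^+ n * A 1 1).
Proof.
rewrite /near1 mat2_scalar; apply/matrixP; do 2 apply: ord2P.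
all: by rewrite [LHS]mxE [X in _ + X]mxE !mat2s ?add0r.
Qed.

Lemma near1_maxK n A : (0 < n)%N -> integral A -> maxK F (near1 n A).
Proof.
move=> n0 hA; rewrite near1E.
have h1 i j : vge ((w : F) ^+ n * A i j) 1.
  by apply: vgeMr => //; apply: vge_trans (vge_wexp w n); rewrite lez_nat.
apply/maxK_mat2; split.
  by split; [apply/(vgeD (int1 F))/intW|exact/intW|exact/intW|apply/(vgeD (int1 F))/intW].
apply: int_unitD; last by apply/vgeN/vgeMl => //; exact/intW.
by apply: int_unitM; apply: int_unitD (h1 _ _); exact: int_unit1.
Qed.

Lemma near1_mul n A B : (0 < n)%N -> integral A -> integral B ->
  congruent n.+1 (near1 n A *m near1 n B) (near1 n (A + B)).
Proof.
move=> n0 hA hB; have -> : near1 n A *m near1 n B =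
    near1 n (A + B) + (w : F) ^+ n *: ((w : F) ^+ n *: (A *m B)).
  rewrite /near1 mulmxDl !mulmxDr !mul1mx mulmx1 scalerDr.
  by rewrite -scalemxAl -scalemxAr !addrA [1%:M + _ + _]addrAC.
move=> i j; rewrite [(near1 n (A + B) + _) i j]mxE [near1 _ _ _ _ + _]addrC addrK.
rewrite 2!mxE intS addrC.
apply: vgeM; first exact: vge_wexp.
apply: vgeMr; first by apply: vge_trans (vge_wexp w n); rewrite lez_nat.
by rewrite mulmx2E; apply: vgeD; apply: intM.
Qed.

Lemma near1_congr n A B : congruent 1 A B -> congruent n.+1 (near1 n A) (near1 n B).
Proof.
move=> AB i j; have -> : near1 n A i j - near1 n B i j = (w : F) ^+ n * (A i j - B i j).
  by rewrite /near1 !mxE; ring.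
by rewrite intS addrC; apply: vgeM (vge_wexp w n) (AB i j).
Qed.

Lemma near1_exists n k : congruent n k 1%:M -> exists2 A, integral A & k = near1 n A.
Proof.
move=> hk; have w0 := wexp_neq0 w n.
exists (((w : F) ^+ n)^-1 *: (k - 1%:M)).
  by move=> i j; rewrite mxE mulrC; apply: vge_divw; have := hk i j; rewrite !mxE.
by rewrite /near1 scalerA mulfV // scale1r addrC subrK.
Qed.

End PrincipalCongruence.

Section SmallVector.
Context {p : nat} {F : local_field p} (w : uniformizer F) {C : closedFieldType}.
Hypotheses (p_prime : prime p) (charC : p \in GRing.pchar C).
Variables (pi : smooth_irrep F C) (sigma : KZ_irrep pi).
Local Notation M2 := 'M[F]_2.
Implicit Types (k g : M2) (n : nat) (x : pi).

Let KZ_sigma : stable (KZ F) sigma := @kz_stable _ _ _ _ sigma.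

Definition fixes n x : Prop :=
  forall k, maxK F k -> congruent n k 1%:M -> k <.> x = x.

Lemma fixes0 n : fixes n 0. Proof. by move=> k _ _; rewrite linear0. Qed.

Lemma fixesP n (e : C) x y : fixes n x -> fixes n y -> fixes n (e *: x + y).
Proof. by move=> hx hy k kK k1; rewrite linearP hx ?hy. Qed.

Lemma fixes_KZ n k x : KZ F k -> fixes n x -> fixes n (k <.> x).
Proof.
move=> [k1 [z [kK zZ ->]]] hx g gK g1; have zG := centre_GL2 zZ.
have kV := maxKV kK; have [[kG gG] kVG] := (GL2_maxK kK, GL2_maxK gK, GL2_maxK kV).
have hgx : (invmx k1 *m g *m k1) <.> x = x.
  apply: hx; first by apply: maxKM kK; apply: maxKM.
  have -> : 1%:M = invmx k1 *m 1%:M *m k1 by rewrite mulmx1 mulVmx.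
  by apply/congruent_mulr/congruent_mull => //; exact: integral_maxK.
have e : g *m (k1 *m z) = k1 *m z *m (invmx k1 *m g *m k1).
  by rewrite -[RHS]mulmxA (centreC _ zZ) !mulmxA mulmxV // mul1mx.
rewrite actM; [|exact: gG|exact: GL2M].
by rewrite e -actM ?hgx; [|exact: GL2M|do 2 apply: GL2M => //].
Qed.

(** The vectors fixed by a normal subgroup of [K] form a stable subspace. *)
Lemma sigma_fixes n : (exists x, [/\ sigma x, x != 0 & fixes n x]) ->
  forall x, sigma x -> fixes n x.
Proof.
move=> [x [sx x0 fx]]; have [_ irr] := @kz_irreducible _ _ _ _ sigma.
have W0 : sigma 0 /\ fixes n 0 by split; [exact: subspace0|exact: fixes0].
have WP (e : C) y z : sigma y /\ fixes n y -> sigma z /\ fixes n z ->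
    sigma (e *: y + z) /\ fixes n (e *: y + z).
  by move=> [sy fy] [sz fz]; split; [exact: subspaceP|exact: fixesP].
have [||h|h] := irr (Subspace W0 WP).
- by move=> y [].
- by move=> k kKZ y [sy fy]; split; [exact: KZ_sigma|exact: fixes_KZ].
- by have /eqP[] := x0; apply: h.
by move=> y /h[].
Qed.

Lemma fixes_congr n k k' x : fixes n x -> maxK F k -> maxK F k' -> congruent n k k' ->
  k <.> x = k' <.> x.
Proof.
move=> fx kK kK' kk'; have kV := maxKV kK'; have [[kG kG'] kVG] := (GL2_maxK kK, GL2_maxK kK', GL2_maxK kV).
have e : (invmx k' *m k) <.> x = x.
  apply: fx; first exact: maxKM.
  rewrite -(mulVmx kG'); apply: congruent_mull => //; exact: integral_maxK.
by rewrite -[in RHS]e actM //; [rewrite mulmxA mulmxV // mul1mx|exact: GL2M].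
Qed.

(** The quotient of two successive principal congruence subgroups is a finite
    abelian group killed by [p], so it has fixed vectors in characteristic [p]. *)
Lemma sigma_fixes_step n : (0 < n)%N -> (forall x, sigma x -> fixes n.+1 x) ->
  forall x, sigma x -> fixes n x.
Proof.
move=> n0 fS; apply: sigma_fixes.
have [[x sx x0] _] := @kz_irreducible _ _ _ _ sigma.
pose mx (t : (F * F) * (F * F)) := mat2 t.1.1 t.1.2 t.2.1 t.2.2.
pose R := [seq (a, b) | a <- residues F, b <- residues F].
pose L := [seq (a, b) | a <- R, b <- R].
have mxO t : t \in L -> integral (mx t).
  move=> /allpairsP[[u u'] /= [/allpairsP[[a b] /= [ha hb ->]] /allpairsP[[c d] /= [hc hd ->]] ->]].
  by do 2 apply: ord2P; rewrite mat2s residues_int.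
have nearK t : t \in L -> maxK F (near1 w n (mx t)) by move=> /mxO; exact: near1_maxK.
have act2 (A B : M2) y : integral A -> integral B -> sigma y ->
    near1 w n A <.> near1 w n B <.> y = near1 w n (A + B) <.> y.
  move=> hA hB sy; have [KA KB] := (near1_maxK w n0 hA, near1_maxK w n0 hB).
  rewrite actM; auto with gl2; apply: (fixes_congr (fS y sy)).
  - exact: maxKM.
  - by apply: near1_maxK => // i j; rewrite mxE; apply: vgeD.
  - exact: near1_mul.
have [| | |y [sy y0 Ly]] := @common_fixed_vector _ _ p _ L
    (fun t => rep_act pi (near1 w n (mx t))) sigma x p_prime charC sx x0.
- by move=> t tL y sy; apply: KZ_sigma => //; exact/maxK_KZ/nearK.
- move=> t t' tL tL' y sy; have [hA hB] := (mxO t tL, mxO t' tL').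
  by rewrite !act2 // addrC.
- move=> t tL y sy; have hA := mxO t tL.
  have it m : integral (mx t *+ m) /\ iter m (rep_act pi (near1 w n (mx t))) y
      = near1 w n (mx t *+ m) <.> y.
    elim: m => [|m [hm IH]].
      split; first by move=> i j; rewrite mulr0n mxE vge0.
      by rewrite mulr0n /near1 scaler0 addr0 rep_act1.
    split; first by move=> i j; rewrite mulrS mxE; apply: vgeD.
    by rewrite iterS IH act2 // mulrS.
  have [hp ->] := it p; rewrite -[RHS](@rep_act1 _ _ _ _ pi y).
  apply: (fixes_congr (fS y sy)); [exact: near1_maxK|exact: maxK1|].
  have -> : 1%:M = near1 w n 0 by rewrite /near1 scaler0 addr0.
  apply: near1_congr => i j; rewrite [X in vge (_ - X) _]mxE subr0 -scaler_nat mxE.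
  by apply: vgeMr => //; exact: lf_residue_char.
exists y; split=> // k kK /(near1_exists w)[A hA eA].
rewrite eA; pose t := ((residue (A 0 0), residue (A 0 1)), (residue (A 1 0), residue (A 1 1))).
have tL : t \in L.
  by apply/allpairsP; exists t; split=> //; apply/allpairsP;
    [exists t.1|exists t.2]; split=> //; apply: (residueP (hA _ _)).1.
rewrite -[RHS](Ly t tL); apply: (fixes_congr (fS y sy)).
- exact: near1_maxK.
- exact: nearK.
apply: near1_congr; rewrite [A]mat2E.
by apply: congruent_mat2; apply: (residueP (hA _ _)).2.
Qed.

Lemma sigma_fixes1 x : sigma x -> fixes 1 x.
Proof.
have [[x0 sx0 x0n] _] := @kz_irreducible _ _ _ _ sigma.
have [N NP] := smooth_congr (@si_smooth _ _ _ pi) x0.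
have : forall x, sigma x -> fixes N.+1 x.
  apply: sigma_fixes; exists x0; split=> // k kK k1; apply: NP; first exact: GL2_maxK.
  by move=> i j; apply: vge_trans (k1 i j); rewrite lez_nat.
elim: N {NP} => [|N IH] fx; first exact: fx.
by apply: IH; apply: sigma_fixes_step.
Qed.

(** The group [K] acts on [sigma] through its quotient over the residue field, in
    which the upper unipotent matrices form a [p]-group, normalized by the
    commutative group of diagonal matrices. *)
Lemma torus_eigenvector : exists (chi : F -> C) x,
  [/\ sigma x, x != 0 & iwahori_eigen chi x].
Proof.
have [[x0 sx0 x0n] _] := @kz_irreducible _ _ _ _ sigma.
have sU b (y : pi) : int (b : F) -> sigma y -> sigma (upper b <.> y).
  by move=> hb; apply/KZ_sigma/maxK_KZ/iwahori_maxK/iwahori_upper.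
have [x1 [sx1 x1n fx1]] := upper_fixed_vector w p_prime charC (@si_smooth _ _ _ pi) sU sx0 x0n.
have W0 : sigma 0 /\ forall b, int (b : F) -> upper b <.> (0 : pi) = 0.
  by split; [exact: subspace0|move=> b _; rewrite linear0].
have WP (e : C) y z : sigma y /\ (forall b, int (b : F) -> upper b <.> y = y) ->
    sigma z /\ (forall b, int (b : F) -> upper b <.> z = z) ->
    sigma (e *: y + z) /\ forall b, int (b : F) -> upper b <.> (e *: y + z) = e *: y + z.
  move=> [sy fy] [sz fz]; split=> [|b hb]; first exact: subspaceP.
  by rewrite linearP fy ?fz.
pose W := Subspace W0 WP.
pose L := [seq a <- residues F | int_unit a].
have LP a : a \in L -> int_unit a by rewrite mem_filter => /andP[].
have dK a : int_unit a -> maxK F (dilate a) by move=> /iwahori_dilate/iwahori_maxK.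
have dM a b (y : pi) : int_unit a -> int_unit b -> dilate a <.> dilate b <.> y = dilate (a * b) <.> y.
  move=> ha hb; rewrite actM; [|exact/GL2_maxK/dK|exact/GL2_maxK/dK].
  by congr (_ <.> y); rewrite mat2M; congr mat2; ring.
have dW a (y : pi) : int_unit a -> W y -> W (dilate a <.> y).
  move=> ha [sy fy]; have a0 := unit_neq0 ha; split.
    by apply: KZ_sigma => //; exact/maxK_KZ/dK.
  move=> b hb; have -> : upper b <.> dilate a <.> y = dilate a <.> upper (b / a) <.> y.
    have aG := GL2_maxK (dK a ha); rewrite !actM; auto with gl2; congr (_ <.> y).
    by rewrite !mat2M; congr mat2; field.
  by rewrite fy //; exact: int_div.
have d_congr a b (y : pi) : sigma y -> int_unit a -> int_unit b -> vge (a - b) 1 ->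
    dilate a <.> y = dilate b <.> y.
  move=> sy ha hb ab; apply: (fixes_congr (sigma_fixes1 sy)); [exact: dK|exact: dK|].
  by apply: congruent_mat2; rewrite ?subrr ?vge0.
have unitX (a : F) i : int_unit a -> int_unit (a ^+ i).
  by move=> ha; elim: i => [|i IH]; rewrite ?exprS ?int_unitM // int_unit1.
have d_iter a i (y : pi) : int_unit a -> iter i (rep_act pi (dilate a)) y = dilate (a ^+ i) <.> y.
  move=> ha; elim: i => [|i IH].
    by rewrite expr0 -[dilate 1]/(upper 0) upper0 rep_act1.
  by rewrite iterS IH dM ?exprS //; apply: unitX.
have pigeon (a : F) : int_unit a -> exists i j : nat, (i < j)%N /\ vge (a ^+ i - a ^+ j) 1.
  move=> ha; pose r i := residue (a ^+ i).
  have rP i := residueP (int_unit_ge (unitX a i ha)).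
  have /(uniqPn 0)[i [j [lt_ij]]] : ~~ uniq [seq r i | i <- iota 0 (size (residues F)).+1].
    apply/negP => u; have := uniq_leq_size u (s2 := residues F).
    rewrite size_map size_iota ltnn => h; have : false by apply: h => _ /mapP[i _ ->]; have [] := rP i.
    by [].
  rewrite size_map size_iota => ltj; rewrite !(nth_map 0%N) ?size_iota //; last exact: ltn_trans ltj.
  rewrite !nth_iota ?add0n //; last exact: ltn_trans ltj.
  move=> e; exists i, j; split=> //; apply: vge_diff (rP i).2 _.
  by rewrite -/(r i) e; apply/vgeC; exact: (rP j).2.
have /choice[P PP] : forall a : F, exists Q : {poly C}, int_unit a -> Q != 0 /\
    forall y, W y -> poly_act (rep_act pi (dilate a)) y Q = 0.
  move=> a.
  have [ha|na] := boolP (int_unit a); last by exists 0.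
  have [i [j [lt_ij aij]]] := pigeon a ha; exists ('X^j - 'X^i) => _; split.
    rewrite -lead_coef_eq0 lead_coefDl ?lead_coefXn ?oner_neq0 //.
    by rewrite size_polyN !size_polyXn.
  move=> y [sy _]; rewrite linearB /= !poly_actXn !d_iter //.
  by rewrite (d_congr (a ^+ j) (a ^+ i)) ?subrr //; [exact: unitX|exact: unitX|exact: vgeC].
have [| | | |x [[sx fx] xn Lx]] := @common_eigenvector _ _ _ L
    (fun a => rep_act pi (dilate a)) P W x1 (conj sx1 fx1) x1n.
- by move=> a /LP ha y; exact: dW.
- by move=> a b /LP ha /LP hb y _; rewrite !dM // mulrC.
- by move=> a /LP/PP[].
- by move=> a /LP/PP[].
have /choice[chi chiP] : forall a : F, exists c : C, int_unit a -> dilate a <.> x = c *: x.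
  move=> a.
  have [ha|na] := boolP (int_unit a); last by exists 0.
  have [rs ra] := residueP (int_unit_ge ha).
  have ur : int_unit (residue a).
    by rewrite -[residue a](subrKC a); apply: int_unitD (vgeC ra).
  have [|c _ ec] := Lx (residue a); first by rewrite mem_filter ur.
  by exists c => _; rewrite -ec; apply: d_congr.
exists chi, x; split=> //; split=> // c hc.
apply: (sigma_fixes1 sx); first exact/iwahori_maxK/iwahori_lower.
rewrite mat2_scalar; apply: congruent_mat2; rewrite ?subrr ?vge0 // subr0.
exact: hc.
Qed.

(** By the quadratic relation, [bruhat_sum x] is an eigenvector of [bruhat_sum] if
    it is nonzero; if it is zero, [x] itself is one. *)
Lemma good_vector : exists (chi : F -> C) x (e : C),
  [/\ sigma x, x != 0, iwahori_eigen chi x & bruhat_sum x = e *: x].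
Proof.
have [omega [omega_neq0 omegaM omegaP]] := @si_central _ _ _ pi.
have [chi [x [sx x0 ex]]] := torus_eigenvector.
have [Tx|Tx] := eqVneq (bruhat_sum x) 0.
  by exists chi, x, 0; rewrite scale0r.
exists (twist omega chi), (bruhat_sum x), (hecke_scalar omega chi); split=> //.
- apply: subspace_sum => a /residues_int ha.
  by apply: KZ_sigma => //; apply/maxK_KZ/maxK_bruhat.
- exact: (iwahori_eigen_bruhat omegaP ex).
- exact: (bruhat_sum_sqr p_prime charC omegaP ex).
Qed.

End SmallVector.

(** * The canonical diagram and its independence of the weight *)

Section SpecialPair.
Context {p : nat} {F : local_field p} (w : uniformizer F).

(** As the square of [Pi] is central, conjugation by [Pi] and by its inverse
    coincide. *)
Lemma Pi_normI : normI F (Pi w).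
Proof.
split=> [|h]; first exact: Pi_GL2.
have wZ : centre F (w : F)%:M by exists (w : F); rewrite ?unif_neq0.
have PG := Pi_GL2 w; have PK : Pi w *m invmx (Pi w) = 1%:M by rewrite mulmxV.
have PVK : invmx (Pi w) *m Pi w = 1%:M by rewrite mulVmx.
have eP : Pi w = (w : F)%:M *m invmx (Pi w).
  by rewrite -Pi_sqr -mulmxA PK mulmx1.
have eV : invmx (Pi w) *m (w : F)%:M = Pi w by rewrite -Pi_sqr mulmxA PVK mul1mx.
split=> hI.
  by have := Pi_conj w hI; rewrite !mulmxA PVK mul1mx -mulmxA PVK mulmx1.
have -> : Pi w *m h *m invmx (Pi w) = invmx (Pi w) *m h *m Pi w.
  transitivity ((w : F)%:M *m (invmx (Pi w) *m h *m invmx (Pi w))).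
    by rewrite !mulmxA -eP.
  by rewrite (centreC _ wZ) -!mulmxA eV.
exact: Pi_conj.
Qed.

Lemma iwahori_normI g : iwahori F g -> normI F g.
Proof.
by move=> gI; apply: IZ_normI; exists g, 1%:M; split; rewrite ?mulmx1 //; exact: centre1.
Qed.

End SpecialPair.

Section Diagram.
Context {p : nat} {F : local_field p} (w : uniformizer F) {C : closedFieldType}.
Variables (pi : smooth_irrep F C) (sigma : KZ_irrep pi).
Implicit Types (x y : pi).

Let KZ_sigma : stable (KZ F) sigma := @kz_stable _ _ _ _ sigma.

Lemma D1_act g x : normI F g -> D1_space w sigma x -> D1_space w sigma (g <.> x).
Proof. by move=> gN; apply: D1_stable. Qed.

Lemma D1_iwahori g x : iwahori F g -> D1_space w sigma x -> D1_space w sigma (g <.> x).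
Proof. by move/iwahori_normI; apply: D1_act. Qed.

Lemma D1_intro x : half sigma x -> half sigma (Pi w <.> x) -> D1_space w sigma x.
Proof.
move=> hx hPx; split=> //; have [omega [o0 _ oP]] := @si_central _ _ _ pi.
have ow := o0 _ (unif_neq0 w).
exists ((omega w)^-1 *: Pi w <.> x); first exact: (subspaceZ (W := half sigma)).
by rewrite linearZ /= (Pi_Pi w oP) scalerA mulVf // scale1r.
Qed.

Lemma D1_Pi x : D1_space w sigma (Pi w <.> x) -> D1_space w sigma x.
Proof.
move=> /(D1_act (Pi_normI w)); have [omega [o0 _ oP]] := @si_central _ _ _ pi.
rewrite (Pi_Pi w oP) => /(subspaceZ (omega w)^-1).
by rewrite scalerA mulVf ?scale1r //; apply/o0/unif_neq0.
Qed.

(** The elements of [K] outside the Iwahori subgroup move the half-tree behind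
    the edge into the half-tree in front of it. *)
Lemma half_not_iwahori k x : maxK F k -> ~ iwahori F k -> half sigma x ->
  half sigma (k <.> Pi w <.> x).
Proof.
move=> kK nI hx; have [//|[b [i [hb iI ->]]]] := maxK_cases kK.
have iG := GL2_iwahori iI; have PG := Pi_GL2 w.
have jI := Pi_conj w iI; have jG := GL2_iwahori jI.
have -> : (bruhat b *m i) <.> Pi w <.> x =
    bruhat b <.> Pi w <.> (invmx (Pi w) *m i *m Pi w) <.> x.
  rewrite !actM; auto with gl2; congr (_ <.> x).
  by rewrite !mulmxA -[bruhat b *m Pi w *m _]mulmxA mulmxV // mulmx1.
by apply: half_bruhat => //; apply: (half_iwahori KZ_sigma).
Qed.

Lemma D1_maxK k x : maxK F k -> D1_space w sigma x -> half sigma (k <.> x).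
Proof.
move=> kK [hx [y hy ex]].
have [kI|nI] := pselect (iwahori F k); first exact: (half_iwahori KZ_sigma kI).
by rewrite ex; apply: half_not_iwahori.
Qed.

Lemma D0_half x : D0_space w sigma x -> half sigma x.
Proof.
apply: span_subset => _ [k [y [kK hy ->]]]; exact: D1_maxK.
Qed.

(** The cosets of the Iwahori group in [K] are represented by the identity and
    by the matrices [bruhat a]. *)
Lemma D0_decomp x : D0_space w sigma x -> exists d (m : F -> pi),
  [/\ D1_space w sigma d, forall a, D1_space w sigma (m a)
    & x = d + \sum_(a <- residues F) bruhat a <.> m a].
Proof.
pose Q (x : pi) := exists d (m : F -> pi),
  [/\ D1_space w sigma d, forall a, D1_space w sigma (m a)
    & x = d + \sum_(a <- residues F) bruhat a <.> m a].
have Q0 : Q 0.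
  exists 0, (fun=> 0); split=> [|_|]; [exact: subspace0|exact: subspace0|].
  by rewrite add0r big1 // => a _; rewrite linear0.
have QP (e : C) y z : Q y -> Q z -> Q (e *: y + z).
  move=> [d [m [hd hm ->]]] [d' [m' [hd' hm' ->]]].
  exists (e *: d + d'), (fun a => e *: m a + m' a).
  split=> [|a|]; [exact: subspaceP|exact: subspaceP|].
  rewrite scalerDr addrACA scaler_sumr -big_split /=; congr (_ + _).
  by apply: eq_bigr => a _; rewrite linearP.
apply: (span_subset (W := Subspace Q0 QP)) => _ [k [y [kK hy ->]]].
have [kI|[b [i [hb iI ->]]]] := maxK_cases kK.
  exists (k <.> y), (fun=> 0); split=> [|_|]; [exact: D1_iwahori|exact: subspace0|].
  by rewrite big1 ?addr0 // => a _; rewrite linear0.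
have [rs rb] := residueP hb; have iG := GL2_iwahori iI.
pose z := lower (b - residue b) <.> i <.> y.
have hz : D1_space w sigma z by apply/D1_iwahori/D1_iwahori => //; exact: iwahori_lower.
exists 0, (fun a => if a == residue b then z else 0); split.
- exact: subspace0.
- by move=> a; case: ifP => _ //; exact: subspace0.
rewrite add0r (bigD1_seq (residue b)) ?residues_uniq //= eqxx big1 ?addr0.
  rewrite /z !actM; auto with gl2; congr (_ <.> y).
  by rewrite ?mulmxA bruhat_lower addrC subrK.
by move=> a /negPf->; rewrite linear0.
Qed.

End Diagram.

Section Independence.
Context {p : nat} {F : local_field p} (w : uniformizer F) {C : closedFieldType}.
Hypotheses (p_prime : prime p) (charC : p \in GRing.pchar C).
Variable pi : smooth_irrep F C.
Implicit Types (x y : pi).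

Lemma orbit_span_full (S : subspace pi) x : (exists2 y, S y & y != 0) -> orbit_span S x.
Proof.
move=> [y Sy y0]; have [_ irr] := @si_irreducible _ _ _ pi.
have [h|//] := irr _ (@orbit_span_stable _ _ _ _ S).
by case/eqP: y0; apply/h/orbit_span_base.
Qed.

(** By irreducibility [v] is torsion, and torsion vectors lie in both half-tree
    spaces; the weight that contains [v] need not be the one that
    defines these spaces. *)
Lemma D1_vector (sigma sigma' : KZ_irrep pi) : exists v,
  [/\ sigma' v, v != 0 & D1_space w sigma v].
Proof.
have [chi [v [e [sv v0 ev Tv]]]] := good_vector w p_prime charC sigma'.
have [omega [o0 oM oP]] := @si_central _ _ _ pi.
have [P P0 Pv] := step_torsion w p_prime charC o0 oM oP (@si_smooth _ _ _ pi)
  (@si_irreducible _ _ _ pi) ev Tv.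
have gen x : orbit_span sigma x.
  by apply: orbit_span_full; have [] := @kz_irreducible _ _ _ _ sigma.
have [h1 h2] := torsion_in_both_halves p_prime charC o0 oM oP
  (@kz_stable _ _ _ _ sigma) gen ev Tv P0 Pv.
by exists v; split=> //; apply: D1_intro.
Qed.

(** A nonzero vector [v] of [sigma'] lies in the space [D1] of [sigma], whose
    translates by [K] stay in the half-tree space of [sigma]; and these translates
    of [v] span [sigma']. *)
Lemma Iplus_independent (sigma sigma' : KZ_irrep pi) x :
  Iplus sigma' x -> Iplus sigma x.
Proof.
have [v [sv v0 Dv]] := D1_vector sigma sigma'.
suff s'_half y : sigma' y -> half sigma y.
  by apply: span_subset => _ [g [y [gP sy ->]]]; apply/half_Ppos/s'_half.
pose Q z := sigma' z /\ forall k, KZ F k -> half sigma (k <.> z).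
have Q0 : Q 0 by split=> [|k _]; rewrite ?linear0; exact: subspace0.
have QP (e : C) t z : Q t -> Q z -> Q (e *: t + z).
  move=> [sy hy] [sz hz]; split=> [|k kKZ]; first exact: subspaceP.
  by rewrite linearP; apply: (subspaceP (s := half sigma)); [exact: hy|exact: hz].
have [KZG KZ1 KZM _] := KZ_subgroup F.
have [_ irr] := @kz_irreducible _ _ _ _ sigma'.
have [||h|h] := irr (Subspace Q0 QP).
- by move=> z [].
- move=> k kKZ z [sz hz]; split; first exact: (@kz_stable _ _ _ _ sigma').
  by move=> k' k'KZ; rewrite actM; [apply/hz/KZM|exact: KZG|exact: KZG].
- case/eqP: v0; apply: h; split=> // _ [k [z [kK zZ ->]]].
  have [kG zG] := (GL2_maxK kK, centre_GL2 zZ).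
  rewrite -actM //; apply: (D1_maxK kK); apply: D1_act Dv.
  by apply: IZ_normI; exists 1%:M, z; split; rewrite ?mul1mx //; exact: iwahori1.
by move=> /h[_ /(_ _ KZ1)]; rewrite rep_act1.
Qed.

End Independence.

(** * From representations to diagrams *)

Section IsoToDiagram.
Context {p : nat} {F : local_field p} (w : uniformizer F) {C : closedFieldType}.
Hypotheses (p_prime : prime p) (charC : p \in GRing.pchar C).

Section ImageWeight.
Variables (pi pi' : smooth_irrep F C) (sigma : KZ_irrep pi).
Variables (f : {linear pi -> pi'}) (f' : {linear pi' -> pi}).
Hypotheses (fG : equivariant (GL2 F) f) (f'G : equivariant (GL2 F) f').
Hypotheses (fK : cancel f f') (f'K : cancel f' f).

Lemma image_weight0 : sigma (f' 0). Proof. by rewrite linear0; exact: subspace0. Qed.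

Lemma image_weightP (e : C) y z : sigma (f' y) -> sigma (f' z) -> sigma (f' (e *: y + z)).
Proof. by move=> hy hz; rewrite linearP; apply: subspaceP. Qed.

(** The image of [sigma], written as a preimage under the inverse isomorphism. *)
Definition image_weight_space : subspace pi' := Subspace image_weight0 image_weightP.

Lemma image_weight_stable : stable (KZ F) image_weight_space.
Proof.
move=> k kKZ y hy; rewrite /= f'G; last exact: GL2_KZ.
exact: (@kz_stable _ _ _ _ sigma).
Qed.

Lemma image_weight_irreducible : irreducible_in (KZ F) image_weight_space.
Proof.
have [[x sx x0] irr] := @kz_irreducible _ _ _ _ sigma; split.
  exists (f x); first by rewrite /= fK.
  by apply: contraNneq x0 => e; rewrite -[x]fK e linear0.
move=> W Ws sW.
have W0 : W (f 0) by rewrite linear0; exact: subspace0.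
have WP (e : C) y z : W (f y) -> W (f z) -> W (f (e *: y + z)).
  by move=> hy hz; rewrite linearP; apply: subspaceP.
have [||h|h] := irr (Subspace W0 WP).
- by move=> y /Ws /=; rewrite fK.
- move=> k kKZ y Wy /=; rewrite fG; [exact: sW|exact: GL2_KZ].
- by left=> y Wy; rewrite -[y]f'K (h (f' y)) ?linear0 //= f'K.
by right=> y /h /=; rewrite f'K.
Qed.

Definition image_weight : KZ_irrep pi' :=
  KZIrrep image_weight_stable image_weight_irreducible.

Lemma Iplus_image (sigma' : KZ_irrep pi') x : Iplus sigma x -> Iplus sigma' (f x).
Proof.
move=> hx; apply: (Iplus_independent w p_prime charC sigma' (sigma' := image_weight)).
move: x hx; apply: span_image => _ [g [x [gP sx ->]]].
rewrite fG; last exact: GL2_Ppos.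
by apply: mem_span; exists g, (f x); split=> //=; rewrite fK.
Qed.

Lemma D1_image (sigma' : KZ_irrep pi') x : D1_space w sigma x -> D1_space w sigma' (f x).
Proof.
move=> [hx [y hy ey]]; split; first exact: Iplus_image.
by exists (f y); [exact: Iplus_image|rewrite ey fG //; exact: Pi_GL2].
Qed.

Lemma D0_image (sigma' : KZ_irrep pi') x : D0_space w sigma x -> D0_space w sigma' (f x).
Proof.
move: x; apply: span_image => _ [k [x [kK hx ->]]]; apply: mem_span.
by exists k, (f x); split; [|exact: D1_image|rewrite fG //; exact: GL2_maxK].
Qed.

End ImageWeight.

Section Restriction.
Variables (V V' : lmodType C) (f : {linear V -> V'}) (W : subspace V) (W' : subspace V').
Hypothesis fW : forall x, W x -> W' (f x).

Definition restriction (x : subspace_type W) : subspace_type W' :=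
  to_subspace (fW (subspace_typeP x)).

Lemma restriction_linear : linear restriction.
Proof. by move=> e x y; apply: val_inj; exact: linearP. Qed.

HB.instance Definition _ :=
  GRing.isLinear.Build C (subspace_type W) (subspace_type W') _ restriction restriction_linear.

End Restriction.

Section Morphism.
Variables (pi pi' : smooth_irrep F C) (sigma : KZ_irrep pi) (sigma' : KZ_irrep pi').
Variables (f : {linear pi -> pi'}) (f' : {linear pi' -> pi}).
Hypotheses (fG : equivariant (GL2 F) f) (f'G : equivariant (GL2 F) f').
Hypotheses (fK : cancel f f') (f'K : cancel f' f).

Lemma diagram_mor_of_iso :
  exists g : diagram_mor (canonical_diagram w sigma) (canonical_diagram w sigma'),
    (forall x, val (mor0 g x) = f (val x)) /\ (forall x, val (mor1 g x) = f (val x)).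
Proof.
pose g0 : {linear _ -> _} := restriction (D0_image (sigma := sigma) fG f'G fK f'K sigma').
pose g1 : {linear _ -> _} := restriction (D1_image (sigma := sigma) fG f'G fK f'K sigma').
have h0 : @equivariant _ _ _ (KZ F) _ _ (D0 w sigma) (D0 w sigma') g0.
  move=> k kKZ x; apply: val_inj => /=.
  rewrite (subrep_funE (@D0_stable _ _ _ w _ sigma')) // (subrep_funE (@D0_stable _ _ _ w _ sigma)) //.
  by rewrite fG //; exact: GL2_KZ.
have h1 : @equivariant _ _ _ (normI F) _ _ (D1 w sigma) (D1 w sigma') g1.
  move=> k kN x; apply: val_inj => /=.
  rewrite (subrep_funE (@D1_stable _ _ _ w _ sigma')) // (subrep_funE (@D1_stable _ _ _ w _ sigma)) //.
  by rewrite fG //; exact: normI_GL2.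
have hr x : g0 (can x) = can (g1 x) by exact: val_inj.
by exists (@DiagramMor _ _ _ (canonical_diagram w sigma) (canonical_diagram w sigma') g0 g1 h0 h1 hr).
Qed.

End Morphism.

Lemma rep_iso_diagram_iso (pi pi' : smooth_irrep F C)
    (sigma : KZ_irrep pi) (sigma' : KZ_irrep pi') :
  rep_iso pi pi' ->
  diagram_iso (canonical_diagram w sigma) (canonical_diagram w sigma').
Proof.
move=> [f [f' [fG f'G fK f'K]]].
have [g [g0 g1]] := diagram_mor_of_iso sigma sigma' fG f'G fK f'K.
have [g' [g0' g1']] := diagram_mor_of_iso sigma' sigma f'G fG f'K fK.
by exists g, g'; split=> x; apply: val_inj; rewrite ?g0' ?g0 ?g1' ?g1 ?g0' ?g1' ?fK ?f'K.
Qed.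

End IsoToDiagram.

(** * From diagrams to representations *)

Section Schur.
Context {p : nat} {F : local_field p} {C : closedFieldType}.
Variables (V V' : rep C (GL2 F)).

(** Schur's lemma: the kernel and the image of [f] are subrepresentations. *)
Lemma irreducible_rep_iso (f : {linear V -> V'}) : irreducible V -> irreducible V' ->
  equivariant (GL2 F) f -> (exists x, f x != 0) -> rep_iso V V'.
Proof.
move=> [_ irr] [_ irr'] fG [x0 fx0].
have K0 : f 0 = 0 := linear0 f.
have KP (e : C) x y : f x = 0 -> f y = 0 -> f (e *: x + y) = 0.
  by move=> fx fy; rewrite linearP fx fy scaler0 addr0.
have [|f_inj|f0] := irr (Subspace K0 KP); last by case/eqP: fx0; exact: f0.
  by move=> g gG x /= fx; rewrite fG // fx linear0.
have I0 : exists x, 0 = f x by exists 0; rewrite linear0.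
have IP (e : C) y z : (exists x, y = f x) -> (exists x, z = f x) ->
    exists x, e *: y + z = f x.
  by move=> [x ->] [x' ->]; exists (e *: x + x'); rewrite linearP.
have [|I_eq0|f_surj] := irr' (Subspace I0 IP).
- by move=> g gG _ [x ->]; exists (g <.> x); rewrite fG.
- by case/eqP: fx0; apply: I_eq0; exists x0.
have [f' f'K] : {f' : V' -> V | forall y, y = f (f' y)}.
  by have [f' h] := choice f_surj; exists f'.
have fI x y : f x = f y -> x = y.
  by move=> e; apply/eqP; rewrite -subr_eq0; apply/eqP/f_inj; rewrite /= linearB e subrr.
have f'_linear : linear f'.
  by move=> e x y; apply: fI; rewrite linearP -!f'K.
pose f'L := GRing.isLinear.Build C V' V _ f' f'_linear.
pose f'l : {linear V' -> V} := HB.pack f' f'L.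
exists f, f'l; split=> //.
  by move=> g gG y; apply: fI; rewrite fG //= -!f'K.
by move=> x; apply: fI; rewrite /= -f'K.
Qed.

End Schur.

Section DiagramToIso.
Context {p : nat} {F : local_field p} (w : uniformizer F) {C : closedFieldType}.
Hypotheses (p_prime : prime p) (charC : p \in GRing.pchar C).
Variables (pi pi' : smooth_irrep F C) (sigma : KZ_irrep pi) (sigma' : KZ_irrep pi').
Local Notation D := (canonical_diagram w sigma).
Local Notation D' := (canonical_diagram w sigma').
Variable f : diagram_mor D D'.
Hypothesis f1_inj : injective (mor1 f).

Let X : lmodType C := (pi * pi')%type.

Definition pair_act (g : 'M[F]_2) (u : X) : X := (g <.> u.1, g <.> u.2).

Lemma pair_act_linear g : linear (pair_act g).
Proof. by move=> e u u'; congr pair; exact: linearP. Qed.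

HB.instance Definition _ g :=
  GRing.isLinear.Build C X X _ (pair_act g) (pair_act_linear g).

Lemma pair_act1 u : pair_act 1%:M u = u.
Proof. by case: u => x y; rewrite /pair_act /= !rep_act1. Qed.

Lemma pair_actM g h : GL2 F g -> GL2 F h ->
  forall u, pair_act (g *m h) u = pair_act g (pair_act h u).
Proof. by move=> gG hG u; rewrite /pair_act !rep_actM. Qed.

(** The graph of [mor0 f] generates in this representation the graph of the
    isomorphism to be found. *)
Definition pair_rep : rep C (GL2 F) :=
  @Rep _ _ _ (GL2 F) X (fun g => pair_act g : {linear _ -> _}) pair_act1 pair_actM.

Definition graph0_set (u : pair_rep) : Prop :=
  exists x : diag0 D, u.1 = val x /\ u.2 = val (mor0 f x).
Definition graph1_set (u : pair_rep) : Prop :=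
  exists x : diag1 D, u.1 = val x /\ u.2 = val (mor1 f x).

Lemma graph0_0 : graph0_set 0. Proof. by exists 0; split; rewrite ?linear0. Qed.
Lemma graph1_0 : graph1_set 0. Proof. by exists 0; split; rewrite ?linear0. Qed.

Lemma graph0P (e : C) u u' : graph0_set u -> graph0_set u' -> graph0_set (e *: u + u').
Proof.
move=> [x [ex fx]] [x' [ex' fx']]; exists (e *: x + x').
by split; rewrite ?linearP /= ?ex ?ex' ?fx ?fx'.
Qed.

Lemma graph1P (e : C) u u' : graph1_set u -> graph1_set u' -> graph1_set (e *: u + u').
Proof.
move=> [x [ex fx]] [x' [ex' fx']]; exists (e *: x + x').
by split; rewrite ?linearP /= ?ex ?ex' ?fx ?fx'.
Qed.

Definition graph0 : subspace pair_rep := Subspace graph0_0 graph0P.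
Definition graph1 : subspace pair_rep := Subspace graph1_0 graph1P.

Lemma graph0_stable : stable (KZ F) graph0.
Proof.
move=> k kKZ u [x [ex fx]]; exists (rep_act (diag0 D) k x).
rewrite (mor0P f kKZ) /= ex fx; split.
  by rewrite (subrep_funE (@D0_stable _ _ _ w _ sigma)).
by rewrite (subrep_funE (@D0_stable _ _ _ w _ sigma')).
Qed.

Lemma graph1_stable : stable (normI F) graph1.
Proof.
move=> k kN u [x [ex fx]]; exists (rep_act (diag1 D) k x).
rewrite (mor1P f kN) /= ex fx; split.
  by rewrite (subrep_funE (@D1_stable _ _ _ w _ sigma)).
by rewrite (subrep_funE (@D1_stable _ _ _ w _ sigma')).
Qed.

Lemma graph1_graph0 u : graph1 u -> graph0 u.
Proof.
by move=> [x [ex fx]]; exists (diag_r D x); rewrite (morP f) ex fx.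
Qed.

Lemma graph0_D1 u : graph0 u -> D1_space w sigma u.1 -> graph1 u.
Proof.
move=> [x [ex fx]] h; exists (to_subspace h); split=> //.
have e : x = diag_r D (to_subspace h) by apply: val_inj; rewrite -ex.
by rewrite fx e (morP f).
Qed.

Lemma graph1_0_inj u : graph1 u -> u.1 = 0 -> u = 0.
Proof.
case: u => x y [z [/= -> ->]] z0; have -> : z = 0 by exact: val_inj.
by rewrite linear0.
Qed.

Lemma half_ball_fst n (u : pair_rep) : half_ball w graph0 n u -> half sigma u.1.
Proof.
elim: n u => [|n IH] u.
  by move=> [x [-> _]]; apply: D0_half; exact: subspace_typeP.
move=> [s [m [[x [ex _]] mb ->]]].
rewrite /= raddf_sum; apply: (subspaceD (W := half sigma)).
  by rewrite ex; apply: D0_half; exact: subspace_typeP.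
apply: (subspace_sum (W := half sigma)) => a /residues_int ha.
by apply: half_step => //; apply: IH (mb a).
Qed.

(** The first components along the branches at the root, corrected by [D1], sum to
    an element of [D1]. Seen from the branch at [a], all the other branches and
    the root edge lie in the half-tree in front of it; hence the component
    along this branch is in [I+ cap I-], and induction applies. *)
Lemma half_ball_D1 n (u : pair_rep) : half_ball w graph0 n u ->
  D1_space w sigma u.1 -> graph1 u.
Proof.
elim: n u => [|n IH] u; first exact: graph0_D1.
move=> [s [m [gs mb eu]]] hu; apply: (graph0_D1 _ hu); rewrite eu.
have PN : normI F (Pi w) := Pi_normI w.
suff hm a : a \in residues F -> D1_space w sigma (m a).1.
  apply: (subspaceD (W := graph0)) => //; apply: (subspace_sum (W := graph0)) => a ar.
  rewrite act_step_bruhat; apply: graph0_stable.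
    by apply/maxK_KZ/maxK_bruhat/residues_int.
  by apply/graph1_graph0/graph1_stable => //; apply: IH (mb a) (hm a ar).
move=> ar; have [x [ex _]] := gs.
have [d [n' [hd hn' exd]]] := D0_decomp (subspace_typeP x).
pose z a := n' a + Pi w <.> (m a).1.
have hz b : exists2 y, half sigma y & z b = Pi w <.> y.
  have [_ [y hy ey]] := hn' b; exists (y + (m b).1).
    by apply: (subspaceD (W := half sigma)) => //; apply: half_ball_fst (mb b).
  by rewrite linearD -ey.
have ez : (d - u.1) + \sum_(b <- residues F) bruhat b <.> z b = 0.
  have : u.1 = d + \sum_(b <- residues F) bruhat b <.> z b.
    rewrite [in LHS]eu /= raddf_sum /= ex exd -addrA -big_split /=; congr (_ + _).
    apply: eq_bigr => b _; rewrite /z linearD; congr (_ + _).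
    by rewrite act_step_bruhat.
  by move=> ->; rewrite opprD addrA subrr add0r addNr.
(* [z b] is the component along the branch at [b], so it lies in [I-]; what
   remains is that it lies in [I+]. *)
suff hza : half sigma (z a).
  apply: D1_Pi; have -> : Pi w <.> (m a).1 = z a - n' a by rewrite /z addrC addKr.
  by apply: subspace_sub => //; split=> //; have [y hy ->] := hz a; exists y.
(* The matrix [c] is the inverse of [bruhat a]. *)
have aO := residues_int ar; pose c := mat2 0 1 1 (- a).
have cb b : c *m bruhat b = lower (b - a).
  by rewrite mat2M; congr mat2; ring.
have cK : maxK F c.
  apply/maxK_mat2; rewrite mul0r mulr1 sub0r; split; last first.
    by rewrite /int_unit oppr_eq0 oner_neq0 valN1.
  by split; [exact: vge0|exact: int1|exact: int1|exact: vgeN].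
have cG := GL2_maxK cK.
have not1 (b : F) : ~~ vge b 1 -> forall g : 'M_2, g 1 0 = b -> ~ iwahori F g.
  by move=> hb g eg [_]; rewrite eg; apply/negP.
have one_n1 : ~~ vge (1 : F) 1.
  by have := int_unit1 F; rewrite int_unitE => /andP[].
have cI : ~ iwahori F c by apply: (not1 1 one_n1); rewrite mat2s.
have e : c <.> (d - u.1) +
    (z a + \sum_(b <- residues F | b != a) c <.> bruhat b <.> z b) = 0.
  transitivity (c <.> ((d - u.1) + \sum_(b <- residues F) bruhat b <.> z b)); last first.
    by rewrite ez linear0.
  rewrite [RHS]linearD; congr (_ + _).
  rewrite (bigD1_seq a) ?residues_uniq //= [RHS]linearD /= linear_sum /=; congr (_ + _).
  rewrite actM; [|exact: cG|exact: GL2_bruhat].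
  by rewrite cb subrr lower0 rep_act1.
move: e; rewrite addrCA => /eqP; rewrite addr_eq0 => /eqP->.
apply: (subspaceN (W := half sigma)); apply: (subspaceD (W := half sigma)).
  have [_ [y hy ->]] : D1_space w sigma (d - u.1) by apply: subspace_sub.
  by apply: half_not_iwahori.
rewrite -big_filter.
apply: (subspace_sum (W := half sigma)) => b; rewrite mem_filter => /andP[nba br].
rewrite actM; [|exact: cG|exact: GL2_bruhat]; rewrite cb.
have bO := residues_int br; have [y hy ->] := hz b.
apply: half_not_iwahori => //; first by apply: maxK_lower; apply: vgeB.
apply: (not1 (b - a)); last by rewrite mat2s.
apply: contra nba => h; rewrite -(residue_id br) -(residue_id ar).
by apply/eqP/residue_congr.
Qed.

Definition graph : subspace pair_rep := orbit_span graph0.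

(** The two half-tree components of a vector of [W] with first component in [D1]
    have their own first components in [I+ cap I-]. *)
Lemma graph_graph1 u : graph u -> D1_space w sigma u.1 -> graph1 u.
Proof.
move=> /(orbit_span_half w graph0_stable)[y [z [hy hz ->]]] hu.
have PN : normI F (Pi w) := Pi_normI w.
have fst_half t : half graph0 t -> half sigma t.1.
  by move=> /(half_ball_exists w graph0_stable)[n]; exact: half_ball_fst.
have D1_graph1 t : half graph0 t -> D1_space w sigma t.1 -> graph1 t.
  by move=> /(half_ball_exists w graph0_stable)[n]; exact: half_ball_D1.
have hy1 : D1_space w sigma y.1.
  split; first exact: fst_half.
  have [_ [t ht et]] := hu; exists (t - z.1).
    by apply: (subspace_sub (W := half sigma)) => //; exact: fst_half.
  by rewrite linearB -et /= addrK.
apply: (subspaceD (W := graph1)); first exact: D1_graph1.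
apply: graph1_stable => //; apply: D1_graph1 => //; apply: D1_Pi.
have -> : Pi w <.> z.1 = (y + Pi w <.> z).1 - y.1 by rewrite /= addrC addKr.
exact: subspace_sub.
Qed.

Lemma graph_injective u : graph u -> u.1 = 0 -> u = 0.
Proof.
move=> gu u0; apply: (graph1_0_inj _ u0); apply: graph_graph1 => //.
by rewrite u0; exact: subspace0.
Qed.

Lemma diagram_mor_iso : rep_iso pi pi'.
Proof.
have gS : stable (GL2 F) graph by exact: orbit_span_stable.
have [v [_ v0 Dv]] := D1_vector w p_prime charC sigma sigma.
pose d : diag1 D := to_subspace Dv; pose y0 := val (mor1 f d).
have gv : graph (v, y0) by apply/orbit_span_base/graph1_graph0; exists d.
have y0n : y0 != 0.
  apply: contraNneq v0 => e; have d0 : mor1 f d = mor1 f 0.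
    by rewrite linear0; apply: val_inj.
  by rewrite -[v]/(val d) (f1_inj d0).
have P0 : exists y, graph (0, y) by exists 0; exact: (subspace0 graph).
have PP (e : C) x x' : (exists y, graph (x, y)) -> (exists y, graph (x', y)) ->
    exists y, graph (e *: x + x', y).
  move=> [y gy] [y' gy']; exists (e *: y + y').
  exact: (subspaceP (s := graph) e gy gy').
have [_ irr] := @si_irreducible _ _ _ pi.
have [|h|/choice[h hP]] := irr (Subspace P0 PP).
- by move=> g gG x [y gy]; exists (g <.> y); exact: (gS g gG _ gy).
- by case/eqP: v0; apply: h; exists y0.
have uniq_h x y : graph (x, y) -> y = h x.
  move=> gy; have := subspace_sub gy (hP x) => /graph_injective /= e.
  have /(congr1 snd) /= : ((x, y) : pair_rep) - (x, h x) = 0 by apply: e; rewrite /= subrr.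
  by move=> /eqP; rewrite subr_eq0 => /eqP.
have h_linear : linear h.
  by move=> e x x'; apply/esym/uniq_h; exact: (subspaceP (s := graph) e (hP x) (hP x')).
pose hL := GRing.isLinear.Build C pi pi' _ h h_linear.
pose hl : {linear pi -> pi'} := HB.pack h hL.
apply: (@irreducible_rep_iso _ _ _ pi pi' hl (@si_irreducible _ _ _ pi) (@si_irreducible _ _ _ pi')).
  by move=> g gG x; apply/esym/uniq_h; exact: (gS g gG _ (hP x)).
by exists v; rewrite /= -(uniq_h _ _ gv).
Qed.

End DiagramToIso.

Theorem mainTheorem5 (p : nat) (p_prime : prime p) (F : local_field p)
    (w : uniformizer F) (C : closedFieldType)
    (charC : p \in GRing.pchar C) (pi pi' : smooth_irrep F C)
    (sigma : KZ_irrep pi) (sigma' : KZ_irrep pi') :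
  rep_iso pi pi' <->
  diagram_iso (canonical_diagram w sigma) (canonical_diagram w sigma').
Proof.
split; first exact: rep_iso_diagram_iso.
by move=> [f [f' [_ _ f1K _]]]; apply: (diagram_mor_iso p_prime charC (can_inj f1K)).
Qed.
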